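(* For every nonconstant inner function $I$ and for any positive integer $n$, the equality $$\mathcal{H}\left(\tfrac{I^n(1+I)}{2}\right)=\mathcal{H}\left(\tfrac{1+I}{2}\right)$$ holds as sets.
   Context: $\mathbb{D}$ is the open unit disk, $\mathbb{T}=\partial\mathbb{D}$, and $H^2$ is the Hardy space on $\mathbb{D}$ with norm $\|\cdot\|$, identified via boundary values with a closed subspace of $L^2(\mathbb{T})$. For $\varphi\in L^\infty(\mathbb{T})$ the Toeplitz operator on $H^2$ is $T_\varphi f=P(\varphi f)$, where $P$ is the orthogonal projection of $L^2(\mathbb{T})$ onto $H^2$. For $b$ in the closed unit ball of $H^\infty$, the de Branges-Rovnyak space $\mathcal{H}(b)$ is the image of $H^2$ under $(1-T_bT_{\overline b})^{1/2}$, with the range norm defined by $\|(1-T_bT_{\overline b})^{1/2}f\|_b=\|f\|$ for $f\in(\ker(1-T_bT_{\overline b})^{1/2})^\perp$. Equality ''as sets'' means that the two spaces consist of the same functions (the norms may differ). *)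

(* Defs.v *)
From HB Require Import structures.
From mathcomp Require Export all_boot all_order all_algebra.
From mathcomp Require Export complex.
From mathcomp Require Export all_classical all_reals all_analysis.

Set Implicit Arguments.
Unset Strict Implicit.
Unset Printing Implicit Defensive.

Import Order.TTheory GRing.Theory Num.Theory.
Import numFieldNormedType.Exports.

Local Open Scope classical_set_scope.
Local Open Scope complex_scope.
Local Open Scope ring_scope.

Section DeBrangesRovnyak.
Variable R : realType.
Local Notation C := R[i].
Local Notation mu := (@lebesgue_measure R).

(* A function on the unit circle is given by its values at e^{it}, 0 <= t <= 2 pi;
   integrals are taken with respect to normalized arc length dt / (2 pi). *)
Definition expi (t : R) : C := cos t +i* sin t.

Definition arc : set R := `[0, 2 * pi]%classic.

Definition cmeasurable (g : R -> C) : Prop :=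
  measurable_fun arc (fun t => complex.Re (g t)) /\
  measurable_fun arc (fun t => complex.Im (g t)).

Definition L2 : set (R -> C) :=
  [set g | cmeasurable g /\
     mu.-integrable arc (fun t => (Normc.normc (g t) ^+ 2)%:E)].

Definition cmean (g : R -> C) : C :=
  (2 * pi)^-1%:C *
  (Rintegral mu arc (fun t => complex.Re (g t)) +i*
   Rintegral mu arc (fun t => complex.Im (g t))).

Definition L2_inner (g h : R -> C) : C := cmean (fun t => g t * (h t)^*).

(* Convergence of complex numbers is that of the normed module R[i]^o. *)
Definition power_series_on_disk (a : nat -> C) (f : C -> C) : Prop :=
  forall z : C, `|z| < 1 ->
    series (fun k => a k * z ^+ k : C^o) @ \oo --> (f z : C^o).

(* A function on the open disk is represented by its extension by 0 to the
   plane, so that Leibniz equality in H2 is equality of functions on the disk. *)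
Definition H2 : set (C -> C) :=
  [set f | (exists a : nat -> C, power_series_on_disk a f /\
              cvgn (series (fun k => Normc.normc (a k) ^+ 2))) /\
           (forall z : C, ~~ (`|z| < 1) -> f z = 0)].

(* Values off the disk are irrelevant here. *)
Definition Hinfty : set (C -> C) :=
  [set f | (exists a : nat -> C, power_series_on_disk a f) /\
           (exists M : R, forall z : C, `|z| < 1 -> Normc.normc (f z) <= M)].

Definition is_boundary_value (f : C -> C) (g : R -> C) : Prop :=
  cmeasurable g /\
  {ae mu, forall t : R, arc t ->
     (f (r%:C * expi t) : C^o) @[r --> (1 : R)^'-] --> (g t : C^o)}.

(* A measurable representative of the a.e. class of radial limits of [f]. *)
Definition boundary (f : C -> C) : R -> C :=
  xget (fun=> 0) [set g | is_boundary_value f g].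

Definition inner (I : C -> C) : Prop :=
  Hinfty I /\
  exists g : R -> C, is_boundary_value I g /\
    {ae mu, forall t : R, arc t -> `|g t| = 1}.

Definition H2_inner (f g : C -> C) : C := L2_inner (boundary f) (boundary g).

Definition H2_norm (f : C -> C) : R := Num.sqrt (complex.Re (H2_inner f f)).

(* The orthogonal projection of L2 onto the subspace of boundary values of H2,
   with the result read as a function on the disk. *)
Definition riesz_proj (g : R -> C) : C -> C :=
  xget (fun=> 0) [set h | H2 h /\
    forall k, H2 k -> L2_inner (fun t => g t - boundary h t) (boundary k) = 0].

Definition toeplitz (phi : R -> C) (f : C -> C) : C -> C :=
  riesz_proj (fun t => phi t * boundary f t).

(* Operators on H2 are functions of which only the restriction to H2 matters. *)
Definition bounded_operator (S : (C -> C) -> (C -> C)) : Prop :=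
  [/\ forall f, H2 f -> H2 (S f),
      forall (c : C) f g, H2 f -> H2 g ->
        S (fun z => c * f z + g z) = (fun z => c * S f z + S g z) &
      exists M : R, forall f, H2 f -> H2_norm (S f) <= M * H2_norm f].

Definition positive_operator (S : (C -> C) -> (C -> C)) : Prop :=
  [/\ bounded_operator S,
      forall f g, H2 f -> H2 g -> H2_inner (S f) g = H2_inner f (S g) &
      forall f, H2 f -> 0 <= H2_inner (S f) f].

Definition sqrt_operator (A : (C -> C) -> (C -> C)) : (C -> C) -> (C -> C) :=
  xget (fun=> fun=> 0) [set S | positive_operator S /\
    forall f, H2 f -> S (S f) = A f].

Definition defect_operator (b : C -> C) (f : C -> C) : C -> C :=
  fun z => f z -
    toeplitz (boundary b) (toeplitz (fun t => (boundary b t)^*) f) z.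

(* The underlying set of H(b), for b in the closed unit ball of H-infinity. *)
Definition deBranges_Rovnyak (b : C -> C) : set (C -> C) :=
  sqrt_operator (defect_operator b) @` H2.

End DeBrangesRovnyak.

(* Main.v *)
(* Let T be multiplication by I on H2, an isometry because |I| = 1 almost
   everywhere on the circle, and put Q f = |f - T T* f|^2 (a seminorm squared).
   For b_n = I^n (1 + I) / 2 the Toeplitz operator of b_n is T^n (1 + T) / 2, and
   d_n f = <(1 - b_n b_n* ) f, f> satisfies
     d_0 f = Q f / 2 + |f - T* f|^2 / 4,   d_(n+1) f = Q f + d_n (T* f).
   Since |f|^2 = |T* f|^2 + Q f, the forms d_0 f and Q f + d_0 (T* f) dominate
   each other up to constants, so by induction d_n and d_0 are equivalent. By
   Douglas' lemma the square roots of 1 - b_n b_n* and 1 - b_0 b_0* then have the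
   same range.

   That Toeplitz operators with symbols b and conj b are multiplication by b and
   its adjoint rests on Fatou's theorem: at a Lebesgue point of the boundary
   function the Poisson integral converges radially. *)
From HB Require Import structures.
Require Import Defs.
From mathcomp Require Import measurable_realfun ring lra.
Set Implicit Arguments.
Unset Strict Implicit.
Unset Printing Implicit Defensive.
Import Order.TTheory GRing.Theory Num.Theory.
Import numFieldNormedType.Exports.
Local Open Scope classical_set_scope.
Local Open Scope complex_scope.
Local Open Scope ring_scope.

(** * Hilbert spaces: square roots and ranges *)

(** Boundary functions, projections and square roots are defined by choice among the objects with a
    given property, so each choice has to be shown possible before anything can be said about it.
    Boundary functions are then determined almost everywhere and projections outright. For square
    roots the argument is different: every symmetric [S] with S^2 = A satisfies |S f|^2 = <A f, f>,
    and Douglas' lemma sees only these numbers, so whichever root is chosen has the same range.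

    The Hilbert space arguments use the real part of the scalar product, which keeps all
    inequalities in [R]. They are carried out on a subtype of functions, and the results are
    transported back to operators on all functions of the plane.

    Analyticity enters only through Taylor coefficients. Completeness, boundedness of point
    evaluations and the multiplier property of bounded functions all come from Parseval's identity
    on the circle. *)

Definition linear_map (K : pzRingType) (V W : lmodType K) (S : V -> W) :=
  forall (c : K) f g, S (c *: f + g) = c *: S f + S g.

Section LinearMap.
Context {K : pzRingType} {V W : lmodType K} {S : V -> W} (hS : linear_map S).

Lemma linear_mapD f g : S (f + g) = S f + S g.
Proof. by rewrite -[f]scale1r hS !scale1r. Qed.

Lemma linear_map0 : S 0 = 0.
Proof. by apply: (addIr (S 0)); rewrite -linear_mapD !add0r. Qed.

Lemma linear_mapZ c f : S (c *: f) = c *: S f.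
Proof. by rewrite -[c *: f]addr0 hS linear_map0 !addr0. Qed.

Lemma linear_mapN f : S (- f) = - S f.
Proof. by rewrite -scaleN1r linear_mapZ scaleN1r. Qed.

Lemma linear_mapB f g : S (f - g) = S f - S g.
Proof. by rewrite linear_mapD linear_mapN. Qed.

End LinearMap.

(* [ip] is the real part of the scalar product; together with the adjoint rule
   [ip_scalec] for complex scalars it carries the same information. *)
Record semi_inner (R : realType) (V : lmodType R[i]) (ip : V -> V -> R) : Prop :=
  SemiInner {
    ip_sym : forall f g, ip f g = ip g f;
    ip_addl : forall f g h, ip (f + g) h = ip f h + ip g h;
    ip_scalec : forall (c : R[i]) f g, ip (c *: f) g = ip f (conjc c *: g);
    ip_scaler : forall (r : R) f g, ip (r%:C *: f) g = r * ip f g;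
    ip_ge0 : forall f, 0 <= ip f f }.

Section SemiInner.
Context {R : realType} {V : lmodType R[i]} {ip : V -> V -> R}.
Hypothesis hip : semi_inner ip.

Definition ipnorm f := Num.sqrt (ip f f).
Local Notation nr := ipnorm.

Lemma ip_addr f g h : ip f (g + h) = ip f g + ip f h.
Proof. by rewrite (ip_sym hip) (ip_addl hip) ![ip _ f](ip_sym hip). Qed.

Lemma ip_scalerr (r : R) f g : ip f (r%:C *: g) = r * ip f g.
Proof. by rewrite (ip_sym hip) (ip_scaler hip) (ip_sym hip). Qed.

Lemma ip_oppl f g : ip (- f) g = - ip f g.
Proof.
have -> : - f = (-1 : R)%:C *: f by rewrite rmorphN rmorph1 scaleN1r.
by rewrite (ip_scaler hip) mulN1r.
Qed.

Lemma ip_oppr f g : ip f (- g) = - ip f g.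
Proof. by rewrite (ip_sym hip) ip_oppl (ip_sym hip). Qed.

Lemma ip_0l g : ip 0 g = 0.
Proof. by rewrite -(scale0r (0 : V)) -[0 : R[i]](rmorph0 (real_complex R)) (ip_scaler hip) mul0r. Qed.

Lemma ip_0r g : ip g 0 = 0.
Proof. by rewrite (ip_sym hip) ip_0l. Qed.

Lemma ip_subl f g h : ip (f - g) h = ip f h - ip g h.
Proof. by rewrite (ip_addl hip) ip_oppl. Qed.

Lemma ip_subr f g h : ip f (g - h) = ip f g - ip f h.
Proof. by rewrite ip_addr ip_oppr. Qed.

Definition ipE := (ip_subl, ip_subr, ip_addl hip, ip_addr, ip_oppl, ip_oppr,
  ip_scaler hip, ip_scalerr).

Lemma ipnorm_ge0 f : 0 <= nr f.
Proof. exact: sqrtr_ge0. Qed.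

Lemma ipnorm_sq f : nr f ^+ 2 = ip f f.
Proof. by rewrite /nr sqr_sqrtr ?(ip_ge0 hip). Qed.

Lemma ipnorm0 : nr 0 = 0.
Proof. by rewrite /nr ip_0l sqrtr0. Qed.

Lemma cauchy_schwarz_sq f g : ip f g ^+ 2 <= ip f f * ip g g.
Proof.
have q (t : R) : 0 <= ip f f + 2 * t * ip f g + t ^+ 2 * ip g g.
  have := ip_ge0 hip (f + t%:C *: g).
  by rewrite !ipE (ip_sym hip g f); move=> h; lra.
have fge := ip_ge0 hip f; have gge := ip_ge0 hip g.
have [g0|gn0] := eqVneq (ip g g) 0; last first.
  have := q (- ip f g / ip g g).
  have gp : 0 < ip g g by rewrite lt_neqAle eq_sym gn0.
  rewrite -(pmulr_rge0 _ gp).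
  suff -> : ip g g * (ip f f + 2 * (- ip f g / ip g g) * ip f g +
    (- ip f g / ip g g) ^+ 2 * ip g g) = ip f f * ip g g - ip f g ^+ 2 by lra.
  by field.
have [->|fg0] := eqVneq (ip f g) 0; first by rewrite expr0n /= mulr_ge0.
(* If [ip g g] vanishes, the quadratic in [t] is affine, and at this [t] it equals -1. *)
have := q (- (ip f f + 1) / (2 * ip f g)).
have -> : 2 * (- (ip f f + 1) / (2 * ip f g)) * ip f g = - (ip f f + 1).
  by field.
by rewrite g0; lra.
Qed.

Lemma cauchy_schwarz f g : `|ip f g| <= nr f * nr g.
Proof.
rewrite -(@ler_sqr _ `|ip f g|) ?nnegrE ?mulr_ge0 ?ipnorm_ge0 //.
by rewrite real_normK ?num_real // exprMn !ipnorm_sq cauchy_schwarz_sq.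
Qed.

Lemma ipnormD f g : nr (f + g) <= nr f + nr g.
Proof.
rewrite -(@ler_sqr _ (nr (f + g))) ?nnegrE ?addr_ge0 ?ipnorm_ge0 //.
rewrite sqrrD !ipnorm_sq !ipE (ip_sym hip g f).
have := le_trans (ler_norm _) (cauchy_schwarz f g).
by rewrite -mulr_natr; lra.
Qed.

Lemma ipnormZ (r : R) f : nr (r%:C *: f) = `|r| * nr f.
Proof.
by rewrite /nr !ipE mulrA -expr2 sqrtrM ?sqr_ge0 // sqrtr_sqr.
Qed.

Lemma ipnormN f : nr (- f) = nr f.
Proof. by rewrite /nr !ipE opprK. Qed.

Lemma ipnormBC f g : nr (f - g) = nr (g - f).
Proof. by rewrite -ipnormN opprB. Qed.

Lemma ipnormB f g h : nr (f - g) <= nr (f - h) + nr (h - g).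
Proof. by rewrite -{1}[f](subrK h) -addrA ipnormD. Qed.

Lemma parallelogram f g :
  nr (f - g) ^+ 2 = 2 * nr f ^+ 2 + 2 * nr g ^+ 2 - nr (f + g) ^+ 2.
Proof. by rewrite !ipnorm_sq !ipE (ip_sym hip g f); ring. Qed.

Definition ipcvg (u : nat -> V) (l : V) :=
  forall e : R, 0 < e -> exists N, forall n, (N <= n)%N -> nr (u n - l) <= e.

Definition ipcauchy (u : nat -> V) :=
  forall e : R, 0 < e -> exists N, forall m n, (N <= m)%N -> (N <= n)%N ->
    nr (u m - u n) <= e.

End SemiInner.
Arguments ipnorm {R V} ip f.
Arguments ipcvg {R V} ip u l.
Arguments ipcauchy {R V} ip u.

Record hilbert (R : realType) (V : lmodType R[i]) (ip : V -> V -> R) : Prop :=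
  Hilbert {
    hilbert_semi :> semi_inner ip;
    hilbert_def : forall f, ip f f = 0 -> f = 0;
    hilbert_complete : forall u, ipcauchy ip u -> exists l, ipcvg ip u l }.

Section Hilbert.
Context {R : realType} {V : lmodType R[i]} {ip : V -> V -> R}.
Hypothesis hH : hilbert ip.
Local Notation nr := (ipnorm ip).
Let hip : semi_inner ip := hH.
Let ipE := (@ipE _ _ _ hip).
Let nrge0 := @ipnorm_ge0 _ _ ip.

Lemma ipnorm_eq0 f : nr f <= 0 -> f = 0.
Proof.
move=> h; apply: (hilbert_def hH); rewrite -(ipnorm_sq hip).
have -> : nr f = 0 by apply: le_anti; rewrite h nrge0.
by rewrite expr0n.
Qed.

Lemma ipnorm_small f : (forall e : R, 0 < e -> nr f <= e) -> f = 0.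
Proof. by move=> h; apply: ipnorm_eq0; apply/ler_addgt0Pr => e /h; rewrite add0r. Qed.

Lemma ip_ext f g : (forall k, ip f k = ip g k) -> f = g.
Proof.
move=> h; apply/eqP; rewrite -subr_eq0; apply/eqP/(hilbert_def hH).
by rewrite (ip_subl hip) h subrr.
Qed.

(** * Square roots of 1 - B for a symmetric contraction B *)

Section SquareRoot.
Variable B : V -> V.
Hypothesis linB : linear_map B.
Hypothesis symB : forall f g, ip (B f) g = ip f (B g).
Hypothesis conB : forall f, nr (B f) <= nr f.
Let half : R[i] := (2^-1 : R)%:C.

(* The limit Y of X_0 = 0, X_(n+1) = (B + X_n^2) / 2 satisfies
   (1 - Y)^2 = 1 - B; the increments of X_n are dominated in norm by those of
   the scalar iteration for B = 1. *)
Fixpoint sqrt_iter n f :=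
  if n is m.+1 then half *: (B f + sqrt_iter m (sqrt_iter m f)) else 0.
Fixpoint sqrt_bound n : R :=
  if n is m.+1 then (1 + sqrt_bound m ^+ 2) / 2 else 0.
Local Notation X := sqrt_iter.
Local Notation x := sqrt_bound.

Lemma sqrt_iter_linear n : linear_map (X n).
Proof.
elim: n => [|n IH] c f g /=; first by rewrite scaler0 addr0.
rewrite !linB !IH [c *: (half *: _)]scalerA [c * half]mulrC -scalerA -scalerDr.
congr (_ *: _); rewrite scalerDr -!addrA; congr (_ + _).
by rewrite addrCA.
Qed.

Lemma sqrt_iter_sym n f g : ip (X n f) g = ip f (X n g).
Proof.
elim: n f g => [|n IH] f g /=; first by rewrite (ip_0l hip) (ip_0r hip).
by rewrite !ipE symB !IH.
Qed.

(** Each [X n] is a polynomial in [B]. Taking for [L] another iterate shows that the iterates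
    commute. *)
Lemma sqrt_iter_comm (L : V -> V) (linL : linear_map L) :
  (forall f, L (B f) = B (L f)) -> forall n f, L (X n f) = X n (L f).
Proof.
move=> h n; elim: n => [|n IH] f /=; first by rewrite (linear_map0 linL).
by rewrite (linear_mapZ linL) (linear_mapD linL) h !IH.
Qed.

Lemma sqrt_bound_ge0 n : 0 <= x n.
Proof. by case: n => [|n] //=; rewrite divr_ge0 ?addr_ge0 ?sqr_ge0. Qed.

Lemma sqrt_bound_le1 n : x n <= 1.
Proof.
by elim: n => [|n IH] /=; [exact: ler01|have := sqrt_bound_ge0 n; nra].
Qed.

Lemma sqrt_bound_incr n : x n <= x n.+1.
Proof. by move=> /=; have := sqr_ge0 (x n - 1); nra. Qed.

Lemma half_norm f : nr (half *: f) = nr f / 2.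
Proof. by rewrite (ipnormZ hip) ger0_norm ?invr_ge0 // mulrC. Qed.

Lemma sqrt_iter_norm n f : nr (X n f) <= x n * nr f.
Proof.
elim: n f => [|n IH] f /=; first by rewrite (ipnorm0 hip) mul0r.
rewrite half_norm.
have h1 := ipnormD hip (B f) (X n (X n f)).
have h2 := IH (X n f).
have h3 := ler_wpM2l (sqrt_bound_ge0 n) (IH f).
have := conB f.
by rewrite expr2; lra.
Qed.

(** Since the iterates commute, X_(n+2) - X_(n+1) is half of (X_(n+1) + X_n) applied to X_(n+1) -
    X_n. The scalar sequence factors in the same way, so the bound is inherited. *)
Lemma sqrt_iter_step n f : nr (X n.+1 f - X n f) <= (x n.+1 - x n) * nr f.
Proof.
elim: n f => [|n IH] f.
  rewrite /= subr0 addr0 half_norm.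
  by have := conB f; rewrite expr0n /=; lra.
have commX g : X n.+1 (X n g) = X n (X n.+1 g).
  apply: sqrt_iter_comm; first exact: sqrt_iter_linear.
  move=> k; symmetry; apply: sqrt_iter_comm => //.
have -> : X n.+2 f - X n.+1 f =
    half *: (X n.+1 (X n.+1 f - X n f) + X n (X n.+1 f - X n f)).
  rewrite {1}[X n.+2 f]/= -/(X n.+1) [X in _ - X]/= -scalerBr; congr (_ *: _).
  rewrite (linear_mapB (sqrt_iter_linear n.+1)) (linear_mapB (sqrt_iter_linear n)).
  by rewrite commX subrKA opprD addrACA subrr add0r.
rewrite half_norm.
have h1 := ipnormD hip (X n.+1 (X n.+1 f - X n f)) (X n (X n.+1 f - X n f)).
have h2 := sqrt_iter_norm n.+1 (X n.+1 f - X n f).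
have h3 := sqrt_iter_norm n (X n.+1 f - X n f).
have s0 : 0 <= x n.+1 + x n by rewrite addr_ge0 ?sqrt_bound_ge0.
have h4 := ler_wpM2l s0 (IH f).
have -> : (x n.+2 - x n.+1) = (x n.+1 + x n) * (x n.+1 - x n) / 2.
  have e1 : x n.+1 = (1 + x n ^+ 2) / 2 by [].
  have -> : x n.+2 = (1 + x n.+1 ^+ 2) / 2 by [].
  by rewrite {2}e1; move: (x n.+1) (x n) => a b; field.
by move: h1 h2 h3 h4; lra.
Qed.

Lemma sqrt_iter_diff m n f : (n <= m)%N ->
  nr (X m f - X n f) <= (x m - x n) * nr f.
Proof.
elim: m => [|m IH].
  by rewrite leqn0 => /eqP ->; rewrite !subrr mul0r (ipnorm0 hip).
rewrite leq_eqVlt => /orP[/eqP ->|]; first by rewrite !subrr mul0r (ipnorm0 hip).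
rewrite ltnS => /IH h.
have h1 := ipnormB hip (X m.+1 f) (X n f) (X m f).
by have := sqrt_iter_step m f; lra.
Qed.

Lemma sqrt_bound_cvg : exists L : R, (forall n, x n <= L) /\
  forall e, 0 < e -> exists N, forall n, (N <= n)%N -> L - x n <= e.
Proof.
pose E := range x.
have nd : nondecreasing_seq x by apply/nondecreasing_seqP; exact: sqrt_bound_incr.
have hs : has_sup E.
  by split; [exists (x 0%N), 0%N|exists 1 => _ [n _ <-]; exact: sqrt_bound_le1].
exists (sup E); split=> [n|e e0]; first by apply: ub_le_sup; [case: hs|exists n].
have [_ [N _ <-] h] := sup_adherent e0 hs.
by exists N => n /nd h2; move: h h2; lra.
Qed.

Lemma sqrt_iter_cvg : exists Y : V -> V, forall f, ipcvg ip (fun n => X n f) (Y f).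
Proof.
suff /choice[Y hY] : forall f, exists l, ipcvg ip (fun n => X n f) l by exists Y.
move=> f.
apply: (hilbert_complete hH) => e e0.
have [L [hL cL]] := sqrt_bound_cvg.
have d0 : 0 < e / (nr f + 1) by rewrite divr_gt0 // ltr_wpDl.
have [N hN] := cL _ d0.
have key m n : (N <= n)%N -> (n <= m)%N -> nr (X m f - X n f) <= e.
  move=> Nn nm; apply: le_trans (sqrt_iter_diff f nm) _.
  have h1 : x m - x n <= e / (nr f + 1) by have := hL m; have := hN _ Nn; lra.
  have h2 := ler_wpM2r (nrge0 f) h1; apply: le_trans h2 _.
  rewrite mulrAC ler_pdivrMr ?ltr_wpDl //.
  by rewrite ler_pM2l // lerDl ler01.
exists N => m n Nm Nn; have [nm|mn] := leqP n m; first exact: key.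
by rewrite (ipnormBC hip) key // ltnW.
Qed.

Theorem positive_sqrt : exists S : V -> V,
  [/\ linear_map S, forall f g, ip (S f) g = ip f (S g),
      forall f, 0 <= ip (S f) f, forall f, nr (S f) <= 2 * nr f &
      forall f, S (S f) = f - B f].
Proof.
have [Y hY] := sqrt_iter_cvg.
have cl u f g : ipcvg ip u f -> ipcvg ip u g -> f = g.
  move=> uf ug; apply/eqP; rewrite -subr_eq0; apply/eqP/ipnorm_small => e e0.
  have e2 : 0 < e / 2 by rewrite divr_gt0.
  have [N1 h1] := uf _ e2; have [N2 h2] := ug _ e2.
  have := h1 (maxn N1 N2) (leq_maxl _ _).
  have := h2 (maxn N1 N2) (leq_maxr _ _).
  have := ipnormB hip f g (u (maxn N1 N2)); rewrite (ipnormBC hip f (u _)).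
  by lra.
have contr f : nr (Y f) <= nr f.
  apply/ler_addgt0Pr => e e0; have [N /(_ N (leqnn _)) h] := hY f _ e0.
  have := ipnormB hip (Y f) 0 (X N f); rewrite !subr0 (ipnormBC hip (Y f)).
  have := sqrt_iter_norm N f; have := sqrt_bound_le1 N.
  move=> a b; have := le_trans b (ler_wpM2r (nrge0 f) a).
  by lra.
have cvD c u v f g : ipcvg ip u f -> ipcvg ip v g ->
    ipcvg ip (fun n => c%:C *: u n + v n) (c%:C *: f + g).
  move=> uf vg e e0.
  have d0 : 0 < e / (2 * (`|c| + 1)) by rewrite divr_gt0 // mulr_gt0 // ltr_wpDl.
  have e2 : 0 < e / 2 by rewrite divr_gt0.
  have [N1 h1] := uf _ d0; have [N2 h2] := vg _ e2.
  exists (maxn N1 N2) => n; rewrite geq_max => /andP[/h1 {}h1 /h2 {}h2].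
  rewrite opprD addrACA -scalerBr; apply: le_trans (ipnormD hip _ _) _.
  rewrite (ipnormZ hip).
  have h3 := ler_wpM2l (normr_ge0 c) h1.
  suff : `|c| * (e / (2 * (`|c| + 1))) <= e / 2 by lra.
  have c1 : 0 < `|c| + 1 by rewrite ltr_wpDl.
  rewrite mulrA ler_pdivrMr ?mulr_gt0 //.
  by have := normr_ge0 c; nra.
have ipcv u f g : ipcvg ip u f -> forall e : R, 0 < e ->
    exists N, forall n, (N <= n)%N -> `|ip (u n) g - ip f g| <= (e : R).
  move=> uf e e0.
  have d0 : 0 < e / (nr g + 1) by rewrite divr_gt0 // ltr_wpDl.
  have [N h] := uf _ d0; exists N => n /h {}h.
  rewrite -(ip_subl hip); apply: le_trans (cauchy_schwarz hip _ _) _.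
  apply: le_trans (ler_wpM2r (nrge0 g) h) _.
  rewrite mulrAC ler_pdivrMr ?ltr_wpDl // ler_pM2l // lerDl.
  exact: ler01.
have symY f g : ip (Y f) g = ip f (Y g).
  apply/eqP; rewrite -subr_eq0 -normr_le0; apply/ler_addgt0Pr => e e0.
  have e2 : 0 < e / 2 by rewrite divr_gt0.
  have [N1 h1] := ipcv _ _ g (hY f) _ e2.
  have [N2 h2] := ipcv _ _ f (hY g) _ e2.
  have {}h1 := h1 (maxn N1 N2) (leq_maxl _ _).
  have {}h2 := h2 (maxn N1 N2) (leq_maxr _ _).
  move: h1 h2; rewrite sqrt_iter_sym (ip_sym hip _ f) (ip_sym hip (Y g)).
  move: (ip f (X _ g)) => t.
  by rewrite !ler_norml => /andP[? ?] /andP[? ?]; apply/andP; split; lra.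
have linY : linear_map Y.
  (* Tested against [k], symmetry moves [Y] to the other side, which settles additivity; only
     complex scalars need a passage to the limit. *)
  move=> c f g; apply: ip_ext => k.
  rewrite symY !(ip_addl hip) !(ip_scalec hip); congr (_ + _); last by rewrite symY.
  rewrite symY; apply/eqP; rewrite -subr_eq0 -normr_le0.
  apply/ler_addgt0Pr => e e0.
  have e2 : 0 < e / 2 by rewrite divr_gt0.
  have [N1 h1] := ipcv _ _ (c *: f) (hY k) _ e2.
  have [N2 h2] := ipcv _ _ f (hY (conjc c *: k)) _ e2.
  have {}h1 := h1 (maxn N1 N2) (leq_maxl _ _).
  have {}h2 := h2 (maxn N1 N2) (leq_maxr _ _).
  move: h1 h2.
  rewrite (linear_mapZ (sqrt_iter_linear _)) ![ip _ f](ip_sym hip).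
  rewrite ![ip _ (c *: f)](ip_sym hip) !(ip_scalec hip).
  move: (ip f (conjc c *: X _ _)) => t.
  by rewrite !ler_norml => /andP[? ?] /andP[? ?]; apply/andP; split; lra.
(* The recursion in the limit, 2 Y = B + Y^2, which is (1 - Y)^2 = 1 - B. *)
have fixY f : Y f + Y f = B f + Y (Y f).
  apply: (cl (fun n => 2%:C *: X n.+1 f)).
    move=> e e0; have e2 : 0 < e / 2 by rewrite divr_gt0.
    have [N h] := hY f _ e2; exists N => n Nn.
    have -> : Y f + Y f = (2 : R)%:C *: Y f by rewrite rmorphD rmorph1 scalerDl scale1r.
    rewrite -scalerBr (ipnormZ hip) ger0_norm //.
    by have := h n.+1 (leqW Nn); lra.
  move=> e e0; have e2 : 0 < e / 2 by rewrite divr_gt0.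
  have [N1 h1] := hY f _ e2; have [N2 h2] := hY (Y f) _ e2.
  exists (maxn N1 N2) => n; rewrite geq_max => /andP[/h1 {}h1 /h2 {}h2].
  have -> : 2%:C *: X n.+1 f = B f + X n (X n f).
    by rewrite /= scalerA -rmorphM /= divff // rmorph1 scale1r.
  rewrite opprD addrACA subrr add0r.
  apply: le_trans (ipnormB hip _ _ (X n (Y f))) _.
  rewrite -(linear_mapB (sqrt_iter_linear n)).
  have h3 := sqrt_iter_norm n (X n f - Y f).
  have h4 := ler_wpM2r (nrge0 (X n f - Y f)) (sqrt_bound_le1 n).
  by lra.
exists (fun f => f - Y f); split.
- move=> c f g; rewrite linY scalerBr opprD -!addrA; congr (_ + _).
  by rewrite addrCA.
- by move=> f g; rewrite !ipE symY.
- move=> f; rewrite !ipE -(ipnorm_sq hip).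
  have h1 := le_trans (ler_norm _) (cauchy_schwarz hip (Y f) f).
  have := ler_wpM2r (nrge0 f) (contr f); rewrite -expr2.
  by lra.
- move=> f; have := ipnormD hip f (- Y f); rewrite (ipnormN hip).
  by have := contr f; lra.
- move=> f; rewrite (linear_mapB linY) opprB addrA.
  have -> : f - B f = f - (Y f + Y f - Y (Y f)) by rewrite fixY addrK.
  by rewrite opprB opprD !addrA [f + Y (Y f) - _]addrAC.
Qed.

End SquareRoot.

(* The bounded case of the Riesz theorem is [S = id]; in general the functional
   lives on the range of [S], and is extended by minimising
   |S f|^2 - 2 phi f. *)
Theorem range_representation (S : V -> V) (phi : V -> R) (M : R) :
  linear_map S -> (forall (r : R) f g, phi (r%:C *: f + g) = r * phi f + phi g) ->
  (forall f, `|phi f| <= M * nr (S f)) ->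
  exists k, forall f, phi f = ip (S f) k.
Proof.
move=> linS linphi bphi.
have phi0 : phi 0 = 0.
  by have := linphi 1 0 0; rewrite scaler0 addr0; lra.
have phiZ r f : phi (r%:C *: f) = r * phi f.
  by rewrite -[_ *: f]addr0 linphi phi0 addr0.
pose J (f : V) : R := nr (S f) ^+ 2 - 2 * phi f.
have Jlb f : - M ^+ 2 <= J f.
  have := le_trans (ler_norm _) (bphi f); rewrite /J.
  have := sqr_ge0 (nr (S f) - M); nra.
pose E := [set - J f | f in [set: V]].
have hs : has_sup E.
  split; first by exists (- J 0), 0.
  by exists (M ^+ 2) => _ [f _ <-]; have := Jlb f; lra.
pose m := - sup E.
have mlb f : m <= J f.
  by rewrite /m lerNl; apply: ub_le_sup; [case: hs|exists f].
have minex (n : nat) : exists f, J f <= m + n.+1%:R^-1.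
  have n0 : 0 < n.+1%:R^-1 :> R by rewrite invr_gt0.
  have [_ [f _ <-] h] := sup_adherent n0 hs.
  by exists f; rewrite /m; move: (sup E) (J f) (n.+1%:R^-1) h => a b c; lra.
have [u hu] := choice minex.
(* The parallelogram law, with [J] at least [m] at the midpoint of [u p] and [u q]. It is the images
   under [S] that form a Cauchy sequence. *)
have diffu p q : nr (S (u p) - S (u q)) ^+ 2 <= 2 * p.+1%:R^-1 + 2 * q.+1%:R^-1.
  rewrite (parallelogram hip).
  have := mlb ((2^-1 : R)%:C *: (u p + u q)).
  rewrite /J (linear_mapZ linS) (ipnormZ hip) (linear_mapD linS) phiZ.
  have -> : phi (u p + u q) = phi (u p) + phi (u q).
    by have := linphi 1 (u p) (u q); rewrite rmorph1 scale1r mul1r.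
  rewrite ger0_norm ?invr_ge0 // exprMn.
  have := hu p; have := hu q; rewrite /J.
  move: (nr (S (u p) + S (u q)) ^+ 2) => a.
  have -> : (2^-1 : R) ^+ 2 = 4^-1 by rewrite exprVn -natrX.
  by move: p.+1%:R^-1 q.+1%:R^-1 (m) => b c d; lra.
have invsmall (e : R) : 0 < e -> exists N, forall n, (N <= n)%N -> n.+1%:R^-1 <= e.
  move=> e0; have [N _ hN] := near_infty_natSinv_lt (PosNum e0).
  by exists N => n Nn; apply: ltW; apply: hN.
have [k hk] : exists l, ipcvg ip (fun n => S (u n)) l.
  apply: (hilbert_complete hH) => e e0.
  have [N hN] : exists N, forall n, (N <= n)%N -> n.+1%:R^-1 <= e ^+ 2 / 4.
    by apply: invsmall; rewrite divr_gt0 ?exprn_gt0.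
  exists N => p q /hN hp /hN hq.
  rewrite -(@ler_sqr _ (nr _)) ?nnegrE ?nrge0 ?(ltW e0) //.
  by move: (diffu p q) hp hq; move: p.+1%:R^-1 q.+1%:R^-1 => b c; lra.
exists k => f.
(* The first variation of [J]. The limit [k] may lie outside the range of [S], so [J] is perturbed
   at [u n] and the inequality passes to the limit. *)
have var (t : R) : 0 <= 2 * t * (ip (S f) k - phi f) + t ^+ 2 * ip (S f) (S f).
  apply/ler_addgt0Pr => e e0.
  have d0 : 0 < e / (2 * (2 * `|t| * nr (S f) + 1)).
    by rewrite divr_gt0 // mulr_gt0 // ltr_wpDl // !mulr_ge0 // nrge0.
  have [N1 h1] := invsmall _ (divr_gt0 e0 (ltr0n R 2)).
  have [N2 h2] := hk _ d0.
  pose n := maxn N1 N2.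
  have {}h1 := h1 n (leq_maxl _ _); have {}h2 := h2 n (leq_maxr _ _).
  have := mlb (t%:C *: f + u n); have := hu n.
  rewrite /J linphi linS !(ipnorm_sq hip) !ipE (ip_sym hip (S (u n))).
  have := cauchy_schwarz hip (S f) (S (u n) - k).
  rewrite (ip_subr hip) => h3.
  have h4 : `|2 * t * (ip (S f) (S (u n)) - ip (S f) k)| <= e / 2.
    rewrite normrM normrM ger0_norm //.
    apply: le_trans (ler_wpM2l _ h3) _; first by rewrite mulr_ge0.
    rewrite mulrA; apply: le_trans (ler_wpM2l _ h2) _.
      by rewrite !mulr_ge0 ?nrge0.
    set a := 2 * `|t| * nr (S f).
    have a0 : 0 <= a by rewrite !mulr_ge0 ?nrge0.
    rewrite mulrA ler_pdivrMr; last by rewrite mulr_gt0 // ltr_wpDl.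
    by nra.
  move: h4 h1; rewrite ler_norml => /andP[h4 h5].
  by move: n.+1%:R^-1 (m) => b c; lra.
apply/eqP; rewrite -subr_eq0; set d := phi f - _.
have dE : ip (S f) k - phi f = - d by rewrite opprB.
rewrite dE in var.
have s0 := ip_ge0 hip (S f).
(* The 1 in the denominator covers the case S f = 0. *)
have := var (d / (ip (S f) (S f) + 1)).
have s1 : 0 < ip (S f) (S f) + 1 by lra.
set s := ip (S f) (S f) in s0 s1 *.
rewrite -(pmulr_rge0 _ (exprn_gt0 2 s1)).
have -> : (s + 1) ^+ 2 * (2 * (d / (s + 1)) * - d + (d / (s + 1)) ^+ 2 * s) =
   - (d ^+ 2 * (s + 2)).
  by field; rewrite gt_eqF.
rewrite oppr_ge0 pmulr_lle0; last by lra.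
by move=> h; rewrite -sqrf_eq0 eq_le h sqr_ge0.
Qed.

Lemma adjoint_exists (T : V -> V) (M : R) : linear_map T ->
  (forall f, nr (T f) <= M * nr f) ->
  exists Ta : V -> V, forall f g, ip (T f) g = ip f (Ta g).
Proof.
move=> linT bT.
suff /choice[Ta h] : forall g, exists k, forall f, ip (T f) g = ip f k by exists Ta.
move=> g.
apply: (@range_representation id (fun f => ip (T f) g) (M * nr g)) => //.
- by move=> r f k; rewrite linT !ipE.
- move=> f; apply: le_trans (cauchy_schwarz hip _ _) _.
  by rewrite mulrAC ler_wpM2r ?nrge0.
Qed.

Lemma adjoint_linear (T Ta : V -> V) : linear_map T ->
  (forall f g, ip (T f) g = ip f (Ta g)) -> linear_map Ta.
Proof.
move=> linT adj c f g; apply: ip_ext => k.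
rewrite ![ip _ k](ip_sym hip) (ip_addr hip) -!adj (ip_addr hip); congr (_ + _).
rewrite (ip_sym hip _ (c *: f)) (ip_scalec hip) -(linear_mapZ linT).
by rewrite (ip_sym hip) adj (ip_scalec hip) conjcK.
Qed.

(** Douglas' lemma: f -> <S1 f, h> is bounded by a multiple of |S2 f|, hence of the form <S2 f, k>,
    and symmetry of both operators turns this into the equation for [k]. *)
Theorem range_inclusion (S1 S2 : V -> V) (M : R) :
  linear_map S1 -> linear_map S2 ->
  (forall f g, ip (S1 f) g = ip f (S1 g)) ->
  (forall f g, ip (S2 f) g = ip f (S2 g)) ->
  (forall f, ip (S1 f) (S1 f) <= M ^+ 2 * ip (S2 f) (S2 f)) -> 0 <= M ->
  forall h, exists k, S1 h = S2 k.
Proof.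
move=> lin1 lin2 sym1 sym2 le12 M0 h.
have [k hk] : exists k, forall f, ip (S1 f) h = ip (S2 f) k.
  apply: (@range_representation S2 (fun f => ip (S1 f) h) (M * nr h)) => //.
    by move=> r f g; rewrite lin1 !ipE.
  move=> f; apply: le_trans (cauchy_schwarz hip _ _) _.
  rewrite mulrAC ler_wpM2r ?nrge0 //.
  rewrite -(@ler_sqr _ (nr (S1 f))) ?nnegrE ?mulr_ge0 ?nrge0 //.
  by rewrite exprMn !(ipnorm_sq hip).
exists k; apply: ip_ext => f.
by rewrite ![ip _ f](ip_sym hip) -sym1 -sym2 hk.
Qed.

End Hilbert.

(** * The quadratic forms 1 - b b* for b = T^n (1 + T) / 2 *)

Section IsometryDefect.
Context {R : realType} {V : lmodType R[i]} {ip : V -> V -> R}.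
Hypothesis hip : semi_inner ip.
Variables T Ta : V -> V.
Hypothesis isoT : forall f g, ip (T f) (T g) = ip f g.
Hypothesis adjT : forall f g, ip (T f) g = ip f (Ta g).
Hypothesis linT : linear_map T.
Hypothesis linTa : linear_map Ta.
Let ipE := (@ipE _ _ _ hip).

(** The adjoint of T^n (1 + T) / 2, applied to [f]. *)
Definition avg_adj n f : V :=
  (2^-1 : R)%:C *: (iter n Ta f + iter n Ta (Ta f)).

Definition defect n f : R := ip f f - ip (avg_adj n f) (avg_adj n f).

Let q f : R := ip (f - T (Ta f)) (f - T (Ta f)).

(** Pythagoras: T Ta is the orthogonal projection onto the range of [T], and [T] preserves the norm
    of [Ta f]. *)
Lemma ip_split f : ip f f = ip (Ta f) (Ta f) + q f.
Proof.
rewrite /q !ipE isoT (ip_sym hip f (T _)) adjT.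
by lra.
Qed.

Lemma ip_sub_le f g : ip (f - g) (f - g) <= 2 * ip f f + 2 * ip g g.
Proof. by have := ip_ge0 hip (f + g); rewrite !ipE (ip_sym hip g f); lra. Qed.

Lemma defectS n f : defect n.+1 f = q f + defect n (Ta f).
Proof.
have -> : defect n.+1 f = ip f f - ip (avg_adj n (Ta f)) (avg_adj n (Ta f)).
  by rewrite /defect /avg_adj !iterSr.
by rewrite /defect ip_split; lra.
Qed.

(** The parallelogram law expresses |f + Ta f|^2 through |f - Ta f|^2, and |f|^2 - |Ta f|^2 is
    [q f]. *)
Lemma defect0 f :
  defect 0 f = q f / 2 + ip (f - Ta f) (f - Ta f) / 4.
Proof.
rewrite /defect /avg_adj /= !ipE (ip_sym hip (Ta f) f).
by have := ip_split f; lra.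
Qed.

Lemma q_ge0 f : 0 <= q f. Proof. exact: ip_ge0. Qed.

Lemma q_sub f g : q (f - g) <= 2 * q f + 2 * q g.
Proof.
rewrite /q (linear_mapB linTa) (linear_mapB linT).
have -> : f - g - (T (Ta f) - T (Ta g)) = (f - T (Ta f)) - (g - T (Ta g)).
  by rewrite !opprB !addrA -!(addrAC _ (- g)) addrAC.
exact: ip_sub_le.
Qed.

Lemma defect_le n : exists c : R, forall f, defect n f <= c * defect 0 f.
Proof.
elim: n => [|n [c hc]]; first by exists 1 => f; rewrite mul1r.
have c0 : 0 <= `|c| := normr_ge0 c.
exists (2 + 5 * `|c|) => f; rewrite defectS.
have d0 g : 0 <= defect 0 g.
  by rewrite defect0; have := q_ge0 g; have := ip_ge0 hip (g - Ta g); lra.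
(* Put u = f - Ta f. Then Ta f = f - u gives q (Ta f) <= 2 q f + 2 q u, and |u|^2 = |Ta u|^2 + q u
   controls both q u and |Ta u|^2. The total is at most q f + |u|^2, within the constant 5. *)
have h : defect 0 (Ta f) <= 5 * defect 0 f.
  rewrite !defect0.
  have e : Ta f = f - (f - Ta f) by rewrite opprB addrC subrK.
  have := q_sub f (f - Ta f); rewrite -e.
  have := ip_split (f - Ta f); rewrite (linear_mapB linTa).
  have := ip_ge0 hip (Ta f - Ta (Ta f)); have := q_ge0 f.
  have := q_ge0 (f - Ta f); lra.
have h1 := hc (Ta f).
have h2 : c * defect 0 (Ta f) <= `|c| * defect 0 (Ta f).
  by rewrite ler_wpM2r // ler_norm.
have h3 := ler_wpM2l c0 h.
have h4 : q f <= 2 * defect 0 f.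
  by rewrite defect0; have := ip_ge0 hip (f - Ta f); lra.
by lra.
Qed.

Lemma defect_ge n : exists c : R, forall f, defect 0 f <= c * defect n f.
Proof.
(* Nonnegativity of [defect n] joins the induction because enlarging the constant in front of it
   must preserve the inequality. *)
suff [c [c0 [_ hc]]] : exists c : R, 0 <= c /\ (forall f, 0 <= defect n f) /\
    forall f, defect 0 f <= c * defect n f by exists c.
have d0 g : 0 <= defect 0 g.
  by rewrite defect0; have := q_ge0 g; have := ip_ge0 hip (g - Ta g); lra.
elim: n => [|n [c [c0 [dn hc]]]].
  by exists 1; split=> //; split=> // f; rewrite mul1r.
exists (1 + 2 * c); split; first by lra.
split=> f; first by rewrite defectS addr_ge0 ?q_ge0.
rewrite defectS.
(* With u = f - Ta f, |u|^2 = |Ta u|^2 + q u and q u <= 2 q f + 2 q (Ta f); the terms in Ta f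
   recombine into [defect 0 (Ta f)]. *)
have h : defect 0 f <= q f + 2 * defect 0 (Ta f).
  rewrite !defect0.
  have := q_sub f (Ta f).
  have := ip_split (f - Ta f); rewrite (linear_mapB linTa).
  have := q_ge0 (Ta f); have := ip_ge0 hip (Ta f - Ta (Ta f)); lra.
have h1 := hc (Ta f); have h2 := dn (Ta f); have h3 := q_ge0 f.
have h4 := mulr_ge0 c0 h3.
by lra.
Qed.

End IsometryDefect.

(** * Poisson integrals on the circle *)

Section ArcIntegral.
Context {R : realType}.
Local Notation mu := (@lebesgue_measure R).
Local Notation arc := (@Defs.arc R).
Implicit Types U W : R -> R.

Definition arcL1 U := mu.-integrable arc (EFin \o U).
Definition arcint U : R := Rintegral mu arc U.

Lemma measurable_arc : measurable (arc : set (measurableTypeR R)).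
Proof. exact: measurable_itv. Qed.
Hint Resolve measurable_arc : core.

Lemma mu_arc : mu arc = (2 * pi)%:E.
Proof.
rewrite /Defs.arc lebesgue_measure_itv /= lte_fin mulr_gt0 ?pi_gt0 //.
by rewrite -EFinB subr0.
Qed.

Lemma arcL1_meas U : arcL1 U -> measurable_fun arc U.
Proof. by move=> /integrableP[/measurable_EFinP]. Qed.

Lemma arcL1D U W : arcL1 U -> arcL1 W -> arcL1 (fun s => U s + W s).
Proof. by move=> hU hW; exact: (integrableD measurable_arc hU hW). Qed.

Lemma arcL1N U : arcL1 U -> arcL1 (fun s => - U s).
Proof. by move=> hU; rewrite /arcL1; apply: (integrableN hU). Qed.

Lemma arcL1B U W : arcL1 U -> arcL1 W -> arcL1 (fun s => U s - W s).
Proof. by move=> hU hW; apply: arcL1D hU (arcL1N hW). Qed.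

Lemma arcL1Z (c : R) U : arcL1 U -> arcL1 (fun s => c * U s).
Proof. by move=> hU; exact: (integrableZl measurable_arc c hU). Qed.

Lemma arcL1_norm U : arcL1 U -> arcL1 (fun s => `|U s|).
Proof. by move=> hU; rewrite /arcL1; apply: (integrable_norm hU). Qed.

Lemma arcL1_le U W : measurable_fun arc U -> arcL1 W ->
  (forall s, arc s -> `|U s| <= W s) -> arcL1 U.
Proof.
move=> mU hW h; apply: (le_integrable measurable_arc _ _ hW) => //.
  exact/measurable_EFinP.
by move=> s /h h1 /=; rewrite lee_fin (le_trans h1) // ler_norm.
Qed.

Lemma arcL1_cst (c : R) : arcL1 (fun=> c).
Proof.
apply: measurable_bounded_integrable => //.
- have h : (mu arc < +oo)%E by rewrite mu_arc ltry.
  exact: h.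
- by exists `|c|; split=> [|M hM s _]; [exact: num_real|exact: ltW].
Qed.

Lemma arcL1M (M : R) (h : R -> R) U : measurable_fun arc h ->
  (forall s, arc s -> `|h s| <= M) -> arcL1 U -> arcL1 (fun s => h s * U s).
Proof.
move=> mh bh hU; apply: (@arcL1_le _ (fun s => M * `|U s|)).
- apply: measurable_funM => //; exact: arcL1_meas.
- exact/arcL1Z/arcL1_norm.
- by move=> s /bh hs; rewrite normrM ler_wpM2r.
Qed.

Lemma continuous_measurable_arc (h : R -> R) : continuous h -> measurable_fun arc h.
Proof. by move=> ch; apply: measurable_funTS; exact: continuous_measurable_fun. Qed.

Lemma arcL1_continuous (h : R -> R) : continuous h -> arcL1 h.
Proof.
move=> ch; apply: continuous_compact_integrable; first exact: segment_compact.
exact: continuous_subspaceT.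
Qed.

Lemma arcintD U W : arcL1 U -> arcL1 W ->
  arcint (fun s => U s + W s) = arcint U + arcint W.
Proof. exact: RintegralD. Qed.

Lemma arcintB U W : arcL1 U -> arcL1 W ->
  arcint (fun s => U s - W s) = arcint U - arcint W.
Proof. exact: RintegralB. Qed.

Lemma arcintZ (c : R) U : arcL1 U -> arcint (fun s => c * U s) = c * arcint U.
Proof. exact: RintegralZl. Qed.

Lemma arcintN U : arcL1 U -> arcint (fun s => - U s) = - arcint U.
Proof.
move=> hU; rewrite -mulN1r -arcintZ //; congr arcint.
by apply/funext => s; rewrite mulN1r.
Qed.

Lemma arcint_le U W : arcL1 U -> arcL1 W -> (forall s, arc s -> U s <= W s) ->
  arcint U <= arcint W.
Proof. exact: le_Rintegral. Qed.

Lemma arcint_ge0 U : (forall s, arc s -> 0 <= U s) -> 0 <= arcint U.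
Proof. by move=> h; apply: Rintegral_ge0. Qed.

Lemma arcint_norm U : arcL1 U -> `|arcint U| <= arcint (fun s => `|U s|).
Proof. exact: le_normr_Rintegral. Qed.

Lemma arcint_cst (c : R) : arcint (fun=> c) = c * (2 * pi).
Proof.
by rewrite /arcint Rintegral_cst //; congr (_ * _); have := mu_arc => /= ->.
Qed.

Lemma arcint_ext U W : (forall s, arc s -> U s = W s) -> arcint U = arcint W.
Proof. by move=> h; apply: eq_Rintegral => s /set_mem /h. Qed.

Definition ae_arc (P : R -> Prop) := {ae mu, forall t, arc t -> P t}.

Lemma ae_arcS (P Q : R -> Prop) : (forall t, arc t -> P t -> Q t) ->
  ae_arc P -> ae_arc Q.
Proof.
move=> h; apply: (@filterS _ _ (ae_filter_ringOfSetsType mu)) => t ht ta.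
exact: h (ht ta).
Qed.

Lemma ae_arcI (P Q : R -> Prop) : ae_arc P -> ae_arc Q -> ae_arc (fun t => P t /\ Q t).
Proof.
move=> hP hQ.
apply: (@filterS _ _ (ae_filter_ringOfSetsType mu)
  _ _ _ (@filterI _ _ (ae_filter_ringOfSetsType mu) _ _ hP hQ)) => t [h1 h2] ta.
by split; [exact: h1|exact: h2].
Qed.

Lemma ae_arc_all (P : R -> Prop) : (forall t, arc t -> P t) -> ae_arc P.
Proof. by move=> h; apply: (@filterE _ _ (ae_filter_ringOfSetsType mu)). Qed.

(** The endpoints form a null set; away from them small balls around [t] stay inside [arc]. *)
Lemma ae_arc_interior (P : R -> Prop) :
  {ae mu, forall t, 0 < t < 2 * pi -> P t} -> ae_arc P.
Proof.
move=> hP; have h0 : {ae mu, forall t, t <> 0 /\ t <> 2 * pi}.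
  exists ([set 0] `|` [set 2 * pi]); split.
  - by apply: measurableU; exact: measurable_set1.
  - by apply: countable_lebesgue_measure0; apply: finite_set_countable; rewrite finite_setU; split; exact: finite_set1.
  - by move=> t /= ht; apply: contrapT => h1; apply: ht; split=> e; apply: h1; [left|right].
apply: (@filterS _ _ (ae_filter_ringOfSetsType mu)
  _ _ _ (@filterI _ _ (ae_filter_ringOfSetsType mu) _ _ hP h0)) => t [h1 [h2 h3]].
rewrite /Defs.arc /= in_itv /= => /andP[t0 t1]; apply: h1.
by rewrite !lt_neqAle t0 t1 !andbT eq_sym; apply/andP; split; apply/eqP.
Qed.

Lemma arcint_ae U W : measurable_fun arc U -> measurable_fun arc W ->
  ae_arc (fun s => U s = W s) -> arcint U = arcint W.
Proof.
move=> mU mW h; rewrite /arcint /Rintegral; congr fine; apply: ae_eq_integral => //.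
- exact/measurable_EFinP.
- exact/measurable_EFinP.
- by apply: (@filterS _ _ (ae_filter_ringOfSetsType mu) _ _ _ h) => s h1 /h1 /= ->.
Qed.

(** Lebesgue differentiation for the extension of [U] by zero. The radius [h] keeps the balls inside
    [arc], where the extension agrees with [U]. *)
Lemma lebesgue_pt_arc U : arcL1 U ->
  {ae mu, forall t, 0 < t < 2 * pi -> forall e : R, 0 < e ->
    exists2 h : R, 0 < h & (forall s, `|t - s| < h -> arc s) /\
     forall r, 0 < r -> r <= h ->
       arcint (fun s => \1_(ball t r) s * `|U s - U t|) <= e * r}.
Proof.
move=> hU; pose V := U \_ arc.
have iV : mu.-integrable setT (EFin \o V).
  have := (@integrable_mkcond _ (measurableTypeR R) R mu arc (EFin \o U) measurable_arc).1 hU.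
  by congr (_.-integrable _ _); apply/funext => s; rewrite /V /= !patchE; case: ifP.
have lV : locally_integrable setT V by apply: open_integrable_locally => //; exact: openT.
apply: (@filterS _ _ (ae_filter_ringOfSetsType mu) _ _ _ (lebesgue_differentiation lV)) => t Lt t2 e e0.
pose h1 := Num.min t (2 * pi - t).
have h10 : 0 < h1 by rewrite lt_min subr_gt0; case/andP: t2 => -> ->.
have arch1 s : `|t - s| < h1 -> arc s.
  rewrite lt_min !ltr_norml => /andP[/andP[a b] /andP[c d]].
  by rewrite /Defs.arc /= in_itv /=; apply/andP; split; lra.
(* The ball of radius r has length 2 r, so a mean below e / 2 is an integral below e r. *)
have e4 : (0 < (e / 2)%:E :> \bar R)%E by rewrite lte_fin divr_gt0.
have near_t : \forall r \near (0:R)^'+, (davg V t r < (e / 2)%:E)%E.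
  have := Lt [set y | (y < (e / 2)%:E)%E]; apply.
  exact: (open_ereal_lt' e4).
have [h2 /= h20 hh2] := near_t.
exists (Num.min h1 (h2 / 2)); first by rewrite lt_min h10 divr_gt0.
split=> [s|r r0]; first by rewrite lt_min => /andP[/arch1].
rewrite le_min => /andP[rh1 rh2].
have : (davg V t r < (e / 2)%:E)%E.
  apply: hh2 => //=; rewrite sub0r normrN gtr0_norm //.
  by apply: le_lt_trans rh2 _; rewrite ltr_pdivrMr //; lra.
have ballarc s : ball t r s -> arc s by move=> bs; apply: arch1; apply: lt_le_trans bs rh1.
have tarc : arc t by apply: arch1; rewrite subrr normr0.
have Vt : V t = U t by rewrite /V patchE mem_set.
have mb : measurable (ball t r) by exact: measurable_ball.
pose F s : R := \1_(ball t r) s * `|U s - U t|.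
have iF : arcL1 F.
  apply: (@arcL1M 1).
  - exact: measurable_indic.
  - by move=> s _; rewrite indicE; case: (_ \in _); rewrite ?normr1 ?normr0.
  - by apply: arcL1_norm; apply: arcL1B => //; exact: arcL1_cst.
have FE : (\int[mu]_(y in ball t r) `|((center (V t) \o V) y)%:E| = \int[mu]_(s in arc) (F s)%:E)%E.
  have -> : ball t r = arc `&` ball t r.
    by apply/seteqP; split=> [s bs|s []//]; split=> //; exact: ballarc.
  rewrite integral_mkcondr; apply: eq_integral => s _; rewrite patchE.
  case: ifPn => sb; rewrite /F indicE.
    rewrite sb mul1r /= Vt.
    by have -> : V s = U s by rewrite /V patchE mem_set //; apply: ballarc; exact: set_mem.
  by rewrite (negbTE sb) mul0r.
rewrite /davg /iavg FE lebesgue_measure_ball ?(ltW r0) //.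
have Ffin : (\int[mu]_(s in arc) (F s)%:E)%E \is a fin_num by exact: integrable_fin_num.
rewrite -(fineK Ffin) inver mulrn_eq0 /= gt_eqF // -EFinM lte_fin.
rewrite mulrC ltr_pdivrMr ?mulrn_wgt0 // => /ltW.
by have -> : e / 2 * (r *+ 2) = e * r by rewrite -mulr_natr; field.
Qed.

End ArcIntegral.
#[global] Hint Resolve measurable_arc : core.

(** * The Poisson kernel and its averages at Lebesgue points *)

Section Poisson.
Context {R : realType}.
Local Notation arc := (@Defs.arc R).
Implicit Types U W : R -> R.

Lemma arcint_cos (m : nat) (phi : R) : (0 < m)%N ->
  arcint (fun s => cos (m%:R * s + phi)) = 0.
Proof.
move=> m0; have mR : (m%:R : R) != 0 by rewrite pnatr_eq0 -lt0n.
pose F s : R := m%:R^-1 * sin (m%:R * s + phi).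
have dF (x : R) : is_derive x 1 F (cos (m%:R * x + phi)).
  rewrite /F; apply: trigger_derive.
  by rewrite /GRing.scale /= !mulr1 addr0 mulrCA mulVf // mulr1.
have cF : continuous F.
  by move=> x; apply/differentiable_continuous/derivable1_diffP; apply: ex_derive.
have cf : continuous (fun s : R => cos (m%:R * s + phi)).
  move=> x; apply: (@continuous_comp _ _ _ (fun s : R => m%:R * s + phi) cos).
    by apply: cvgD; [apply: cvgM; [exact: cvg_cst|exact: cvg_id]|exact: cvg_cst].
  exact: continuous_cos.
rewrite /arcint /Rintegral /Defs.arc (@continuous_FTC2 _ _ F).
- rewrite -EFinB /= /F mulr0 add0r -mulrBr.
  have -> : (m%:R : R) * (2 * pi) + phi = phi + (pi *+ 2) *+ m.
    by rewrite addrC -[pi *+ 2 *+ m]mulr_natl -[pi *+ 2]mulr_natl.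
  by rewrite (periodicn (@sinD2pi R)) subrr mulr0.
- by rewrite mulr_gt0 // pi_gt0.
- exact: continuous_subspaceT.
- split.
  + by move=> x _; apply: ex_derive.
  + by apply: cvg_at_right_filter; exact: cF.
  + by apply: cvg_at_left_filter; exact: cF.
- by move=> x _; rewrite derive1E; apply: derive_val.
Qed.

(** This is |1 - r e^(i th)|^2. *)
Definition poisson_denom (r th : R) := 1 - 2 * r * cos th + r ^+ 2.
Definition poisson (r th : R) := (1 - r ^+ 2) / poisson_denom r th.
(** A partial sum of the Fourier series of the Poisson kernel, the constant term being split off. *)
Definition poisson_sum (N : nat) (r th : R) :=
  1 + \sum_(k < N) 2 * r ^+ k.+1 * cos (k.+1%:R * th).

Lemma poisson_denomE r th :
  poisson_denom r th = (1 - r) ^+ 2 + 2 * r * (1 - cos th).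
Proof. by rewrite /poisson_denom; ring. Qed.

Lemma poisson_denom_ge r th : 0 <= r -> (1 - r) ^+ 2 <= poisson_denom r th.
Proof.
by move=> r0; rewrite poisson_denomE lerDl !mulr_ge0 // subr_ge0 cos_le1.
Qed.

Lemma poisson_denom_gt0 r th : 0 <= r < 1 -> 0 < poisson_denom r th.
Proof.
move=> /andP[r0 r1]; apply: lt_le_trans (poisson_denom_ge th r0).
by rewrite exprn_gt0 // subr_gt0.
Qed.

Lemma poisson_ge0 r th : 0 <= r < 1 -> 0 <= poisson r th.
Proof.
move=> h; rewrite divr_ge0 ?(ltW (poisson_denom_gt0 th h)) //.
by case/andP: h => r0 r1; rewrite subr_ge0 expr_le1 // ltW.
Qed.

(** After multiplication by the denominator, the three-term recurrence for cos (k th) makes the sum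
    telescope to its ends. *)
Lemma poisson_telescope N r th : poisson_denom r th * poisson_sum N r th =
  1 - r ^+ 2 - 2 * r ^+ N.+1 * cos (N.+1%:R * th) + 2 * r ^+ N.+2 * cos (N%:R * th).
Proof.
elim: N => [|N IH].
  by rewrite /poisson_sum big_ord0 mul0r cos0 mul1r /poisson_denom; ring.
rewrite /poisson_sum big_ord_recr /= addrA mulrDr IH /poisson_denom.
have -> : cos (N.+2%:R * th) = 2 * cos th * cos (N.+1%:R * th) - cos (N%:R * th).
  have -> : N.+2%:R * th = N.+1%:R * th + th by rewrite -[N.+2]addn1 natrD; ring.
  have -> : N%:R * th = N.+1%:R * th - th by rewrite -[N.+1]addn1 natrD; ring.
  by rewrite cosD cosB; ring.
by rewrite !exprS; ring.
Qed.

(** The two end terms are at most 2 r^N each, and the denominator is at least (1 - r)^2. The bound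
    is uniform in [th], so it can be integrated against any [U]. *)
Lemma poisson_sum_diff N r th : 0 <= r < 1 ->
  `|poisson_sum N r th - poisson r th| <= 4 / (1 - r) ^+ 2 * r ^+ N.
Proof.
move=> hr; have D0 := poisson_denom_gt0 th hr.
have /andP[r0 r1] := hr.
have -> : poisson_sum N r th - poisson r th =
    (2 * r ^+ N.+2 * cos (N%:R * th) - 2 * r ^+ N.+1 * cos (N.+1%:R * th)) /
    poisson_denom r th.
  have -> : poisson_sum N r th =
     (poisson_denom r th * poisson_sum N r th) / poisson_denom r th.
    by rewrite mulrAC divff ?mul1r // gt_eqF.
  by rewrite poisson_telescope /poisson -mulrBl; congr (_ / _); ring.
rewrite normrM normfV (gtr0_norm D0) ler_pdivrMr //.
have rN : 0 <= r ^+ N by rewrite exprn_ge0.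
have h1 : `|2 * r ^+ N.+2 * cos (N%:R * th) - 2 * r ^+ N.+1 * cos (N.+1%:R * th)|
    <= 4 * r ^+ N.
  apply: le_trans (ler_normB _ _) _.
  have -> : 4 * r ^+ N = 2 * r ^+ N + 2 * r ^+ N by ring.
  have e1 (k : nat) (x : R) : `|2 * r ^+ (N + k) * cos x| <= 2 * r ^+ N.
    rewrite !normrM ger0_norm // (ger0_norm (exprn_ge0 _ r0)) exprD -mulrA.
    rewrite ler_wpM2l // -[leRHS]mulr1 -mulrA ler_wpM2l //.
    by rewrite mulr_ile1 ?normr_ge0 ?cos_max ?exprn_ge0 ?exprn_ile1 // ltW.
  have e2 x := e1 2%N x; have e3 x := e1 1%N x.
  by apply: lerD; [rewrite addn2 in e2|rewrite addn1 in e3].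
apply: le_trans h1 _.
have q0 : 0 < (1 - r) ^+ 2 by rewrite exprn_gt0 // subr_gt0.
rewrite [leRHS](_ : _ = 4 * r ^+ N * (poisson_denom r th / (1 - r) ^+ 2)); last by ring.
by rewrite ler_peMr ?mulr_ge0 // ler_pdivlMr // mul1r poisson_denom_ge.
Qed.

Lemma continuous_cos_affine (a b : R) : continuous (fun s : R => cos (a * s + b)).
Proof.
move=> x; apply: (@continuous_comp _ _ _ (fun s : R => a * s + b) cos).
  by apply: cvgD; [apply: cvgM; [exact: cvg_cst|exact: cvg_id]|exact: cvg_cst].
exact: continuous_cos.
Qed.

Lemma measurable_poisson (r t : R) : 0 <= r < 1 -> measurable_fun arc (fun s => poisson r (t - s)).
Proof.
move=> hr; apply: continuous_measurable_arc => x.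
apply: cvgM; first exact: cvg_cst.
apply: cvgV; first by rewrite gt_eqF // poisson_denom_gt0.
rewrite /poisson_denom; apply: cvgD; last exact: cvg_cst.
apply: cvgB; first exact: cvg_cst.
apply: cvgM; first exact: cvg_cst.
have cc : continuous (fun s : R => cos (t - s)).
  have -> : (fun s : R => cos (t - s)) = (fun s => cos (-1 * s + t)).
    by apply/funext => s; rewrite mulN1r addrC.
  exact: continuous_cos_affine.
exact: cc.
Qed.

Lemma poisson_le (r th : R) : 0 <= r < 1 -> `|poisson r th| <= (1 - r ^+ 2) / (1 - r) ^+ 2.
Proof.
move=> hr; rewrite ger0_norm ?poisson_ge0 //; have /andP[r0 r1] := hr.
rewrite /poisson ler_wpM2l //; first by rewrite subr_ge0 expr_le1 // ltW.
by rewrite lef_pV2 ?posrE ?poisson_denom_gt0 ?poisson_denom_ge // exprn_gt0 // subr_gt0.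
Qed.

Lemma arcL1_poisson (r t : R) U : 0 <= r < 1 -> arcL1 U ->
  arcL1 (fun s => poisson r (t - s) * U s).
Proof.
move=> hr hU; apply: arcL1M hU; first exact: measurable_poisson.
by move=> s _; exact: poisson_le.
Qed.

Lemma arcL1_cosM (a b : R) U : arcL1 U -> arcL1 (fun s => cos (a * s + b) * U s).
Proof.
apply: (@arcL1M R 1).
  by apply: continuous_measurable_arc; exact: continuous_cos_affine.
by move=> s _; exact: cos_max.
Qed.

Lemma cos_flip (k : nat) (t s : R) : cos (k%:R * (t - s)) = cos (k%:R * s + (- (k%:R * t))).
Proof. by rewrite -cosN; congr cos; ring. Qed.

Lemma arcint_poisson_sum N (r t : R) U : arcL1 U ->
  arcL1 (fun s => poisson_sum N r (t - s) * U s) /\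
  arcint (fun s => poisson_sum N r (t - s) * U s) =
  arcint U + \sum_(k < N) 2 * r ^+ k.+1 * arcint (fun s => cos (k.+1%:R * (t - s)) * U s).
Proof.
move=> hU; elim: N => [|N [IH1 IH2]].
  have e : (fun s => poisson_sum 0 r (t - s) * U s) = U.
    by apply/funext => s; rewrite /poisson_sum big_ord0 addr0 mul1r.
  by rewrite e big_ord0 addr0.
have e : (fun s => poisson_sum N.+1 r (t - s) * U s) =
    (fun s => poisson_sum N r (t - s) * U s +
      2 * r ^+ N.+1 * (cos (N.+1%:R * (t - s)) * U s)).
  apply/funext => s; rewrite /poisson_sum big_ord_recr /= addrA mulrDl.
  by congr (_ + _); rewrite mulrA.
have h : arcL1 (fun s => cos (N.+1%:R * (t - s)) * U s).
  have := arcL1_cosM N.+1%:R (- (N.+1%:R * t)) hU.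
  by under eq_fun do rewrite -cos_flip.
rewrite e; split; first by apply: arcL1D => //; exact: arcL1Z.
by rewrite arcintD // ?arcintZ //; [rewrite IH2 big_ord_recr /= addrA|exact: arcL1Z].
Qed.

Lemma poisson_series (r t : R) U : 0 <= r < 1 -> arcL1 U -> forall N,
  `|arcint U + \sum_(k < N) 2 * r ^+ k.+1 * arcint (fun s => cos (k.+1%:R * (t - s)) * U s)
    - arcint (fun s => poisson r (t - s) * U s)| <=
  4 / (1 - r) ^+ 2 * r ^+ N * arcint (fun s => `|U s|).
Proof.
move=> hr hU N; have [h1 <-] := arcint_poisson_sum N r t hU.
have h2 := arcL1_poisson t hr hU.
rewrite -arcintB //; apply: le_trans (arcint_norm (arcL1B h1 h2)) _.
rewrite -arcintZ; last exact: arcL1_norm.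
apply: arcint_le.
- exact/arcL1_norm/arcL1B.
- exact/arcL1Z/arcL1_norm.
- by move=> s _; rewrite -mulrBl normrM ler_wpM2r // poisson_sum_diff.
Qed.

Lemma geometric_small (r c e : R) : 0 <= r < 1 -> 0 < e ->
  exists N, forall n, (N <= n)%N -> c * r ^+ n <= e.
Proof.
move=> /andP[r0 r1] e0.
have h : (fun n => c * r ^+ n) @ \oo --> (0 : R).
  rewrite -[X in _ --> X](mulr0 c); apply: cvgM; first exact: cvg_cst.
  by apply: cvg_expr; rewrite ger0_norm.
move/cvgrPdist_le : h => /(_ e e0) [N _ hN].
exists N => n Nn; have := hN n Nn.
by rewrite sub0r normrN; apply: le_trans; exact: ler_norm.
Qed.

Lemma arcint_poisson (r t : R) : 0 <= r < 1 ->
  arcint (fun s => poisson r (t - s)) = 2 * pi.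
Proof.
move=> hr; have h := poisson_series t hr (arcL1_cst (1 : R)).
have c0 (k : nat) : arcint (fun s => cos (k.+1%:R * (t - s)) * 1) = 0.
  rewrite -[RHS](arcint_cos (- (k.+1%:R * t)) (ltn0Sn k)).
  by apply: arcint_ext => s _; rewrite mulr1 cos_flip.
have e1 : (fun s : R => poisson r (t - s) * 1) = (fun s => poisson r (t - s)).
  by apply/funext => s; rewrite mulr1.
rewrite e1 in h.
apply/eqP; rewrite -subr_eq0 -normr_le0; apply/ler_addgt0Pr => e e0; rewrite add0r.
have [N hN] := geometric_small (4 / (1 - r) ^+ 2 * arcint (fun=> `|1|)) hr e0.
have := h N; rewrite arcint_cst mul1r.
rewrite big1 ?addr0; last by move=> k _; rewrite c0 mulr0.
rewrite distrC => /le_trans; apply; rewrite mulrAC.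
exact: hN.
Qed.

(** The derivative of [sin] at 0 is 1, so sin x / x >= 1/2 near 0. With x = th / 2, the identity 1 -
    cos th = 2 sin^2 x produces the 8. *)
Lemma one_sub_cos_ge : exists2 h : R, 0 < h &
  forall th : R, `|th| < h -> th ^+ 2 / 8 <= 1 - cos th.
Proof.
have : (fun h : R => h^-1 *: (sin (h *: 1 + 0) - sin 0)) @ 0^' --> (1 : R).
  have d := @derivable_sin R 0.
  have := @derive_val _ _ _ _ _ _ _ (is_derive_sin (0 : R)).
  by rewrite cos0 => e; rewrite -[X in _ --> X]e; exact: d.
move=> /cvgrPdist_lt /(_ (2^-1)) [|h /= h0 hh]; first by rewrite invr_gt0.
exists h => // th hth.
have [->|thn0] := eqVneq th 0; first by rewrite expr0n /= mul0r cos0 subrr.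
have half0 : th / 2 != 0 by rewrite mulf_neq0 // invr_eq0.
have := hh (th / 2); rewrite /ball_ /= sub0r normrN sin0 subr0 addr0 /GRing.scale /= mulr1.
have th2 : `|th / 2| < h.
  by rewrite normrM [`|2^-1|]ger0_norm ?invr_ge0 //; have := normr_ge0 th; lra.
move=> /(_ th2 half0).
set x := th / 2; set y := sin x => hy.
have -> : 1 - cos th = 2 * y ^+ 2.
  have -> : th = x *+ 2 by rewrite -[x *+ 2]mulr_natl /x mulrC divfK.
  by rewrite cos_mulr2n -[_ ^+ 2 *+ 2]mulr_natl cos2sin2 -/y; ring.
have -> : th ^+ 2 / 8 = x ^+ 2 / 2 by rewrite /x exprMn; field.
have y2 : 2^-1 <= x^-1 * y.
  by move: hy; rewrite ltr_norml => /andP[_]; lra.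
have x2 : 0 < x ^+ 2 by rewrite exprn_even_gt0.
have : 4^-1 <= (x^-1 * y) ^+ 2.
  have -> : 4^-1 = (2^-1 : R) ^+ 2 by rewrite exprVn -natrX.
  by rewrite ler_sqr ?nnegrE ?invr_ge0 // (le_trans _ y2).
rewrite exprMn exprVn mulrC ler_pdivlMr //.
by lra.
Qed.

Lemma cos_le_far (q x : R) : 0 < q -> q <= x -> x <= pi -> cos x <= cos q.
Proof.
move=> q0 qx xpi; have x0 : 0 < x := lt_le_trans q0 qx.
move: qx; rewrite le_eqVlt => /orP[/eqP -> //|qx]; apply: ltW.
by rewrite ltr_cos ?in_itv /= ?(ltW q0) ?(ltW x0) ?xpi ?(le_trans (ltW qx)).
Qed.

Lemma cos_far (t h : R) : 0 < t < 2 * pi -> 0 < h -> exists2 k : R, 0 < k &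
  forall s, arc s -> h <= `|t - s| -> k <= 1 - cos (t - s).
Proof.
move=> /andP[t0 t1] h0; have pi0 := @pi_gt0 R.
(* The bounds by t and 2 pi - t keep |t - s| <= 2 pi - q for s in [arc], away from 2 pi where the
   cosine returns to 1. *)
pose q := Num.min (Num.min h pi) (Num.min t (2 * pi - t)).
have q0 : 0 < q by rewrite !lt_min h0 pi0 t0 subr_gt0 t1.
have [qh qpi qt qt'] : [/\ q <= h, q <= pi, q <= t & q <= 2 * pi - t].
  by split; rewrite /q !ge_min lexx ?orbT.
exists (1 - cos q).
  rewrite subr_gt0 -cos0.
  by rewrite ltr_cos ?in_itv /= ?lexx ?(ltW pi0) ?qpi ?(ltW q0).
move=> s; rewrite /Defs.arc /= in_itv /= => /andP[s0 s1] hs.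
rewrite lerB // -cos_norm.
have [le_pi|gt_pi] := leP `|t - s| pi.
  by apply: cos_le_far => //; exact: le_trans qh hs.
have -> : cos `|t - s| = cos (2 * pi - `|t - s|).
  rewrite -[RHS]cosN opprB; have := cosD2pi (`|t - s| - 2 * pi) => <-.
  by congr cos; rewrite -[pi *+ 2]mulr_natl; ring.
apply: cos_le_far => //; last by lra.
have : `|t - s| <= 2 * pi - q by rewrite ler_norml; apply/andP; split; lra.
by lra.
Qed.

(** The heights come from d / (d^2 + x^2): where |x| >= 2^(j-1) d it is at most 1 / (4^(j-1) d), the
    height given to the ball of radius 2^j d. *)
Fixpoint dyadic_kernel (J : nat) (d t s : R) : R :=
  if J is J'.+1 then dyadic_kernel J' d t s +
    4 / (4 ^+ J * d) * \1_(ball t (2 ^+ J * d)) s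
  else 4 / d * \1_(ball t d) s.

Lemma dyadic_kernel_ge0 J d t s : 0 < d -> 0 <= dyadic_kernel J d t s.
Proof.
move=> d0; elim: J => [|J IH] /=.
  by rewrite mulr_ge0 ?divr_ge0 ?(ltW d0) // indicE.
by rewrite addr_ge0 // mulr_ge0 ?divr_ge0 ?mulr_ge0 ?exprn_ge0 ?(ltW d0) // indicE.
Qed.

Lemma dyadic_kernel_ge J (d t s : R) : 0 < d -> `|t - s| < 2 ^+ J * d ->
  d / (d ^+ 2 + (t - s) ^+ 2) <= dyadic_kernel J d t s.
Proof.
move=> d0; have d2 : 0 < d ^+ 2 by rewrite exprn_gt0.
have th2 := sqr_ge0 (t - s).
elim: J => [|J IH] /=.
  rewrite expr0 mul1r => h; rewrite indicE mem_set //= mulr1.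
  rewrite ler_pdivrMr; last by lra.
  rewrite mulrAC ler_pdivlMr //.
  by rewrite -expr2; lra.
have [lt_J _|ge_J h] := ltP `|t - s| (2 ^+ J * d).
  apply: le_trans (IH lt_J) _; rewrite lerDl mulr_ge0 ?indicE //.
  by rewrite divr_ge0 ?mulr_ge0 ?exprn_ge0 ?(ltW d0).
rewrite -[leLHS]add0r; apply: lerD; first exact: dyadic_kernel_ge0.
rewrite indicE mem_set //= mulr1.
have h1 : 4 ^+ J * d ^+ 2 <= (t - s) ^+ 2.
  have -> : 4 ^+ J * d ^+ 2 = (2 ^+ J * d) ^+ 2.
    by rewrite exprMn -exprM mulnC exprM; congr (_ ^+ _ * _); rewrite -natrX.
  rewrite -[(t - s) ^+ 2]real_normK ?num_real //.
  by rewrite ler_sqr ?nnegrE // mulr_ge0 ?exprn_ge0 // ltW.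
have J0 : 0 < 4 ^+ J :> R by rewrite exprn_gt0.
rewrite ler_pdivrMr; last by lra.
rewrite mulrAC ler_pdivlMr ?mulr_gt0 ?exprn_gt0 //.
by rewrite exprS; nra.
Qed.

(** The ball of radius 2^j d contributes at most 4 / (4^j d) times e 2^j d, that is 4 e / 2^j; these
    add up to (8 - 4 / 2^J) e. *)
Lemma arcint_dyadic (J : nat) (d t e h : R) (W : R -> R) : arcL1 W -> 0 < d ->
  2 ^+ J * d <= h ->
  (forall r, 0 < r -> r <= h -> arcint (fun s => \1_(ball t r) s * `|W s|) <= e * r) ->
  arcL1 (fun s => dyadic_kernel J d t s * `|W s|) /\
  arcint (fun s => dyadic_kernel J d t s * `|W s|) <= (8 - 4 / 2 ^+ J) * e.
Proof.
move=> hW d0 hJ hh.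
have iB r : arcL1 (fun s => \1_(ball t r) s * `|W s|).
  apply: (@arcL1M _ 1).
  - apply: measurable_indic; exact: measurable_ball.
  - by move=> s _; rewrite indicE; case: (_ \in _); rewrite ?normr1 ?normr0.
  - exact: arcL1_norm.
elim: J hJ => [|J IH] hJ /=.
  have -> : (fun s => 4 / d * \1_(ball t d) s * `|W s|) =
    (fun s => 4 / d * (\1_(ball t d) s * `|W s|)) by apply/funext => s; rewrite mulrA.
  rewrite expr0 mul1r in hJ.
  split; first exact/arcL1Z/iB.
  rewrite arcintZ //; have := hh d d0 hJ => h1.
  have h2 : 0 <= 4 / d by rewrite divr_ge0 // ltW.
  apply: le_trans (ler_wpM2l h2 h1) _.
  rewrite mulrCA -mulrA [d^-1 * d]mulVf ?gt_eqF // expr0.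
  by lra.
have J0 : 0 < 2 ^+ J.+1 * d by rewrite mulr_gt0 ?exprn_gt0.
have {IH}[|IH1 IH2] := IH.
  by apply: le_trans hJ; rewrite ler_wpM2r ?(ltW d0) // exprS ler_peMl ?exprn_ge0 // ler1n.
have -> : (fun s => (dyadic_kernel J d t s + 4 / (4 ^+ J.+1 * d) *
     \1_(ball t (2 ^+ J.+1 * d)) s) * `|W s|) =
    (fun s => dyadic_kernel J d t s * `|W s| + 4 / (4 ^+ J.+1 * d) *
      (\1_(ball t (2 ^+ J.+1 * d)) s * `|W s|)).
  by apply/funext => s; rewrite mulrDl mulrA.
split; first exact/arcL1D/arcL1Z/iB.
rewrite arcintD //; last exact/arcL1Z/iB.
rewrite arcintZ //.
have h2 : 0 <= 4 / (4 ^+ J.+1 * d) by rewrite divr_ge0 ?mulr_ge0 ?exprn_ge0 ?(ltW d0).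
have h1 := ler_wpM2l h2 (hh _ J0 hJ).
have -> : (8 - 4 / 2 ^+ J.+1) * e = (8 - 4 / 2 ^+ J) * e +
    4 / (4 ^+ J.+1 * d) * (e * (2 ^+ J.+1 * d)).
  have -> : (4 : R) ^+ J.+1 = 2 ^+ J.+1 * 2 ^+ J.+1 by rewrite -exprMn -natrM.
  rewrite !exprS; field.
  by rewrite gt_eqF //= expf_neq0.
exact: lerD.
Qed.

Lemma dyadic_scale (d h : R) : 0 < d -> d <= h ->
  exists J : nat, 2 ^+ J * d <= h < 2 ^+ J.+1 * d.
Proof.
move=> d0 dh.
have ex : exists n, h < 2 ^+ n.+1 * d.
  have [N /(_ N (leqnn _)) hN] := @geometric_small (2^-1) h (d) ltac:(by rewrite invr_ge0 ler0n /= invf_lt1 ?ltr1n) d0.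
  exists N; move: hN; rewrite exprVn ler_pdivrMr ?exprn_gt0 // => hN.
  apply: le_lt_trans hN _; rewrite mulrC ltr_pM2r // exprS ltr_pMl ?exprn_gt0 //.
  by rewrite ltr1n.
case: (ex_minnP ex) => J hJ minJ; exists J; rewrite hJ andbT.
case: J hJ minJ => [|J] hJ minJ; first by rewrite expr0 mul1r.
by rewrite leNgt; apply/negP => /minJ; rewrite ltnn.
Qed.

(** The numerator is at most 2 (1 - r), and for r >= 1/2 the denominator is at least an eighth of (1
    - r)^2 + th^2; hence the 16. *)
Lemma poisson_near (r th : R) : 2^-1 <= r < 1 -> th ^+ 2 / 8 <= 1 - cos th ->
  poisson r th <= 16 * ((1 - r) / ((1 - r) ^+ 2 + th ^+ 2)).
Proof.
move=> /andP[r2 r1] h; have r0 : 0 <= r < 1 by apply/andP; split; lra.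
have D0 := poisson_denom_gt0 th r0.
have d2 : 0 < (1 - r) ^+ 2 by rewrite exprn_gt0 // subr_gt0.
have th2 := sqr_ge0 th.
rewrite /poisson ler_pdivrMr // mulrAC mulrA ler_pdivlMr; last by lra.
have c0 : 0 <= 1 - cos th by rewrite subr_ge0 cos_le1.
have h1 : ((1 - r) ^+ 2 + th ^+ 2) / 8 <= poisson_denom r th.
  rewrite poisson_denomE.
  have : 1 - cos th <= 2 * r * (1 - cos th) by rewrite ler_peMl //; lra.
  by lra.
have -> : 1 - r ^+ 2 = (1 - r) * (1 + r) by ring.
rewrite [leRHS](_ : _ = (1 - r) * (16 * poisson_denom r th)); last by ring.
rewrite -mulrA ler_wpM2l //; first by lra.
by nra.
Qed.

Lemma poisson_far (r th k : R) : 2^-1 <= r < 1 -> 0 < k -> k <= 1 - cos th ->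
  poisson r th <= 2 / k * (1 - r).
Proof.
move=> /andP[r2 r1] k0 h; have r0 : 0 <= r < 1 by apply/andP; split; lra.
have D0 := poisson_denom_gt0 th r0.
rewrite /poisson ler_pdivrMr //.
have h1 : k <= poisson_denom r th.
  rewrite poisson_denomE.
  have : 1 - cos th <= 2 * r * (1 - cos th) by rewrite ler_peMl //; lra.
  by have := sqr_ge0 (1 - r); lra.
have -> : 1 - r ^+ 2 = (1 - r) * (1 + r) by ring.
rewrite [leRHS](_ : _ = (1 - r) * (2 * (poisson_denom r th / k))); last by ring.
rewrite ler_wpM2l //; first by lra.
have : 1 <= poisson_denom r th / k by rewrite ler_pdivlMr // mul1r.
by lra.
Qed.

(* The dyadic kernel dominates the Poisson kernel near its peak by a
   combination of indicators of balls, so that averages over balls suffice. *)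
Theorem poisson_lebesgue_pt U (t : R) : arcL1 U -> 0 < t < 2 * pi ->
  (forall e : R, 0 < e ->
    exists2 h : R, 0 < h & (forall s, `|t - s| < h -> arc s) /\
     forall r, 0 < r -> r <= h ->
       arcint (fun s => \1_(ball t r) s * `|U s - U t|) <= e * r) ->
  forall e : R, 0 < e -> exists2 d : R, 0 < d & forall r, 1 - d < r < 1 ->
    `|(2 * pi)^-1 * arcint (fun s => poisson r (t - s) * U s) - U t| <= e.
Proof.
move=> hU t2 hL e e0.
(* 129 = 16 * 8 + 1: the factor 16 of [poisson_near] times the 8 of [arcint_dyadic], plus one share
   for the points far from [t]. *)
have e' : 0 < e / 129 by rewrite divr_gt0.
have [h2 h20 [arch hh]] := hL _ e'.
have [h1 h10 hcos] := one_sub_cos_ge.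
pose h := Num.min h1 h2.
have h0 : 0 < h by rewrite lt_min h10.
have [hle1 hle2] : h <= h1 /\ h <= h2 by split; rewrite /h ge_min lexx ?orbT.
clearbody h; have hhalf : 0 < h / 2 by rewrite divr_gt0.
(* The largest dyadic ball will have radius between h / 2 and h, so the far region lies beyond h /
   2. *)
have [k k0 hk] := cos_far t2 hhalf.
pose W s := U s - U t.
have hW : arcL1 W by apply: arcL1B => //; exact: arcL1_cst.
pose c := 2 / k * arcint (fun s => `|W s|).
have c0 : 0 <= c.
  by rewrite mulr_ge0 ?divr_ge0 ?(ltW k0) //; apply: arcint_ge0.
exists (Num.min (Num.min (2^-1) h) (e / 129 / (c + 1))).
  by rewrite !lt_min invr_gt0 ltr0n h0 /= divr_gt0 //; lra.
move=> r /andP[rd r1].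
pose d := 1 - r.
have d0 : 0 < d by rewrite subr_gt0.
have : d < Num.min (Num.min (2^-1) h) (e / 129 / (c + 1)) by rewrite /d; lra.
rewrite !lt_min => /andP[/andP[d2 dh] dc].
have hr : 2^-1 <= r < 1 by apply/andP; split; rewrite /d in d2; lra.
have hr0 : 0 <= r < 1 by apply/andP; split; rewrite /d in d2; lra.
have [J /andP[J1 J2]] := dyadic_scale d0 (ltW dh).
have [iK bK] : arcL1 (fun s => dyadic_kernel J d t s * `|W s|) /\
    arcint (fun s => dyadic_kernel J d t s * `|W s|) <= (8 - 4 / 2 ^+ J) * (e / 129).
  by apply: (@arcint_dyadic _ _ _ _ h) => // r' r0' rh; apply: hh => //; exact: le_trans hle2.
have pi1 : 1 <= 2 * pi :> R by have := @pi_ge2 R; lra.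
have pi0 : 0 < 2 * pi :> R by lra.
have -> : (2 * pi)^-1 * arcint (fun s => poisson r (t - s) * U s) - U t =
    (2 * pi)^-1 * arcint (fun s => poisson r (t - s) * W s).
  have -> : arcint (fun s => poisson r (t - s) * W s) =
      arcint (fun s => poisson r (t - s) * U s) - U t * (2 * pi).
    rewrite -(arcint_poisson t hr0) -arcintZ; last first.
      have := arcL1_poisson t hr0 (arcL1_cst (1 : R)).
      by under eq_fun do rewrite mulr1.
    rewrite -arcintB.
    - by apply: arcint_ext => s _; rewrite /W; ring.
    - exact: arcL1_poisson.
    - have := arcL1Z (U t) (arcL1_poisson t hr0 (arcL1_cst (1 : R))).
      by under eq_fun do rewrite mulr1.
  by rewrite mulrBr; congr (_ - _); rewrite mulrCA mulVf ?mulr1 // gt_eqF.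
have iP := arcL1_poisson t hr0 hW.
have iP' := arcL1_poisson t hr0 (arcL1_norm hW).
rewrite normrM gtr0_norm ?invr_gt0 //.
have bnd : arcint (fun s => poisson r (t - s) * `|W s|) <= e.
  have i1 := arcL1Z 16 iK.
  have i2 := arcL1Z (2 / k * d) (arcL1_norm hW).
  apply: (@le_trans _ _ (arcint (fun s => 16 * (dyadic_kernel J d t s * `|W s|) +
      2 / k * d * `|W s|))).
    apply: arcint_le => //; first exact: arcL1D.
    move=> s sarc; rewrite mulrA -mulrDl ler_wpM2r //.
    have [near_s|far_s] := ltP `|t - s| (2 ^+ J * d).
      have hs : `|t - s| < h1 by apply: lt_le_trans near_s (le_trans J1 hle1).
      apply: le_trans (poisson_near hr (hcos _ hs)) _.
      rewrite -[leLHS]addr0; apply: lerD; last by rewrite mulr_ge0 ?divr_ge0 ?ltW.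
      by rewrite ler_wpM2l // dyadic_kernel_ge.
    have hs : h / 2 <= `|t - s|.
      by apply: le_trans far_s; move: J2; rewrite exprS -mulrA; lra.
    apply: le_trans (poisson_far hr k0 (hk _ sarc hs)) _.
    by rewrite lerDr mulr_ge0 // dyadic_kernel_ge0.
  rewrite arcintD // !arcintZ //; last exact: arcL1_norm.
  have -> : 2 / k * d * arcint (fun s => `|W s|) = c * d by rewrite /c mulrAC.
  have h3 : c * d <= e / 129.
    move: dc; rewrite ltr_pdivlMr; last by lra.
    by move=> /ltW; apply: le_trans; rewrite mulrC ler_pM2l //; lra.
  have h4 : (8 - 4 / 2 ^+ J) * (e / 129) <= 8 * (e / 129).
    by rewrite ler_pM2r // gerBl divr_ge0 // exprn_ge0.
  by lra.
have bnd2 : `|arcint (fun s => poisson r (t - s) * W s)| <= e.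
  apply: le_trans (arcint_norm iP) _; apply: le_trans bnd.
  rewrite le_eqVlt; apply/orP; left; apply/eqP; apply: arcint_ext => s _.
  by rewrite normrM ger0_norm // poisson_ge0.
rewrite mulrC ler_pdivrMr //; apply: le_trans bnd2 _.
by rewrite ler_peMr // ltW.
Qed.

End Poisson.

(** * Boundary values of H2 functions *)

Section TrigPoly.
Context {R : realType}.
Local Notation C := R[i].
Local Notation arc := (@Defs.arc R).
Local Notation Re := (@complex.Re R).
Local Notation Im := (@complex.Im R).
Local Notation normc := Normc.normc.
Implicit Types (U W : R -> R) (c z : C) (a : nat -> C).

Lemma normc_sq z : normc z ^+ 2 = Re z ^+ 2 + Im z ^+ 2.
Proof. by case: z => x y /=; rewrite sqr_sqrtr // addr_ge0 ?sqr_ge0. Qed.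

Lemma cReD z w : Re (z + w) = Re z + Re w. Proof. by case: z w => [? ?] [? ?]. Qed.
Lemma cImD z w : Im (z + w) = Im z + Im w. Proof. by case: z w => [? ?] [? ?]. Qed.
Lemma cReM z w : Re (z * w) = Re z * Re w - Im z * Im w.
Proof. by case: z w => [? ?] [? ?]. Qed.
Lemma cImM z w : Im (z * w) = Re z * Im w + Im z * Re w.
Proof. by case: z w => [? ?] [? ?]. Qed.
Lemma cReN z : Re (- z) = - Re z. Proof. by case: z. Qed.
Lemma cImN z : Im (- z) = - Im z. Proof. by case: z. Qed.
Lemma cReJ z : Re (conjc z) = Re z. Proof. by case: z. Qed.
Lemma cImJ z : Im (conjc z) = - Im z. Proof. by case: z. Qed.

Lemma Re_sum (I : Type) (r : seq I) (P : pred I) (F : I -> C) :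
  Re (\sum_(i <- r | P i) F i) = \sum_(i <- r | P i) Re (F i).
Proof. by elim/big_rec2: _ => // i x y _ <-; rewrite cReD. Qed.

Lemma Im_sum (I : Type) (r : seq I) (P : pred I) (F : I -> C) :
  Im (\sum_(i <- r | P i) F i) = \sum_(i <- r | P i) Im (F i).
Proof. by elim/big_rec2: _ => // i x y _ <-; rewrite cImD. Qed.

Lemma complex_eq z w : Re z = Re w -> Im z = Im w -> z = w.
Proof. by case: z w => [? ?] [? ?] /= -> ->. Qed.

Lemma expiX (t : R) k : expi t ^+ k = expi (k%:R * t).
Proof.
elim: k => [|k IH]; first by rewrite expr0 mul0r /expi cos0 sin0.
rewrite exprSr IH -natr1 mulrDl mul1r /expi cosD sinD.
by apply: complex_eq; rewrite ?cReM ?cImM /=; ring.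
Qed.

Lemma normc_expi (t : R) : normc (expi t) = 1.
Proof. by rewrite /expi /= cos2Dsin2 sqrtr1. Qed.

Lemma Re_mul_expi c k (s : R) :
  Re (c * expi s ^+ k) = Re c * cos (k%:R * s) - Im c * sin (k%:R * s).
Proof. by rewrite expiX cReM. Qed.

Lemma arcL1_sum N (F : nat -> R -> R) : (forall k, arcL1 (F k)) ->
  arcL1 (fun s => \sum_(k < N) F k s).
Proof.
move=> h; elim: N => [|N IH].
  by under eq_fun do rewrite big_ord0; exact: arcL1_cst.
by under eq_fun do rewrite big_ord_recr /=; apply: arcL1D.
Qed.

Lemma arcint_sum N (F : nat -> R -> R) : (forall k, arcL1 (F k)) ->
  arcint (fun s => \sum_(k < N) F k s) = \sum_(k < N) arcint (F k).
Proof.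
move=> h; elim: N => [|N IH].
  by under eq_fun do rewrite big_ord0; rewrite arcint_cst mul0r big_ord0.
rewrite big_ord_recr /= -IH; under eq_fun do rewrite big_ord_recr /=.
by rewrite arcintD //; exact: arcL1_sum.
Qed.

Lemma arcL1_cos (m : nat) (phi : R) : arcL1 (fun s => cos (m%:R * s + phi)).
Proof. by apply: arcL1_continuous; exact: continuous_cos_affine. Qed.

(** The phases let this single orthogonality relation cover sines as well, as cosines shifted by pi
    / 2. *)
Lemma arcint_cos_cos m k (phi psi : R) : (0 < m)%N ->
  arcint (fun s => cos (m%:R * s + phi) * cos (k%:R * s + psi)) =
  (m == k)%:R * (pi * cos (phi - psi)).
Proof.
move=> m0.
(* The difference frequency has to be the natural number |m - k|, so the phase changes sign when m <
   k. *)
have e : (fun s : R => cos (m%:R * s + phi) * cos (k%:R * s + psi)) =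
    (fun s => 2^-1 * (cos ((m + k)%:R * s + (phi + psi)) +
                      cos ((maxn m k - minn m k)%:R * s +
                        (if (m < k)%N then psi - phi else phi - psi)))).
  apply/funext => s.
  have -> : cos ((maxn m k - minn m k)%:R * s +
      (if (m < k)%N then psi - phi else phi - psi)) =
      cos ((m%:R * s + phi) - (k%:R * s + psi)).
    case: ltnP => mk.
      rewrite -[RHS]cosN natrB ?(ltnW mk) //.
      by congr cos; ring.
    by rewrite natrB //; congr cos; ring.
  have -> : (m + k)%:R * s + (phi + psi) = (m%:R * s + phi) + (k%:R * s + psi).
    by rewrite natrD; ring.
  by move: (m%:R * s + phi) (k%:R * s + psi) => x y; rewrite cosD cosB; field.
rewrite e arcintZ; last by apply: arcL1D; exact: arcL1_cos.
rewrite arcintD; try exact: arcL1_cos.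
rewrite arcint_cos ?addn_gt0 ?m0 // add0r.
case: eqVneq => [<-|mk].
  rewrite maxnn minnn subnn ltnn mul1r.
  under eq_fun do rewrite mul0r add0r.
  by rewrite arcint_cst; field.
rewrite arcint_cos ?mulr0 ?mul0r //.
by case: (ltngtP m k) mk => [h _|h _|_ //]; rewrite ?subn_gt0.
Qed.

Lemma arcL1_Re_mono c k : arcL1 (fun s => Re (c * expi s ^+ k)).
Proof.
have -> : (fun s => Re (c * expi s ^+ k)) = (fun s : R => Re c * cos (k%:R * s + 0) -
    Im c * cos (k%:R * s + (- (pi / 2)))).
  by apply/funext => s; rewrite Re_mul_expi addr0 cosBpihalf.
by apply: arcL1B; apply: arcL1Z; exact: arcL1_cos.
Qed.

(** Convolution with a term of the Poisson series isolates the monomial of the same degree. Degree 0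
    carries 2 pi in place of pi and is left to [arcint_Re_mono]. *)
Lemma arcint_cos_mono m (t : R) c k : (0 < m)%N ->
  arcint (fun s => cos (m%:R * (t - s)) * Re (c * expi s ^+ k)) =
  (m == k)%:R * (pi * Re (c * expi t ^+ k)).
Proof.
move=> m0.
have -> : (fun s => cos (m%:R * (t - s)) * Re (c * expi s ^+ k)) =
  (fun s : R => Re c * (cos (m%:R * s + - (m%:R * t)) * cos (k%:R * s + 0)) -
    Im c * (cos (m%:R * s + - (m%:R * t)) * cos (k%:R * s + (- (pi / 2))))).
  by apply/funext => s; rewrite Re_mul_expi addr0 cosBpihalf cos_flip; ring.
rewrite arcintB; try by apply: arcL1Z; apply: arcL1_cosM; exact: arcL1_cos.
rewrite !arcintZ; try by apply: arcL1_cosM; exact: arcL1_cos.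
rewrite !arcint_cos_cos //; case: eqVneq => [<-|_]; last by rewrite !mul0r; ring.
by rewrite subr0 opprK cosN cosDpihalf sinN opprK Re_mul_expi; ring.
Qed.

Lemma arcint_Re_mono c k :
  arcint (fun s => Re (c * expi s ^+ k)) = (k == 0)%N%:R * (2 * pi * Re c).
Proof.
case: k => [|k].
  by under eq_fun do rewrite expr0 mulr1; rewrite arcint_cst eqxx mul1r mulrC.
have -> : (fun s => Re (c * expi s ^+ k.+1)) = (fun s : R =>
   Re c * cos (k.+1%:R * s + 0) - Im c * cos (k.+1%:R * s + (- (pi / 2)))).
  by apply/funext => s; rewrite Re_mul_expi addr0 cosBpihalf.
rewrite arcintB; try by apply: arcL1Z; exact: arcL1_cos.
by rewrite !arcintZ ?arcint_cos ?mulr0 ?subrr ?mul0r //; exact: arcL1_cos.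
Qed.

Definition trig_poly a N (s : R) : C := \sum_(k < N) a k * expi s ^+ k.

Lemma arcL1_Re_tp a N : arcL1 (fun s => Re (trig_poly a N s)).
Proof.
under eq_fun do rewrite Re_sum.
by apply: (@arcL1_sum N (fun k s => Re (a k * expi s ^+ k))) => k; exact: arcL1_Re_mono.
Qed.

Lemma arcint_Re_tp a N : (0 < N)%N ->
  arcint (fun s => Re (trig_poly a N s)) = 2 * pi * Re (a 0%N).
Proof.
move=> N0; under eq_fun do rewrite Re_sum.
rewrite (@arcint_sum N (fun k s => Re (a k * expi s ^+ k))); last first.
  by move=> k; exact: arcL1_Re_mono.
rewrite (bigD1 (Ordinal N0)) //= arcint_Re_mono eqxx mul1r big1 ?addr0 //.
move=> i hi; rewrite arcint_Re_mono; case: eqP => [i0|]; last by rewrite mul0r.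
by case/eqP: hi; apply: val_inj.
Qed.

Lemma arcint_cos_tp m (t : R) a N : (0 < m < N)%N ->
  arcint (fun s => cos (m%:R * (t - s)) * Re (trig_poly a N s)) =
  pi * Re (a m * expi t ^+ m).
Proof.
move=> /andP[m0 mN].
have -> : (fun s => cos (m%:R * (t - s)) * Re (trig_poly a N s)) =
    (fun s => \sum_(k < N) cos (m%:R * (t - s)) * Re (a k * expi s ^+ k)).
  by apply/funext => s; rewrite Re_sum mulr_sumr.
rewrite (@arcint_sum N (fun k s => cos (m%:R * (t - s)) * Re (a k * expi s ^+ k))).
  rewrite (bigD1 (Ordinal mN)) //= arcint_cos_mono // eqxx mul1r big1 ?addr0 //.
  move=> i hi; rewrite arcint_cos_mono //; case: eqP => [i0|]; last by rewrite mul0r.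
  by case/eqP: hi; apply: val_inj.
move=> k; have := arcL1_cosM m%:R (- (m%:R * t)) (arcL1_Re_mono (a k) k).
by under eq_fun do rewrite -cos_flip.
Qed.

Lemma normc_sqD z w : normc (z + w) ^+ 2 =
  normc z ^+ 2 + normc w ^+ 2 + 2 * Re (z * conjc w).
Proof. by rewrite !normc_sq cReM cReJ cImJ cReD cImD; ring. Qed.

Lemma normc_sqM z w : normc (z * w) ^+ 2 = normc z ^+ 2 * normc w ^+ 2.
Proof. by rewrite Normc.normcM exprMn. Qed.

Lemma Re_expi_conj c k m (s : R) : (k < m)%N ->
  Re (c * expi s ^+ k * conjc (expi s ^+ m)) = Re (conjc c * expi s ^+ (m - k)).
Proof.
move=> km; rewrite -{1}(subnK (ltnW km)) exprD rmorphM /=.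
have -> : c * expi s ^+ k * (conjc (expi s ^+ (m - k)) * conjc (expi s ^+ k)) =
   c * conjc (expi s ^+ (m - k)) * (expi s ^+ k * conjc (expi s ^+ k)) by ring.
have -> : expi s ^+ k * conjc (expi s ^+ k) = 1.
  by rewrite -sqr_normc expiX normc_def /= cos2Dsin2 sqrtr1 expr1n.
by rewrite mulr1 -cReJ rmorphM /= conjcK.
Qed.

(** Parseval, one coefficient at a time: a cross term is the real part of a monomial of degree N - k
    > 0, which has mean zero. *)
Lemma arcint_tp_sq a N :
  arcL1 (fun s => normc (trig_poly a N s) ^+ 2) /\
  arcint (fun s => normc (trig_poly a N s) ^+ 2) =
    2 * pi * \sum_(k < N) normc (a k) ^+ 2.
Proof.
elim: N => [|N [IH1 IH2]].
  have -> : (fun s => normc (trig_poly a 0 s) ^+ 2) = (fun=> 0).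
    by apply/funext => s; rewrite /trig_poly big_ord0 normc_sq /= expr0n addr0.
  by split; [exact: arcL1_cst|rewrite arcint_cst big_ord0 mul0r mulr0].
pose F k s := Re (conjc (a k * conjc (a N)) * expi s ^+ (N - k)).
have F1 k : arcL1 (F k) by exact: arcL1_Re_mono.
have F0 (k : 'I_N) : arcint (F k) = 0.
  by rewrite /F arcint_Re_mono subn_eq0 leqNgt ltn_ord mul0r.
have e : (fun s => normc (trig_poly a N.+1 s) ^+ 2) = (fun s =>
   normc (trig_poly a N s) ^+ 2 + (normc (a N) ^+ 2 + 2 * \sum_(k < N) F k s)).
  apply/funext => s; rewrite /trig_poly big_ord_recr /= -/(trig_poly a N s).
  rewrite normc_sqD -addrA; congr (_ + (_ + 2 * _)).
    rewrite normc_sqM; have -> : normc (expi s ^+ N) ^+ 2 = 1 :> R.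
      by rewrite expiX normc_expi expr1n.
    by rewrite mulr1.
  rewrite /trig_poly mulr_suml Re_sum; apply: eq_bigr => k _.
  rewrite /F -Re_expi_conj ?ltn_ord //; congr Re.
  by rewrite rmorphM /=; ring.
rewrite e; split.
  by apply: arcL1D => //; apply: arcL1D; [exact: arcL1_cst|exact/arcL1Z/arcL1_sum].
rewrite arcintD //; last by apply: arcL1D; [exact: arcL1_cst|exact/arcL1Z/arcL1_sum].
rewrite arcintD; [|exact: arcL1_cst|exact/arcL1Z/arcL1_sum].
rewrite arcintZ; last exact: arcL1_sum.
rewrite (arcint_sum N F1) (eq_bigr (fun=> 0)); last by move=> k _; exact: F0.
by rewrite big1 // mulr0 addr0 arcint_cst IH2 big_ord_recr /=; ring.
Qed.

(** Zeroing the first [N] coefficients presents a block of the series as a polynomial again, so that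
    Parseval applies to it. *)
Lemma trig_polyB a N M : (N <= M)%N -> forall s,
  trig_poly a M s - trig_poly a N s =
  trig_poly (fun k => if (N <= k)%N then a k else 0) M s.
Proof.
move=> NM s; rewrite /trig_poly -(subnKC NM).
rewrite big_split_ord /= [X in X - _]addrC addrK.
rewrite big_split_ord /= [X in _ = X + _]big1 ?add0r.
  by apply: eq_bigr => k _; rewrite leq_addr.
by move=> k _; rewrite leqNgt ltn_ord mul0r.
Qed.

End TrigPoly.

(** * Almost everywhere limits of sequences bounded in L2 *)

Section L2Limits.
Context {R : realType}.
Local Notation C := R[i].
Local Notation mu := (@lebesgue_measure R).
Local Notation arc := (@Defs.arc R).
Implicit Types (U V W : R -> R) (u : nat -> R -> R).

Lemma EFin_arcint U : arcL1 U -> (\int[mu]_(s in arc) (U s)%:E = (arcint U)%:E)%E.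
Proof. by move=> hU; rewrite /arcint /Rintegral fineK //; exact: (integrable_fin_num measurable_arc hU). Qed.

Lemma arcL1_sq W : measurable_fun arc W -> arcL1 (fun s => W s ^+ 2) -> arcL1 W.
Proof.
move=> mW hW; apply: (@arcL1_le _ _ (fun s => 1 + W s ^+ 2)) => //.
  by apply: arcL1D => //; exact: arcL1_cst.
move=> s _; rewrite -[W s ^+ 2]real_normK ?num_real //.
by have := sqr_ge0 (`|W s| - 1); have := sqr_ge0 (`|W s|); nra.
Qed.

(** The pointwise inequality |W| <= eta / 2 + W^2 / (2 eta) integrated over a period; optimising
    [eta] recovers Cauchy-Schwarz. *)
Lemma arcint_norm_le W (eta : R) : measurable_fun arc W ->
  arcL1 (fun s => W s ^+ 2) -> 0 < eta ->
  arcint (fun s => `|W s|) <= pi * eta + arcint (fun s => W s ^+ 2) / (2 * eta).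
Proof.
move=> mW hW e0; have iW := arcL1_sq mW hW.
have -> : pi * eta + arcint (fun s => W s ^+ 2) / (2 * eta) =
    arcint (fun s => eta / 2 + (2 * eta)^-1 * W s ^+ 2).
  rewrite arcintD; [|exact: arcL1_cst|exact: arcL1Z].
  by rewrite (arcintZ (2 * eta)^-1) // arcint_cst; field; rewrite gt_eqF.
apply: arcint_le; first exact: arcL1_norm.
  by apply: arcL1D; [exact: arcL1_cst|exact: arcL1Z].
move=> s _; rewrite -[W s ^+ 2]real_normK ?num_real //.
have -> : eta / 2 + (2 * eta)^-1 * `|W s| ^+ 2 =
    `|W s| + (2 * eta)^-1 * (`|W s| - eta) ^+ 2 by field; rewrite gt_eqF.
by rewrite lerDl mulr_ge0 ?sqr_ge0 // invr_ge0 mulr_ge0 // ltW.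
Qed.

(** Let d_j be the increments. The integrals of 2^j d_j^2 are summable, so the sum of 2^j d_j^2 is
    finite almost everywhere, and |d_j| <= 2^-j + 2^j d_j^2 makes the telescoping series absolutely
    convergent there. *)
Lemma ae_cvg_fast u (K : R) : (forall j, measurable_fun arc (u j)) ->
  (forall j, arcL1 (fun s => (u j.+1 s - u j s) ^+ 2)) ->
  (forall j, arcint (fun s => (u j.+1 s - u j s) ^+ 2) <= K * (4^-1) ^+ j) ->
  ae_arc (fun t => cvgn (fun j => u j t)).
Proof.
move=> mu_ iu bu.
pose h j t := 2 ^+ j * (u j.+1 t - u j t) ^+ 2.
have h0 j t : 0 <= h j t by rewrite mulr_ge0 ?sqr_ge0 ?exprn_ge0.
have ih j : arcL1 (h j) by apply: arcL1Z.
have mh j : measurable_fun (arc : set (measurableTypeR R)) (fun t => (h j t)%:E).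
  by apply/measurable_EFinP; exact: arcL1_meas.
pose F t := (\sum_(j <oo) (h j t)%:E)%E.
have mF : measurable_fun (arc : set (measurableTypeR R)) F.
  by apply: ge0_emeasurable_sum => // j t *; rewrite lee_fin.
have F0 t : (0 <= F t)%E by apply: nneseries_ge0 => j _ _; rewrite lee_fin.
have intF : (\int[mu]_(t in arc) F t < +oo)%E.
  rewrite /F integral_nneseries //; last by move=> j t _; rewrite lee_fin.
  have K0 : 0 <= K.
    by have := bu 0%N; rewrite expr0 mulr1; apply: le_trans; apply: arcint_ge0 => s _; exact: sqr_ge0.
  have b j : (\int[mu]_(t in arc) (h j t)%:E <= (K * 2^-1 ^+ j)%:E)%E.
    rewrite EFin_arcint // lee_fin arcintZ //; apply: le_trans (ler_wpM2l _ (bu j)) _.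
      by rewrite exprn_ge0.
    rewrite mulrCA -exprMn; have -> : (2 * 4^-1 : R) = 2^-1 by field.
    by [].
  apply: (@le_lt_trans _ _ (2 * K)%:E); last exact: ltry.
  apply: lime_le.
    by apply: is_cvg_nneseries => j _ _; apply: integral_ge0 => t _; rewrite lee_fin.
  apply: nearW => n; apply: (@le_trans _ _ (\sum_(0 <= j < n) (K * 2^-1 ^+ j)%:E)%E).
    by apply: lee_sum => j _; exact: b.
  rewrite sumEFin lee_fin -mulr_sumr mulrC ler_wpM2r //.
  elim: n => [|n IH]; first by rewrite big_geq.
  have -> : \sum_(0 <= i < n.+1) (2^-1 : R) ^+ i = 2 - 2^-1 ^+ n.
    elim: n {IH} => [|n IH]; first by rewrite big_nat1 !expr0; lra.
    by rewrite big_nat_recr //= IH exprS; lra.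
  by rewrite gerBl exprn_ge0 ?invr_ge0.
have iF : mu.-integrable arc F.
  apply/integrableP; split => //; apply: le_lt_trans intF.
  by under eq_integral do rewrite gee0_abs //.
have := integrable_ae measurable_arc iF.
apply: ae_arcS => t ta Ft.
have cs : cvgn (series (fun j => h j t)).
  apply: nondecreasing_is_cvgn.
    apply/nondecreasing_seqP => n; rewrite /series /= big_nat_recr //= lerDl.
    exact: h0.
  exists (fine (F t)) => _ [n _ <-].
  rewrite -lee_fin fineK // /series /= -sumEFin.
  by apply: nneseries_lim_ge => j _ _; rewrite lee_fin.
have cg : cvgn (series (geometric (1 : R) 2^-1)).
  apply: cvgP; apply: cvg_geometric_series.
  by rewrite ger0_norm ?invr_ge0 // invf_lt1 ?ltr1n.
pose d j := u j.+1 t - u j t.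
have cd : cvgn (series d).
  apply: normed_cvg.
  apply: (@series_le_cvg _ _ (fun j => geometric 1 2^-1 j + h j t)).
  - by move=> j; exact: normr_ge0.
  - by move=> j; rewrite addr_ge0 // mulr_ge0 // exprn_ge0 ?invr_ge0.
  - move=> j; rewrite /= mul1r /h -/(d j) exprVn.
    have q0 : 0 < 2 ^+ j :> R by rewrite exprn_gt0.
    have -> : (2 ^+ j)^-1 + 2 ^+ j * d j ^+ 2 =
       `|d j| + ((2 ^+ j)^-1 - `|d j| + 2 ^+ j * `|d j| ^+ 2).
      by rewrite real_normK ?num_real //; ring.
    rewrite lerDl -(pmulr_rge0 _ q0).
    have -> : 2 ^+ j * ((2 ^+ j)^-1 - `|d j| + 2 ^+ j * `|d j| ^+ 2) =
       (2 ^+ j * `|d j| - 2^-1) ^+ 2 + 3 / 4 by field; rewrite gt_eqF.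
    by rewrite addr_ge0 ?sqr_ge0.
  - have -> : series (fun j => geometric 1 2^-1 j + h j t) =
       series (geometric (1 : R) 2^-1) \+ series (fun j => h j t).
      by apply/funext => n; rewrite /series /= big_split.
    exact: is_cvgD.
have -> : (fun j => u j t) = (fun n => u 0%N t + series d n).
  by apply/funext => n; exact: (eq_sum_telescope (fun j => u j t) n).
by apply: is_cvgD => //; exact: is_cvg_cst.
Qed.

(** Applied with [V] a fixed partial sum: a bound on the distance from [V] along the sequence
    survives in the limit. *)
Lemma fatou_sq u U V (K : R) : (forall j, measurable_fun arc (u j)) ->
  measurable_fun arc U -> measurable_fun arc V ->
  ae_arc (fun t => (fun j => u j t) @ \oo --> U t) ->
  (forall j, arcL1 (fun s => (u j s - V s) ^+ 2)) ->
  (forall j, arcint (fun s => (u j s - V s) ^+ 2) <= K) ->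
  arcL1 (fun s => (U s - V s) ^+ 2) /\ arcint (fun s => (U s - V s) ^+ 2) <= K.
Proof.
move=> mu_ mU mV cu iu bu.
pose f j t := ((u j t - V t) ^+ 2)%:E.
have mf j : measurable_fun (arc : set (measurableTypeR R)) (f j).
  by apply/measurable_EFinP; exact: arcL1_meas.
have f0 j t : arc t -> (0 <= f j t)%E by rewrite lee_fin sqr_ge0.
have mg : measurable_fun (arc : set (measurableTypeR R)) (fun t => ((U t - V t) ^+ 2)%:E).
  by apply/measurable_EFinP; apply: measurable_funX; exact: measurable_funB.
have me : measurable_fun (arc : set (measurableTypeR R)) (fun t => limn_einf (f^~ t)).
  apply: (@emeasurable_fun_cvg _ _ _ _ (fun n t => einfs (f^~ t) n)).
    exact: measurable_fun_einfs.
  by move=> t _; rewrite limn_einf_lim; exact: is_cvg_einfs.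
have key : (\int[mu]_(t in arc) ((U t - V t) ^+ 2)%:E <= K%:E)%E.
  (* The limit exists only almost everywhere, so the integrand is replaced by the lower limit that
     Fatou's lemma controls. *)
  have -> : (\int[mu]_(t in arc) ((U t - V t) ^+ 2)%:E =
      \int[mu]_(t in arc) limn_einf (f^~ t))%E.
    apply: ae_eq_integral => //.
    move: cu; apply: ae_arcS => t _ ct /=; symmetry.
    apply: (cvg_limn_einf_sup _).1.
    apply: cvg_EFin; first by apply: nearW.
    have h : (fun j => (u j t - V t) * (u j t - V t)) @ \oo --> (U t - V t) * (U t - V t).
      by apply: cvgM; apply: cvgB => //; exact: cvg_cst.
    exact: h.
  apply: le_trans (fatou _ _ mf f0) _ => //.
  rewrite limn_einf_lim; apply: lime_le; first exact: is_cvg_einfs.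
  apply: nearW => n; apply: (@le_trans _ _ (\int[mu]_(t in arc) f n t)%E).
    by apply: ereal_inf_lbound; exists n => /=.
  by rewrite EFin_arcint // lee_fin.
have iUV : arcL1 (fun s => (U s - V s) ^+ 2).
  apply/integrableP; split => //.
  under eq_integral do rewrite gee0_abs ?lee_fin ?sqr_ge0 //.
  by apply: le_lt_trans key _; exact: ltry.
by split => //; rewrite -lee_fin -EFin_arcint.
Qed.

Lemma cvg_normcP (T : Type) (F : set_system T) (FF : Filter F) (f : T -> C) (l : C) :
  ((f : T -> C^o) @ F --> (l : C^o)) <->
  (forall e : R, 0 < e -> \forall x \near F, Normc.normc (l - f x) < e).
Proof.
split=> [/cvgrPdist_lt h e e0|h].
  have e0C : (0 : C) < e%:C by rewrite ltcR.
  by have := h _ e0C; apply: filterS => x /=; rewrite ltcR.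
(* A positive element of [C] has zero imaginary part, so the radius is real. *)
apply/cvgrPdist_lt => -[e1 e2]; rewrite ltcE /= => /andP[/eqP -> e10].
by have := h _ e10; apply: filterS => x hx; rewrite -[e1 +i* 0]/(e1%:C) ltcR.
Qed.

Lemma normc_ReIm (z : C) : `|complex.Re z| <= Normc.normc z /\
  `|complex.Im z| <= Normc.normc z /\
  Normc.normc z <= `|complex.Re z| + `|complex.Im z|.
Proof.
case: z => x y /=; set s := Num.sqrt _.
have s0 : 0 <= s by exact: sqrtr_ge0.
have s2 : s ^+ 2 = `|x| ^+ 2 + `|y| ^+ 2.
  by rewrite /s sqr_sqrtr ?addr_ge0 ?sqr_ge0 // !real_normK ?num_real.
have x0 := normr_ge0 x; have y0 := normr_ge0 y.
have q1 := sqr_ge0 `|x|; have q2 := sqr_ge0 `|y|.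
split; last split.
- by rewrite -(@ler_sqr _ `|x|) ?nnegrE // s2; lra.
- by rewrite -(@ler_sqr _ `|y|) ?nnegrE // s2; lra.
- rewrite -(@ler_sqr _ s) ?nnegrE ?addr_ge0 // s2.
  by have := mulr_ge0 x0 y0; lra.
Qed.

Lemma cvg_ReIm (T : Type) (F : set_system T) (FF : Filter F) (f : T -> C) (l : C) :
  ((f : T -> C^o) @ F --> (l : C^o)) <->
  ((fun x => complex.Re (f x)) @ F --> complex.Re l /\
   (fun x => complex.Im (f x)) @ F --> complex.Im l).
Proof.
rewrite cvg_normcP; split=> [h|[/cvgrPdist_lt h1 /cvgrPdist_lt h2] e e0].
  split; apply/cvgrPdist_lt => e e0; have := h e e0; apply: filterS => x.
    apply: le_lt_trans; rewrite -cReN -cReD.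
    by case: (normc_ReIm (l - f x)).
  apply: le_lt_trans; rewrite -cImN -cImD.
  by case: (normc_ReIm (l - f x)) => _ [].
have e2 : 0 < e / 2 by rewrite divr_gt0.
apply: (@filterS _ F FF _ _ _ (@filterI _ F FF _ _ (h1 _ e2) (h2 _ e2))) => x [a b].
have [_ [_ c]] := normc_ReIm (l - f x); apply: le_lt_trans c _.
by rewrite cReD cImD cReN cImN; lra.
Qed.

End L2Limits.

(** * Fatou's theorem for power series with square-summable coefficients *)

Section FatouH2.
Context {R : realType}.
Local Notation C := R[i].
Local Notation mu := (@lebesgue_measure R).
Local Notation arc := (@Defs.arc R).
Local Notation Re := (@complex.Re R).
Local Notation Im := (@complex.Im R).
Local Notation normc := Normc.normc.
Implicit Types (a : nat -> C) (f : C -> C).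

Lemma cReZ (x : R) (z : C) : Re (x%:C * z) = x * Re z.
Proof. by rewrite cReM /= mul0r subr0. Qed.

Definition sqsum a : R ^nat := series (fun k => normc (a k) ^+ 2).

Lemma sqsum_nd a : nondecreasing_seq (sqsum a).
Proof.
apply/nondecreasing_seqP => n.
by rewrite /sqsum /series /= big_nat_recr //= lerDl sqr_ge0.
Qed.

Lemma sqsum_ord a N : sqsum a N = \sum_(k < N) normc (a k) ^+ 2.
Proof. by rewrite /sqsum /series /= big_mkord. Qed.

Lemma sqsum_le a N : cvgn (sqsum a) -> sqsum a N <= limn (sqsum a).
Proof. by move=> h; apply: nondecreasing_cvgn_le => //; exact: sqsum_nd. Qed.

Lemma sqsum_tail a : cvgn (sqsum a) -> forall e : R, 0 < e ->
  exists N, forall n, (N <= n)%N -> limn (sqsum a) - sqsum a n <= e.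
Proof.
move=> h e e0; move/cvgrPdist_le : h => /(_ e e0) [N _ hN].
by exists N => n /hN; apply: le_trans; exact: ler_norm.
Qed.

Lemma sqsum_cut a N M : (N <= M)%N ->
  \sum_(k < M) normc (if (N <= k)%N then a k else 0) ^+ 2 = sqsum a M - sqsum a N.
Proof.
move=> NM; rewrite !sqsum_ord -(subnKC NM) !big_split_ord /= addrAC subrr add0r.
rewrite big1 ?add0r; last by move=> k _; rewrite leqNgt ltn_ord normc_sq /= expr0n addr0.
by apply: eq_bigr => k _; rewrite leq_addr.
Qed.

Lemma measurable_Re_tp a N : measurable_fun arc (fun s => Re (trig_poly a N s)).
Proof. exact: (arcL1_meas (arcL1_Re_tp a N)). Qed.

Lemma tp_diff_sq a N M : cvgn (sqsum a) -> (N <= M)%N ->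
  arcL1 (fun s => (Re (trig_poly a M s) - Re (trig_poly a N s)) ^+ 2) /\
  arcint (fun s => (Re (trig_poly a M s) - Re (trig_poly a N s)) ^+ 2) <=
    2 * pi * (limn (sqsum a) - sqsum a N).
Proof.
move=> sa NM; have [h1 h2] := arcint_tp_sq (fun k => if (N <= k)%N then a k else 0) M.
have le s : (Re (trig_poly a M s) - Re (trig_poly a N s)) ^+ 2 <=
    normc (trig_poly (fun k => if (N <= k)%N then a k else 0) M s) ^+ 2.
  by rewrite -trig_polyB // normc_sq -cReN -cReD lerDl sqr_ge0.
have i1 : arcL1 (fun s => (Re (trig_poly a M s) - Re (trig_poly a N s)) ^+ 2).
  apply: arcL1_le h1 _.
    by apply: measurable_funX; apply: measurable_funB; exact: measurable_Re_tp.
  by move=> s _; rewrite ger0_norm ?sqr_ge0.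
split => //; apply: le_trans (arcint_le i1 h1 (fun s _ => le s)) _.
rewrite h2 sqsum_cut // ler_wpM2l //; first by rewrite mulr_ge0 // pi_ge0.
by rewrite lerD2r sqsum_le.
Qed.

(** Riesz-Fischer for the real parts: along indices with tails below 4^-j the partial sums converge
    almost everywhere, and Fatou's lemma bounds the distance of the limit from every partial sum. *)
Lemma l2_limit_re a : cvgn (sqsum a) -> exists2 U : R -> R, measurable_fun arc U &
  forall N, arcL1 (fun s => (U s - Re (trig_poly a N s)) ^+ 2) /\
   arcint (fun s => (U s - Re (trig_poly a N s)) ^+ 2) <=
     2 * pi * (limn (sqsum a) - sqsum a N).
Proof.
move=> sa.
have /choice[n hn] (j : nat) : exists N, forall m, (N <= m)%N ->
    limn (sqsum a) - sqsum a m <= 4^-1 ^+ j.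
  by apply: sqsum_tail => //; rewrite exprn_gt0 // invr_gt0.
(* The sum makes the indices monotone and at least [n j]; the summand [j] makes them unbounded. *)
pose nn j := (\sum_(i < j.+1) n i + j)%N.
have nnS j : (nn j <= nn j.+1)%N.
  by rewrite /nn [in leqRHS]big_ord_recr /= leq_add // leq_addr.
have nnj j : (j <= nn j)%N by rewrite leq_addl.
have nnle i j : (i <= j)%N -> (nn i <= nn j)%N.
  move=> ij; rewrite -(subnKC ij); elim: (j - i)%N => [|k IH]; first by rewrite addn0.
  by rewrite addnS (leq_trans IH).
have nnn j : limn (sqsum a) - sqsum a (nn j) <= 4^-1 ^+ j.
  by apply: hn; rewrite /nn big_ord_recr /= -addnA addnCA leq_addr.
pose u j t := Re (trig_poly a (nn j) t).
have mu_ j : measurable_fun arc (u j) by exact: measurable_Re_tp.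
have cu : ae_arc (fun t => cvgn (fun j => u j t)).
  apply: (@ae_cvg_fast _ u (2 * pi)) => // j; first by case: (tp_diff_sq sa (nnS j)).
  apply: le_trans (tp_diff_sq sa (nnS j)).2 _.
  by rewrite ler_wpM2l // mulr_ge0 // pi_ge0.
(* The upper limit is measurable and defined for every t; [fine] sends infinite values to 0. *)
pose U t : R := fine (limn_esup (fun j => (u j t)%:E)).
have mU : measurable_fun arc U.
  apply: measurableT_comp => //.
  by apply: measurable_fun_limn_esup => j; apply/measurable_EFinP.
have cU : ae_arc (fun t => (fun j => u j t) @ \oo --> U t).
  apply: ae_arcS cu => t _ /cvg_ex[l hl].
  have hE : (fun j => (u j t)%:E) @ \oo --> l%:E.
    by apply: cvg_EFin => //; apply: nearW.
  by have [_ e] := cvg_limn_einf_sup hE; rewrite /U e.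
exists U => // N.
(* The shift puts every index [nn (j + N)] at or beyond [N], as [tp_diff_sq] demands. *)
apply: (@fatou_sq _ (fun j => u (j + N)%N) U (fun s => Re (trig_poly a N s))) => //.
- exact: measurable_Re_tp.
- apply: ae_arcS cU => t _ h.
  by rewrite (cvg_shiftn N (fun j => u j t) (nbhs (U t))).
- by move=> j; case: (@tp_diff_sq a N (nn (j + N)%N) sa) => //; rewrite (leq_trans _ (nnj _)) // leq_addl.
- by move=> j; case: (@tp_diff_sq a N (nn (j + N)%N) sa) => //; rewrite (leq_trans _ (nnj _)) // leq_addl.
Qed.

Section Coefficients.
Variables (a : nat -> C) (U : R -> R).
Hypothesis sa : cvgn (sqsum a).
Hypothesis mU : measurable_fun arc U.
Hypothesis hU : forall N, arcL1 (fun s => (U s - Re (trig_poly a N s)) ^+ 2) /\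
   arcint (fun s => (U s - Re (trig_poly a N s)) ^+ 2) <=
     2 * pi * (limn (sqsum a) - sqsum a N).

Let mD N : measurable_fun arc (fun s => U s - Re (trig_poly a N s)).
Proof. by apply: measurable_funB => //; exact: measurable_Re_tp. Qed.

Lemma l2_limit_L1 : arcL1 U.
Proof.
have h := arcL1D (arcL1_sq (mD 0%N) (hU 0%N).1) (arcL1_Re_tp a 0%N).
by move: h; under eq_fun do rewrite subrK.
Qed.

Lemma l2_limit_small (e : R) : 0 < e -> exists N0, forall N, (N0 <= N)%N ->
  arcint (fun s => `|U s - Re (trig_poly a N s)|) <= e.
Proof.
move=> e0; have pi0 := @pi_gt0 R.
pose eta := e / (2 * pi).
have eta0 : 0 < eta by rewrite divr_gt0 // mulr_gt0.
have [N hN] := sqsum_tail sa (exprn_gt0 2 eta0).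
exists N => n /hN {}hN; apply: le_trans (arcint_norm_le (mD n) (hU n).1 eta0) _.
have h1 := le_trans (hU n).2 (ler_wpM2l (ltW (mulr_gt0 (ltr0n R 2) pi0)) hN).
have -> : e = pi * eta + 2 * pi * eta ^+ 2 / (2 * eta).
  have {1}-> : e = 2 * pi * eta by rewrite /eta mulrC divfK // gt_eqF // mulr_gt0.
  by field; rewrite gt_eqF.
by rewrite lerD2l ler_pM2r // invr_gt0 mulr_gt0.
Qed.

(** Partial sums converge to [U] in L1, so integrals against a bounded [h] converge; here they are
    eventually constant. *)
Lemma l2_limit_weak (h : R -> R) (l : R) : measurable_fun arc h ->
  (forall s, `|h s| <= 1) ->
  (exists N0, forall N, (N0 <= N)%N -> arcint (fun s => h s * Re (trig_poly a N s)) = l) ->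
  arcint (fun s => h s * U s) = l.
Proof.
move=> mh bh [N0 hl]; apply/eqP; rewrite -subr_eq0 -normr_le0.
apply/ler_addgt0Pr => e e0; rewrite add0r.
have [N1 hN] := l2_limit_small e0.
pose N := maxn N0 N1.
rewrite -(hl N) ?leq_maxl //.
have i1 : arcL1 (fun s => h s * U s) by apply: (@arcL1M _ 1) => //; exact: l2_limit_L1.
have i2 : arcL1 (fun s => h s * Re (trig_poly a N s)).
  by apply: (@arcL1M _ 1) => //; exact: arcL1_Re_tp.
rewrite -arcintB //; apply: le_trans (arcint_norm (arcL1B i1 i2)) _.
apply: le_trans (hN N (leq_maxr _ _)).
apply: arcint_le.
- exact/arcL1_norm/arcL1B.
- by apply/arcL1_norm/arcL1B; [exact: l2_limit_L1|exact: arcL1_Re_tp].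
- by move=> s _; rewrite -mulrBr normrM ler_piMl.
Qed.

Lemma l2_limit_mean : arcint U = 2 * pi * Re (a 0%N).
Proof.
have := @l2_limit_weak (fun=> 1) (2 * pi * Re (a 0%N)).
have -> : (fun s => 1 * U s) = U by apply/funext => s; rewrite mul1r.
apply => //; first by move=> s; rewrite normr1.
exists 1%N => N N0; rewrite -(arcint_Re_tp a N0); apply: arcint_ext => s _.
by rewrite mul1r.
Qed.

Lemma l2_limit_coef m (t : R) : (0 < m)%N ->
  arcint (fun s => cos (m%:R * (t - s)) * U s) = pi * Re (a m * expi t ^+ m).
Proof.
move=> m0; apply: l2_limit_weak.
- have -> : (fun s => cos (m%:R * (t - s))) = (fun s : R => cos (m%:R * s + - (m%:R * t))).
    by apply/funext => s; rewrite cos_flip.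
  by apply: continuous_measurable_arc; exact: continuous_cos_affine.
- by move=> s; exact: cos_max.
- by exists m.+1 => N mN; apply: arcint_cos_tp; rewrite m0.
Qed.

Lemma normC_radius (r t : R) : 0 <= r < 1 -> `|r%:C * expi t| < 1.
Proof.
move=> /andP[r0 r1]; rewrite normrM -[`|expi t|]/((normc (expi t))%:C) normc_expi mulr1.
by rewrite normc_def /= expr0n addr0 sqrtr_sqr ger0_norm // ltcR.
Qed.

Lemma poisson_power_series (f : C -> C) (r t : R) : power_series_on_disk a f ->
  0 <= r < 1 ->
  arcint (fun s => poisson r (t - s) * U s) = 2 * pi * Re (f (r%:C * expi t)).
Proof.
move=> psf hr; have L1U := l2_limit_L1.
have /cvg_ReIm[hre _] := psf _ (normC_radius t hr).
have h := poisson_series t hr L1U.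
(* The mean and N cosine terms make up N + 1 Taylor terms; the 2 in the Poisson series compensates
   for pi against 2 pi in the coefficients. *)
have e N : arcint U + \sum_(k < N) 2 * r ^+ k.+1 *
    arcint (fun s => cos (k.+1%:R * (t - s)) * U s) =
    2 * pi * Re (series (fun k => a k * (r%:C * expi t) ^+ k) N.+1).
  rewrite /series /= big_mkord Re_sum big_ord_recl l2_limit_mean [RHS]mulrDr.
  congr (_ + _); first by rewrite expr0 mulr1.
  rewrite mulr_sumr; apply: eq_bigr => k _.
  rewrite l2_limit_coef // exprMn -rmorphXn /= mulrCA.
  by rewrite /= /bump leq0n add1n [in RHS]mulrCA cReZ; ring.
apply/eqP; rewrite -subr_eq0 -normr_le0; apply/ler_addgt0Pr => d d0; rewrite add0r.
have d2 : 0 < d / 2 by rewrite divr_gt0.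
have [N1 hN1] := geometric_small (4 / (1 - r) ^+ 2 * arcint (fun s => `|U s|)) hr d2.
have p0 : 0 < 2 * pi :> R by rewrite mulr_gt0 // pi_gt0.
move/cvgrPdist_le : hre => /(_ _ (divr_gt0 d2 p0)) [N2 _ hN2].
pose N := maxn N1 N2.
have h1 := h N; have h2 := hN1 N (leq_maxl _ _).
have h3 := hN2 N.+1 (leqW (leq_maxr _ _)).
rewrite e [X in _ <= X]mulrAC in h1.
have {}h1 := le_trans h1 h2.
set x := Re (series _ _) in h1 h3.
have h4 : `|2 * pi * Re (f (r%:C * expi t)) - 2 * pi * x| <= d / 2.
  rewrite -mulrBr normrM (gtr0_norm p0).
  by apply: le_trans (ler_wpM2l (ltW p0) h3) _; rewrite mulrCA divff ?mulr1 // gt_eqF.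
move: h1 h4; rewrite !ler_norml => /andP[b1 b2] /andP[b3 b4].
by apply/andP; split; lra.
Qed.

Lemma radial_limit_re (f : C -> C) : power_series_on_disk a f ->
  ae_arc (fun t => (fun r : R => Re (f (r%:C * expi t))) @ (1 : R)^'- --> U t).
Proof.
move=> psf; apply: ae_arc_interior.
apply: (@filterS _ _ (ae_filter_ringOfSetsType mu) _ _ _ (lebesgue_pt_arc l2_limit_L1)).
move=> t ht t2; apply/cvgrPdist_le => e e0.
have [d d0 hd] := poisson_lebesgue_pt l2_limit_L1 t2 (ht t2) e0.
(* The bound by 1 keeps r positive. *)
exists (Num.min d 1); first by rewrite /= lt_min d0 ltr01.
move=> r /=; rewrite lt_min => /andP[rd r1] rlt1.
have hr : 1 - d < r < 1.
  by move: rd; rewrite rlt1 andbT ltr_norml => /andP[]; lra.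
have hr0 : 0 <= r < 1.
  by move: r1; rewrite rlt1 andbT ltr_norml => /andP[]; lra.
have := hd r hr; rewrite (poisson_power_series t psf hr0) mulrA mulVf ?mul1r.
  by rewrite distrC.
by rewrite mulf_neq0 // gt_eqF // pi_gt0.
Qed.

End Coefficients.

(** The right side exceeds the left by eta^-1 |eta z - w|^2. With [eta] small it serves as a
    triangle inequality for squared L2 norms. *)
Lemma normc_sq_peter (eta : R) (z w : C) : 0 < eta ->
  normc (z + w) ^+ 2 <= (1 + eta) * normc z ^+ 2 + (1 + eta^-1) * normc w ^+ 2.
Proof.
move=> e0; rewrite !normc_sq cReD cImD.
have key (x y : R) : (x + y) ^+ 2 <= (1 + eta) * x ^+ 2 + (1 + eta^-1) * y ^+ 2.
  have -> : (1 + eta) * x ^+ 2 + (1 + eta^-1) * y ^+ 2 =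
    (x + y) ^+ 2 + eta^-1 * (eta * x - y) ^+ 2 by field; rewrite gt_eqF.
  by rewrite lerDl mulr_ge0 ?sqr_ge0 // invr_ge0 ltW.
by have := key (Re z) (Re w); have := key (Im z) (Im w); lra.
Qed.

(* The L2 limit of the partial sums is the radial limit almost everywhere,
   since radial limits are Poisson averages. *)
Theorem fatou_H2 a f : cvgn (sqsum a) -> power_series_on_disk a f ->
  exists g, [/\ is_boundary_value f g, L2 g &
    arcint (fun s => normc (g s) ^+ 2) = 2 * pi * limn (sqsum a)].
Proof.
move=> sa psf.
(* The real part of -i f is the imaginary part of f, so the real case applied to [a] and [b] covers
   both parts. *)
pose b k := - 'i%C * a k.
have nb k : normc (b k) ^+ 2 = normc (a k) ^+ 2.
  by rewrite /b normc_sqM normc_sq /= oppr0 expr0n add0r sqrrN expr1n mul1r.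
have sbE : sqsum b = sqsum a by congr series; apply/funext.
have sb : cvgn (sqsum b) by rewrite sbE.
have ReNi (z : C) : Re (- 'i%C * z) = Im z.
  by rewrite cReM /= oppr0 mul0r sub0r mulN1r opprK.
have psb : power_series_on_disk b (fun z => - 'i%C * f z).
  move=> z /psf; rewrite !cvg_ReIm.
  have -> : (series (fun k => b k * z ^+ k) : nat -> C) =
      (fun n => - 'i%C * series (fun k => a k * z ^+ k) n).
    apply/funext => n; rewrite /series /= mulr_sumr.
    by apply: eq_bigr => k _; rewrite mulrA.
  move=> [h1 h2]; rewrite ReNi.
  have ImNi (w : C) : Im (- 'i%C * w) = - Re w.
    by rewrite cImM /= oppr0 mul0r add0r mulN1r.
  split; first by under eq_fun do rewrite ReNi.
  by rewrite ImNi; under eq_fun do rewrite ImNi; exact: cvgN.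
have tpb N s : Re (trig_poly b N s) = Im (trig_poly a N s).
  rewrite -ReNi; congr Re; rewrite /trig_poly mulr_sumr.
  by apply: eq_bigr => k _; rewrite mulrA.
have [U mU hU] := l2_limit_re sa; have [V mV hV] := l2_limit_re sb.
pose g t := U t +i* V t.
have rad : ae_arc (fun t => (f (r%:C * expi t) : C^o) @[r --> (1 : R)^'-] --> (g t : C^o)).
  have := ae_arcI (radial_limit_re sa mU hU psf) (radial_limit_re sb mV hV psb).
  apply: ae_arcS => t _ [h1 h2]; apply/cvg_ReIm; split=> //.
  by under eq_fun do rewrite -ReNi.
pose D N s := normc (g s - trig_poly a N s) ^+ 2.
have DE N : D N = (fun s => (U s - Re (trig_poly a N s)) ^+ 2 + (V s - Re (trig_poly b N s)) ^+ 2).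
  by apply/funext => s; rewrite /D normc_sq cReD cImD cReN cImN tpb.
have iD N : arcL1 (D N) by rewrite DE; apply: arcL1D; [case: (hU N)|case: (hV N)].
have bD N : arcint (D N) <= 4 * pi * (limn (sqsum a) - sqsum a N).
  rewrite DE arcintD; [|by case: (hU N)|by case: (hV N)].
  by have := (hU N).2; have := (hV N).2; rewrite sbE; lra.
have ig : arcL1 (fun s => normc (g s) ^+ 2).
  have := iD 0%N; congr arcL1; apply/funext => s.
  by rewrite /D /trig_poly big_ord0 subr0.
exists g; split => //.
have [iT T] := (fun N => (arcint_tp_sq a N).1, fun N => (arcint_tp_sq a N).2).
pose G := arcint (fun s => normc (g s) ^+ 2).
pose S := 2 * pi * limn (sqsum a).
have pi0 := @pi_gt0 R.
have p2 : 0 <= 2 * pi :> R by rewrite mulr_ge0 // pi_ge0.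
have TN N : arcint (fun s => normc (trig_poly a N s) ^+ 2) = 2 * pi * sqsum a N.
  by rewrite sqsum_ord T.
have G0 : 0 <= G by apply: arcint_ge0 => s _; exact: sqr_ge0.
have S0 : 0 <= S.
  apply: le_trans (_ : 2 * pi * sqsum a 0%N <= _).
    by rewrite sqsum_ord big_ord0 mulr0.
  exact: ler_wpM2l p2 _ _ (sqsum_le _ sa).
(* The squared norms of [g] and of a partial sum bound each other up to 1 + eta and a multiple of
   their squared distance. Equality follows as N grows and then [eta] tends to 0. *)
have step1 (eta : R) N : 0 < eta ->
    G <= (1 + eta) * (2 * pi * sqsum a N) + (1 + eta^-1) * arcint (D N).
  move=> e0; rewrite -TN -!arcintZ // -arcintD; try exact: arcL1Z.
  apply: arcint_le => //; first by apply: arcL1D; exact: arcL1Z.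
  by move=> s _; have := normc_sq_peter (trig_poly a N s) (g s - trig_poly a N s) e0; rewrite addrC subrK.
have step2 (eta : R) N : 0 < eta ->
    2 * pi * sqsum a N <= (1 + eta) * G + (1 + eta^-1) * arcint (D N).
  move=> e0; rewrite -TN -!arcintZ // -arcintD; try exact: arcL1Z.
  apply: arcint_le => //; first by apply: arcL1D; exact: arcL1Z.
  move=> s _; have := normc_sq_peter (g s) (trig_poly a N s - g s) e0; rewrite addrC subrK.
  by rewrite /D -[trig_poly a N s - g s]opprB normcN.
have lim (x y : R) : 0 <= y ->
    (forall eta : R, 0 < eta -> forall e : R, 0 < e -> x <= (1 + eta) * y + e) -> x <= y.
  move=> y0 h; apply/ler_addgt0Pr => e e0.
  have e2 : 0 < e / 2 by rewrite divr_gt0.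
  have y1 : 0 < y + 1 by lra.
  have := h (e / 2 / (y + 1)) (divr_gt0 e2 y1) _ e2.
  rewrite mulrDl mul1r.
  have : e / 2 / (y + 1) * y <= e / 2.
    by rewrite mulrAC ler_pdivrMr // ler_pM2l //; lra.
  by lra.
have small (eta : R) : 0 < eta -> forall e : R, 0 < e -> exists N,
    (1 + eta^-1) * arcint (D N) <= e /\ S - 2 * pi * sqsum a N <= e.
  move=> e0 e e1.
  have q0 : 0 < 1 + eta^-1 by rewrite addr_gt0 // invr_gt0.
  pose k := Num.min (e / (1 + eta^-1) / (4 * pi)) (e / (2 * pi)).
  have k0 : 0 < k by rewrite lt_min !divr_gt0 // mulr_gt0.
  have [N /(_ N (leqnn _)) hN] := sqsum_tail sa k0.
  move: hN; rewrite le_min => /andP[b1 b2]; exists N; split.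
    rewrite mulrC -ler_pdivlMr //; apply: le_trans (bD N) _.
    by rewrite mulrC -ler_pdivlMr // mulr_gt0.
  by rewrite /S -mulrBr mulrC -ler_pdivlMr // mulr_gt0.
apply: le_anti; apply/andP; split.
  apply: lim => // eta e0 e e1; have [N [h1 _]] := small _ e0 _ e1.
  have := step1 eta N e0.
  have : (1 + eta) * (2 * pi * sqsum a N) <= (1 + eta) * S.
    rewrite ler_wpM2l //; first lra.
    exact: ler_wpM2l p2 _ _ (sqsum_le _ sa).
  by rewrite -/G -/S; lra.
apply: lim => // eta e0 e e1.
have e2 : 0 < e / 2 by rewrite divr_gt0.
have [N [h1 h2]] := small _ e0 _ e2.
by have := step2 eta N e0; rewrite -/G -/S; lra.
Qed.

End FatouH2.

(** * Boundary functions and the scalar product they induce *)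

Section Boundary.
Context {R : realType}.
Local Notation C := R[i].
Local Notation mu := (@lebesgue_measure R).
Local Notation arc := (@Defs.arc R).
Local Notation Re := (@complex.Re R).
Local Notation Im := (@complex.Im R).
Local Notation normc := Normc.normc.
Implicit Types (a : nat -> C) (f : C -> C) (g h : R -> C).

Lemma arcL1_ae (U W : R -> R) : measurable_fun arc U -> arcL1 W ->
  ae_arc (fun s => U s = W s) -> arcL1 U.
Proof.
move=> mU hW h.
have mn (X : R -> R) : measurable_fun arc X ->
    measurable_fun (arc : set (measurableTypeR R)) (fun s => `|(X s)%:E|%E).
  by move=> mX; apply: measurableT_comp => //; exact/measurable_EFinP.
apply/integrableP; split; first exact/measurable_EFinP.
have /integrableP[_] := hW; apply: le_lt_trans.
rewrite le_eqVlt; apply/orP; left; apply/eqP; apply: ae_eq_integral => //.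
- exact: mn.
- exact: (mn _ (arcL1_meas hW)).
- by move: h; apply: ae_arcS => t _ /= ->.
Qed.

Lemma cmeasurableD g h : cmeasurable g -> cmeasurable h -> cmeasurable (fun t => g t + h t).
Proof.
move=> [g1 g2] [h1 h2]; split.
  by under eq_fun do rewrite cReD; exact: measurable_funD.
by under eq_fun do rewrite cImD; exact: measurable_funD.
Qed.

Lemma cmeasurableM g h : cmeasurable g -> cmeasurable h -> cmeasurable (fun t => g t * h t).
Proof.
move=> [g1 g2] [h1 h2]; split.
  by under eq_fun do rewrite cReM; apply: measurable_funB; exact: measurable_funM.
by under eq_fun do rewrite cImM; apply: measurable_funD; exact: measurable_funM.
Qed.

Lemma cmeasurable_cst (c : C) : cmeasurable (fun=> c).
Proof. by split; exact: measurable_cst. Qed.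

Lemma cmeasurableJ g : cmeasurable g -> cmeasurable (fun t => conjc (g t)).
Proof.
move=> [g1 g2]; split; first by under eq_fun do rewrite cReJ.
by under eq_fun do rewrite cImJ; exact: measurable_funN.
Qed.

Lemma cmeasurable_normc_sq g : cmeasurable g -> measurable_fun arc (fun t => normc (g t) ^+ 2).
Proof.
move=> [g1 g2]; under eq_fun do rewrite normc_sq.
by apply: measurable_funD; exact: measurable_funX.
Qed.

Definition cL1 g := arcL1 (fun s => Re (g s)) /\ arcL1 (fun s => Im (g s)).

Lemma Re_cmean g : Re (cmean g) = (2 * pi)^-1 * arcint (fun s => Re (g s)).
Proof. by rewrite /cmean cReZ. Qed.

Lemma Im_cmean g : Im (cmean g) = (2 * pi)^-1 * arcint (fun s => Im (g s)).
Proof. by rewrite /cmean cImM /= mul0r addr0. Qed.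

Lemma cmeanD g h : cL1 g -> cL1 h -> cmean (fun t => g t + h t) = cmean g + cmean h.
Proof.
move=> [g1 g2] [h1 h2]; apply: complex_eq.
  rewrite cReD !Re_cmean -mulrDr -arcintD //.
  by under eq_fun do rewrite cReD.
rewrite cImD !Im_cmean -mulrDr -arcintD //.
by under eq_fun do rewrite cImD.
Qed.

Lemma cmeanZ (c : C) g : cL1 g -> cmean (fun t => c * g t) = c * cmean g.
Proof.
move=> [g1 g2]; apply: complex_eq.
  rewrite cReM !Re_cmean Im_cmean.
  under eq_fun do rewrite cReM.
  by rewrite arcintB ?arcintZ //; [ring|exact: arcL1Z|exact: arcL1Z].
rewrite cImM !Im_cmean Re_cmean.
under eq_fun do rewrite cImM.
by rewrite arcintD ?arcintZ //; [ring|exact: arcL1Z|exact: arcL1Z].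
Qed.

Lemma cmeanJ g : cL1 g -> cmean (fun t => conjc (g t)) = conjc (cmean g).
Proof.
move=> [g1 g2]; apply: complex_eq.
  by rewrite cReJ !Re_cmean; under eq_fun do rewrite cReJ.
rewrite cImJ !Im_cmean; under eq_fun do rewrite cImJ.
by rewrite arcintN // mulrN.
Qed.

Lemma cmean_ae g h : cmeasurable g -> cmeasurable h ->
  ae_arc (fun t => g t = h t) -> cmean g = cmean h.
Proof.
move=> [g1 g2] [h1 h2] e; apply: complex_eq.
  by rewrite !Re_cmean; congr (_ * _); apply: arcint_ae => //; apply: ae_arcS e => t _ ->.
by rewrite !Im_cmean; congr (_ * _); apply: arcint_ae => //; apply: ae_arcS e => t _ ->.
Qed.

Lemma L2_meas g : L2 g -> cmeasurable g. Proof. by case. Qed.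

Lemma L2_normc g : L2 g -> arcL1 (fun s => normc (g s) ^+ 2). Proof. by case. Qed.

Lemma L2_mulJ g h : L2 g -> L2 h -> cL1 (fun t => g t * conjc (h t)).
Proof.
move=> hg hh.
have [m1 m2] := cmeasurableM (L2_meas hg) (cmeasurableJ (L2_meas hh)).
have bnd (z w : C) : normc (z * conjc w) <= normc z ^+ 2 + normc w ^+ 2.
  rewrite Normc.normcM.
  have -> : normc (conjc w) = normc w by case: w => x y /=; rewrite sqrrN.
  have z0 : 0 <= normc z by case: z => x y; exact: sqrtr_ge0.
  have w0 : 0 <= normc w by case: w => x y; exact: sqrtr_ge0.
  by have := sqr_ge0 (normc z - normc w); have := mulr_ge0 z0 w0; rewrite sqrrB -mulr_natl; lra.
have i := arcL1D (L2_normc hg) (L2_normc hh).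
split.
  apply: arcL1_le i _ => // s _; apply: le_trans (bnd _ _).
  by have [? _] := normc_ReIm (g s * conjc (h s)).
apply: arcL1_le i _ => // s _; apply: le_trans (bnd _ _).
by have [_ []] := normc_ReIm (g s * conjc (h s)).
Qed.

Lemma L2_ae g h : cmeasurable g -> L2 h -> ae_arc (fun t => g t = h t) -> L2 g.
Proof.
move=> mg hh e; split => //; apply: (@arcL1_ae _ (fun s => normc (h s) ^+ 2)).
- exact: cmeasurable_normc_sq.
- exact: L2_normc.
- by apply: ae_arcS e => t _ ->.
Qed.

Lemma L2_mul_bounded (k g : R -> C) (M : R) : cmeasurable k ->
  ae_arc (fun t => normc (k t) <= M) -> L2 g -> L2 (fun t => k t * g t).
Proof.
move=> mk bk hg; have mkg := cmeasurableM mk (L2_meas hg); split => //.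
have M2 : 0 <= M ^+ 2 := sqr_ge0 M.
(* The bound on [k] holds only almost everywhere; truncation makes it hold everywhere and changes
   the function on a null set. *)
pose m t := if normc (k t) ^+ 2 <= M ^+ 2 then normc (k t) ^+ 2 else M ^+ 2.
have mm : measurable_fun arc m.
  have -> : m = (fun t => Num.min (normc (k t) ^+ 2) (M ^+ 2)).
    by apply/funext => t; rewrite /m; case: leP.
  by apply: measurable_minr => //; exact: cmeasurable_normc_sq.
apply: (@arcL1_ae _ (fun s => m s * normc (g s) ^+ 2)).
- exact: cmeasurable_normc_sq.
- apply: (@arcL1M _ (M ^+ 2)) => //; last exact: L2_normc.
  move=> s _; rewrite /m ger0_norm; last by case: ifP => _ //; exact: sqr_ge0.
  by case: ifP.
- apply: ae_arcS bk => t _ h; rewrite normc_sqM /m.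
  have k0 : 0 <= normc (k t) by case: (k t) => x y; exact: sqrtr_ge0.
  by rewrite ler_sqr ?nnegrE ?(le_trans k0 h) // h.
Qed.

Lemma L2_innerDl g1 g2 h : L2 g1 -> L2 g2 -> L2 h ->
  L2_inner (fun t => g1 t + g2 t) h = L2_inner g1 h + L2_inner g2 h.
Proof.
move=> h1 h2 h3; rewrite /L2_inner -cmeanD; try exact: L2_mulJ.
by congr cmean; apply/funext => t; rewrite mulrDl.
Qed.

Lemma L2_innerZl (c : C) g h : L2 g -> L2 h ->
  L2_inner (fun t => c * g t) h = c * L2_inner g h.
Proof.
move=> h1 h2; rewrite /L2_inner -cmeanZ; last exact: L2_mulJ.
by congr cmean; apply/funext => t; rewrite mulrA.
Qed.

Lemma L2_innerC g h : L2 g -> L2 h -> L2_inner h g = conjc (L2_inner g h).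
Proof.
move=> h1 h2; rewrite /L2_inner -cmeanJ; last exact: L2_mulJ.
by congr cmean; apply/funext => t; rewrite rmorphM /= conjcK mulrC.
Qed.

Lemma L2_inner_ae g g' h h' : cmeasurable g -> cmeasurable g' ->
  cmeasurable h -> cmeasurable h' -> ae_arc (fun t => g t = g' t) ->
  ae_arc (fun t => h t = h' t) -> L2_inner g h = L2_inner g' h'.
Proof.
move=> m1 m2 m3 m4 e1 e2; apply: cmean_ae.
- by apply: cmeasurableM => //; exact: cmeasurableJ.
- by apply: cmeasurableM => //; exact: cmeasurableJ.
- by have := ae_arcI e1 e2; apply: ae_arcS => t _ [-> ->].
Qed.

Lemma L2Z (c : C) g : L2 g -> L2 (fun t => c * g t).
Proof.
move=> hg; apply: (@L2_mul_bounded (fun=> c) g (normc c)) => //.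
exact: ae_arc_all.
Qed.

Lemma Re_L2_inner g : Re (L2_inner g g) = (2 * pi)^-1 * arcint (fun s => normc (g s) ^+ 2).
Proof.
rewrite Re_cmean; congr (_ * arcint _); apply/funext => s.
by rewrite normc_sq cReM cReJ cImJ mulrN opprK -!expr2.
Qed.

Lemma bv_unique f g h : is_boundary_value f g -> is_boundary_value f h ->
  ae_arc (fun t => g t = h t).
Proof.
move=> [_ h1] [_ h2]; have := ae_arcI (h1 : ae_arc _) h2.
apply: ae_arcS => t _ [/cvg_ReIm[a1 a2] /cvg_ReIm[b1 b2]].
by apply: complex_eq; [exact: (cvg_unique _ a1 b1)|exact: (cvg_unique _ a2 b2)].
Qed.

Lemma boundary_bv f g : is_boundary_value f g -> is_boundary_value f (boundary f).
Proof. by move=> h; rewrite /boundary; apply: (@xgetPex _ (fun=> 0)); exists g. Qed.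

Lemma boundary_ae f g : is_boundary_value f g -> ae_arc (fun t => boundary f t = g t).
Proof. by move=> h; exact: bv_unique (boundary_bv h) h. Qed.

Lemma bvM f1 f2 g1 g2 : is_boundary_value f1 g1 -> is_boundary_value f2 g2 ->
  is_boundary_value (fun z => f1 z * f2 z) (fun t => g1 t * g2 t).
Proof.
move=> [m1 h1] [m2 h2]; split; first exact: cmeasurableM.
have := ae_arcI (h1 : ae_arc _) h2.
apply: ae_arcS => t _ [/cvg_ReIm[a1 a2] /cvg_ReIm[b1 b2]].
apply/cvg_ReIm; split.
  under eq_fun do rewrite cReM; rewrite cReM.
  by apply: cvgB; exact: cvgM.
under eq_fun do rewrite cImM; rewrite cImM.
by apply: cvgD; exact: cvgM.
Qed.

Lemma bvD f1 f2 g1 g2 : is_boundary_value f1 g1 -> is_boundary_value f2 g2 ->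
  is_boundary_value (fun z => f1 z + f2 z) (fun t => g1 t + g2 t).
Proof.
move=> [m1 h1] [m2 h2]; split; first exact: cmeasurableD.
have := ae_arcI (h1 : ae_arc _) h2.
apply: ae_arcS => t _ [/cvg_ReIm[a1 a2] /cvg_ReIm[b1 b2]].
apply/cvg_ReIm; split.
  by under eq_fun do rewrite cReD; rewrite cReD; exact: cvgD.
by under eq_fun do rewrite cImD; rewrite cImD; exact: cvgD.
Qed.

Lemma bv_cst (c : C) : is_boundary_value (fun=> c) (fun=> c).
Proof.
split; first exact: cmeasurable_cst.
by apply: ae_arc_all => t _; apply/cvg_ReIm; split; exact: cvg_cst.
Qed.

Lemma H2_coef f : H2 f -> exists2 a, power_series_on_disk a f & cvgn (sqsum a).
Proof. by move=> [[a [h1 h2]] _]; exists a. Qed.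

Lemma H2_boundary f : H2 f -> is_boundary_value f (boundary f) /\ L2 (boundary f).
Proof.
move=> /H2_coef[a psf sa]; have [g [bg Lg _]] := fatou_H2 sa psf.
have bf := boundary_bv bg; split => //.
by apply: (L2_ae _ Lg (boundary_ae bg)); case: bf.
Qed.

Lemma H2_bv f : H2 f -> is_boundary_value f (boundary f).
Proof. by move=> /H2_boundary[]. Qed.

Lemma H2_L2 f : H2 f -> L2 (boundary f).
Proof. by move=> /H2_boundary[]. Qed.

(** Since [boundary] is a chosen representative, this is what allows computing with explicit ones,
    such as products of boundary functions. *)
Lemma H2_inner_bv f1 f2 g1 g2 : is_boundary_value f1 g1 -> is_boundary_value f2 g2 ->
  H2_inner f1 f2 = L2_inner g1 g2.
Proof.
move=> h1 h2; apply: L2_inner_ae.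
- by case: (boundary_bv h1).
- by case: h1.
- by case: (boundary_bv h2).
- by case: h2.
- exact: boundary_ae.
- exact: boundary_ae.
Qed.

Lemma H2_innerE f a : power_series_on_disk a f -> cvgn (sqsum a) ->
  Re (H2_inner f f) = limn (sqsum a).
Proof.
move=> psf sa; have [g [bg Lg Ng]] := fatou_H2 sa psf.
rewrite (H2_inner_bv bg bg) Re_L2_inner Ng mulrA mulVf ?mul1r //.
by rewrite mulf_neq0 // gt_eqF // pi_gt0.
Qed.

Lemma H2_innerDl f1 f2 f3 : H2 f1 -> H2 f2 -> H2 f3 ->
  H2_inner (fun z => f1 z + f2 z) f3 = H2_inner f1 f3 + H2_inner f2 f3.
Proof.
move=> h1 h2 h3; rewrite (H2_inner_bv (bvD (H2_bv h1) (H2_bv h2)) (H2_bv h3)).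
by apply: L2_innerDl; exact: H2_L2.
Qed.

Lemma H2_innerZl (c : C) f f' : H2 f -> H2 f' ->
  H2_inner (fun z => c * f z) f' = c * H2_inner f f'.
Proof.
move=> h1 h2; rewrite (H2_inner_bv (bvM (bv_cst c) (H2_bv h1)) (H2_bv h2)).
by apply: L2_innerZl; exact: H2_L2.
Qed.

Lemma H2_innerC f f' : H2 f -> H2 f' -> H2_inner f' f = conjc (H2_inner f f').
Proof. by move=> h1 h2; apply: L2_innerC; exact: H2_L2. Qed.

End Boundary.

(** * H2 as a Hilbert space *)

Section H2Space.
Context {R : realType}.
Local Notation C := R[i].
Local Notation Re := (@complex.Re R).
Local Notation Im := (@complex.Im R).
Local Notation normc := Normc.normc.
Implicit Types (a b : nat -> C) (f : C -> C).

Lemma normc_ge0 (z : C) : 0 <= normc z.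
Proof. by case: z => x y; exact: sqrtr_ge0. Qed.

Lemma ps_lin (c : C) a b f g : power_series_on_disk a f -> power_series_on_disk b g ->
  power_series_on_disk (fun k => c * a k + b k) (fun z => c * f z + g z).
Proof.
move=> ha hb z z1; have /cvg_ReIm[a1 a2] := ha z z1; have /cvg_ReIm[b1 b2] := hb z z1.
have e : (series (fun k => (c * a k + b k) * z ^+ k) : nat -> C) = (fun n =>
   c * series (fun k => a k * z ^+ k) n + series (fun k => b k * z ^+ k) n).
  apply/funext => n; rewrite /series /= mulr_sumr -big_split /=.
  by apply: eq_bigr => k _; rewrite mulrDl mulrA.
apply/cvg_ReIm; rewrite e; split.
  under eq_fun do rewrite cReD cReM; rewrite cReD cReM.
  apply: cvgD => //; apply: cvgB; apply: cvgM => //; exact: cvg_cst.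
under eq_fun do rewrite cImD cImM; rewrite cImD cImM.
apply: cvgD => //; apply: cvgD; apply: cvgM => //; exact: cvg_cst.
Qed.

Lemma sqsum_bounded a (M : R) : (forall n, sqsum a n <= M) ->
  cvgn (sqsum a) /\ limn (sqsum a) <= M.
Proof.
move=> h; have c : cvgn (sqsum a).
  by apply: nondecreasing_is_cvgn; [exact: sqsum_nd|exists M => _ [n _ <-]].
by split => //; apply: limr_le => //; exact: nearW.
Qed.

Lemma sqsum_lin (c : C) a b : cvgn (sqsum a) -> cvgn (sqsum b) ->
  cvgn (sqsum (fun k => c * a k + b k)).
Proof.
move=> sa sb.
suff h n : sqsum (fun k => c * a k + b k) n <=
    2 * normc c ^+ 2 * limn (sqsum a) + 2 * limn (sqsum b).
  by have [] := sqsum_bounded h.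
apply: le_trans (_ : 2 * normc c ^+ 2 * sqsum a n + 2 * sqsum b n <= _).
  rewrite /sqsum /series /= !mulr_sumr -big_split /=; apply: ler_sum => k _.
  have := normc_sq_peter (c * a k) (b k) (@ltr01 R); rewrite invr1 normc_sqM.
  by rewrite mulrA.
apply: lerD; last by rewrite ler_wpM2l // sqsum_le.
by rewrite ler_wpM2l ?sqsum_le // mulr_ge0 // sqr_ge0.
Qed.

Lemma H2_lin (c : C) f g : H2 f -> H2 g -> H2 (fun z => c * f z + g z).
Proof.
move=> hf hg; have [a psa sa] := H2_coef hf; have [b psb sb] := H2_coef hg.
split; first by exists (fun k => c * a k + b k); split; [exact: ps_lin|exact: sqsum_lin].
by move=> z hz; rewrite (hf.2 _ hz) (hg.2 _ hz) mulr0 addr0.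
Qed.

Lemma H2_0 : H2 (fun=> 0 : C).
Proof.
split => //; exists (fun=> 0); split.
  move=> z _; have -> : (series (fun k => 0 * z ^+ k) : nat -> C^o) = cst 0.
    by apply/funext => n; rewrite /series /= big1 // => k _; rewrite mul0r.
  exact: cvg_cst.
have -> : (series (fun k => normc (0 : C) ^+ 2) : nat -> R) = cst 0.
  apply/funext => n; rewrite /series /= big1 // => k _.
  by rewrite expr0n addr0 sqrtr0 expr0n.
exact: is_cvg_cst.
Qed.

(** The codomain [C^o] gives functions their pointwise module structure, and a boolean predicate is
    the form in which submodules are declared. *)
Definition H2_pred : {pred (C -> C^o)} := fun f => `[< H2 f >].

Lemma H2_predP (f : C -> C^o) : reflect (H2 f) (f \in H2_pred).
Proof. exact: asboolP. Qed.

Lemma H2_submod : submod_closed H2_pred.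
Proof.
split; first by apply/H2_predP; exact: H2_0.
by move=> c f g /H2_predP hf /H2_predP hg; apply/H2_predP; exact: H2_lin.
Qed.

End H2Space.

HB.instance Definition _ (R : realType) :=
  GRing.isSubmodClosed.Build R[i] (R[i] -> R[i]^o) (@H2_pred R) H2_submod.

Record H2_type (R : realType) :=
  H2Elt { H2_val :> R[i] -> R[i]^o; _ : H2_val \in @H2_pred R }.

HB.instance Definition _ (R : realType) := [isSub for @H2_val R].
HB.instance Definition _ (R : realType) := [Choice of H2_type R by <:].
HB.instance Definition _ (R : realType) := [SubChoice_isSubLmodule of H2_type R by <:].

(** * Point evaluations and completeness of H2 *)

Section H2Hilbert.
Context {R : realType}.
Local Notation C := R[i].
Local Notation Re := (@complex.Re R).
Local Notation Im := (@complex.Im R).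
Local Notation normc := Normc.normc.
Implicit Types (a b : nat -> C) (f g : H2_type R).

Lemma H2_valP f : H2 f.
Proof. by apply/H2_predP; case: f. Qed.

Lemma H2_val_inj f g : (forall z, f z = g z) -> f = g.
Proof. by move=> h; apply: val_inj; apply/funext. Qed.

Definition H2ip f g : R := Re (H2_inner f g).

Lemma H2ip_semi_inner : semi_inner H2ip.
Proof.
have D f g (k : H2_type R) : H2_inner (f + g : H2_type R) k = H2_inner f k + H2_inner g k.
  exact: (H2_innerDl (H2_valP f) (H2_valP g) (H2_valP k)).
have Z (c : C) f g : H2_inner (c *: f : H2_type R) g = c * H2_inner f g.
  exact: (H2_innerZl c (H2_valP f) (H2_valP g)).
have J f g : H2_inner g f = conjc (H2_inner f g) by apply: H2_innerC; exact: H2_valP.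
split.
- by move=> f g; rewrite /H2ip J cReJ.
- by move=> f g k; rewrite /H2ip D cReD.
- by move=> c f g; rewrite /H2ip Z (J (conjc c *: g) f) Z rmorphM /= conjcK (J g f).
- by move=> r f g; rewrite /H2ip Z cReZ.
- move=> f; have [a psa sa] := H2_coef (H2_valP f).
  rewrite /H2ip (H2_innerE psa sa); apply: le_trans (sqsum_le 0 sa).
  by rewrite sqsum_ord big_ord0.
Qed.

Lemma H2ip_coef f a : power_series_on_disk a f -> cvgn (sqsum a) ->
  H2ip f f = limn (sqsum a).
Proof. exact: H2_innerE. Qed.

Lemma normcX (z : C) n : normc (z ^+ n) = normc z ^+ n.
Proof.
elim: n => [|n IH]; first by rewrite !expr0 /= expr1n expr0n addr0 sqrtr1.
by rewrite !exprS Normc.normcM IH.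
Qed.

Lemma normC_lt1 (z : C) : (`|z| < 1) = (normc z < 1).
Proof. by rewrite -[`|z|]/((normc z)%:C) ltcR. Qed.

Lemma geometric_sum_le (x : R) n : 0 <= x -> x < 1 ->
  \sum_(0 <= k < n) x ^+ k <= (1 - x)^-1.
Proof.
move=> x0 x1; have d : 0 < 1 - x by rewrite subr_gt0.
rewrite -[leRHS]mul1r ler_pdivlMr //.
suff -> : (\sum_(0 <= k < n) x ^+ k) * (1 - x) = 1 - x ^+ n by rewrite gerBl exprn_ge0.
elim: n => [|n IH]; first by rewrite big_geq // expr0 subrr mul0r.
by rewrite big_nat_recr //= mulrDl IH exprS; ring.
Qed.

Lemma term_le (x y eta : R) : 0 <= x -> 0 <= y -> 0 < eta ->
  x * y <= x ^+ 2 / (2 * eta) + eta / 2 * y ^+ 2.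
Proof.
move=> x0 y0 e0; have -> : x ^+ 2 / (2 * eta) + eta / 2 * y ^+ 2 =
  x * y + (2 * eta)^-1 * (x - eta * y) ^+ 2 by field; rewrite gt_eqF.
by rewrite lerDl mulr_ge0 ?sqr_ge0 // invr_ge0 mulr_ge0 // ltW.
Qed.

Lemma normc_sum n (F : nat -> C) : normc (\sum_(0 <= k < n) F k) <= \sum_(0 <= k < n) normc (F k).
Proof.
elim: n => [|n IH]; first by rewrite !big_geq //= expr0n addr0 sqrtr0.
by rewrite !big_nat_recr //=; apply: le_trans (le_normcD _ _) _; rewrite lerD2r.
Qed.

Lemma ps_partial_le a (z : C) (eta : R) n : normc z < 1 -> 0 < eta ->
  \sum_(0 <= k < n) normc (a k * z ^+ k) <=
  sqsum a n / (2 * eta) + eta / 2 * (1 - normc z ^+ 2)^-1.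
Proof.
move=> z1 e0; have z0 := normc_ge0 z.
apply: le_trans (_ : sqsum a n / (2 * eta) +
    eta / 2 * \sum_(0 <= k < n) (normc z ^+ 2) ^+ k <= _).
  rewrite /sqsum /series /= mulr_suml mulr_sumr -big_split /=.
  apply: ler_sum => k _; rewrite Normc.normcM normcX exprAC.
  by apply: term_le => //; [exact: normc_ge0|exact: exprn_ge0].
rewrite lerD2l ler_wpM2l //; first by rewrite divr_ge0 // ltW.
by apply: geometric_sum_le; [exact: sqr_ge0|rewrite expr_lt1].
Qed.

(** Point evaluations are bounded, by a weighted arithmetic-geometric mean against a geometric
    series. The constant [K] is half of 1 / (1 - |z|^2), the squared norm of the evaluation. *)
Lemma H2_eval (z : C) : `|z| < 1 -> exists2 K : R, 0 <= K &
  forall f (eta : R), 0 < eta -> normc (f z) <= H2ip f f / (2 * eta) + eta * K.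
Proof.
move=> z1; have zn := z1; rewrite normC_lt1 in zn.
have d : 0 < 1 - normc z ^+ 2 by rewrite subr_gt0 expr_lt1 // normc_ge0.
exists (2^-1 * (1 - normc z ^+ 2)^-1); first by rewrite mulr_ge0 ?invr_ge0 ?(ltW d).
move=> f eta e0; have [a psa sa] := H2_coef (H2_valP f).
rewrite (H2ip_coef psa sa) mulrA.
apply/ler_addgt0Pr => e e1; have /cvg_normcP /(_ e e1) [N _ hN] := psa z z1.
have {}hN := hN N (leqnn _).
have := le_normcD (f z - series (fun k => a k * z ^+ k) N) (series (fun k => a k * z ^+ k) N).
rewrite subrK => h1; apply: le_trans h1 _; rewrite addrC; apply: lerD; last exact: ltW.
apply: le_trans (normc_sum _ _) _.
apply: le_trans (ps_partial_le a N zn e0) _.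
by rewrite lerD2r ler_pM2r ?invr_gt0 ?mulr_gt0 // sqsum_le.
Qed.

Lemma power_series_l2 a : cvgn (sqsum a) -> exists f : H2_type R, power_series_on_disk a f.
Proof.
move=> sa.
have key (z : C) : exists w : C, `|z| < 1 ->
    series (fun k => a k * z ^+ k : C^o) @ \oo --> (w : C^o).
  have [z1|] := boolP (`|z| < 1); last by exists 0.
  have zn := z1; rewrite normC_lt1 in zn.
  have sn : cvgn (series (fun k => normc (a k * z ^+ k))).
    apply: nondecreasing_is_cvgn.
      apply/nondecreasing_seqP => n; rewrite /series /= big_nat_recr //= lerDl.
      exact: normc_ge0.
    exists (limn (sqsum a) / (2 * 1) + 1 / 2 * (1 - normc z ^+ 2)^-1) => _ [n _ <-].
    apply: le_trans (ps_partial_le a n zn ltr01) _.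
    by rewrite lerD2r ler_pM2r ?invr_gt0 ?mulr_gt0 // sqsum_le.
  have cRe : cvgn (series (fun k => Re (a k * z ^+ k))).
    apply: normed_cvg; apply: series_le_cvg sn => k; first exact: normr_ge0.
      exact: normc_ge0.
    by case: (normc_ReIm (a k * z ^+ k)).
  have cIm : cvgn (series (fun k => Im (a k * z ^+ k))).
    apply: normed_cvg; apply: series_le_cvg sn => k; first exact: normr_ge0.
      exact: normc_ge0.
    by case: (normc_ReIm (a k * z ^+ k)) => _ [].
  case/cvg_ex : cRe => x hx; case/cvg_ex : cIm => y hy.
  exists (x +i* y) => _; apply/cvg_ReIm; split.
    have -> : (fun n => Re (series (fun k => a k * z ^+ k) n)) =
        series (fun k => Re (a k * z ^+ k)) by apply/funext => n; exact: Re_sum.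
    exact: hx.
  have -> : (fun n => Im (series (fun k => a k * z ^+ k) n)) =
      series (fun k => Im (a k * z ^+ k)) by apply/funext => n; exact: Im_sum.
  exact: hy.
have [F hF] := choice key.
pose f z := if `|z| < 1 then F z else 0.
have psf : power_series_on_disk a f.
  by move=> z z1; rewrite /f z1; exact: hF.
have hf : H2 f.
  split; first by exists a.
  by move=> z /negbTE h; rewrite /f h.
have hp : (f : C -> C^o) \in @H2_pred R by apply/H2_predP.
by exists (H2Elt hp).
Qed.

Lemma sqsum_ge_term a k : normc (a k) ^+ 2 <= sqsum a k.+1.
Proof.
by rewrite sqsum_ord big_ord_recr /= lerDr sumr_ge0 // => i _; exact: sqr_ge0.
Qed.

Lemma real_cauchy (u : nat -> R) :
  (forall e : R, 0 < e -> exists N, forall m n, (N <= m)%N -> (N <= n)%N -> `|u m - u n| <= e) ->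
  cvgn u.
Proof.
move=> h; apply/cauchy_cvgP/cauchy_ballP => e e0.
have e2 : 0 < e / 2 by rewrite divr_gt0.
have [N hN] := h _ e2.
pose A : set R := [set x | exists2 n, (N <= n)%N & u n = x].
exists (A, A); first by split; exists N => // n hn; exists n.
move=> [x y] /= [[m hm <-] [n hn <-]]; rewrite /ball /=.
by apply: le_lt_trans (hN m n hm hn) _; lra.
Qed.

(** Completeness is that of the square-summable sequences: coefficients converge one by one, and the
    bound on each finite sum of squares passes to the limit. *)
Theorem H2_hilbert : hilbert H2ip.
Proof.
have hip := H2ip_semi_inner; split => //.
  move=> f f0; have [a psa sa] := H2_coef (H2_valP f).
  rewrite (H2ip_coef psa sa) in f0.
  have a0 k : a k = 0.
    apply: Normc.eq0_normc; apply/eqP; rewrite -sqrf_eq0 eq_le sqr_ge0 andbT.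
    by rewrite -f0 (le_trans (sqsum_ge_term a k)) // sqsum_le.
  apply: H2_val_inj => z; have [z1|z1] := boolP (`|z| < 1); last by rewrite (H2_valP f).2.
  have := psa z z1; have -> : (series (fun k => a k * z ^+ k) : nat -> C) = cst 0.
    by apply/funext => n; rewrite /series /= big1 // => k _; rewrite a0 mul0r.
  have h0 : (fun _ : nat => 0 : R) @ \oo --> (0 : R) by exact: cvg_cst.
  move=> /cvg_ReIm[h1 h2]; apply: complex_eq.
    exact: (cvg_unique _ h1 h0).
  exact: (cvg_unique _ h2 h0).
move=> u cu.
have /choice[a ha] n : exists a, power_series_on_disk a (u n) /\ cvgn (sqsum a).
  by have [a ? ?] := H2_coef (H2_valP (u n)); exists a.
(* The difference is written in the shape c a + b handled by [ps_lin] and [sqsum_lin]. *)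
pose dif m n k := -1 * a n k + a m k.
have difE m n : H2ip (u m - u n) (u m - u n) = limn (sqsum (dif m n)) /\ cvgn (sqsum (dif m n)).
  have sd : cvgn (sqsum (dif m n)) by apply: sqsum_lin; [case: (ha n)|case: (ha m)].
  split => //; apply: H2ip_coef sd.
  have := @ps_lin R (-1) _ _ _ _ (ha n).1 (ha m).1.
  by congr power_series_on_disk; apply/funext => z; rewrite mulN1r addrC.
have cau (e : R) : 0 < e -> exists N, forall m n, (N <= m)%N -> (N <= n)%N ->
    forall K, sqsum (dif m n) K <= e ^+ 2.
  move=> e0; have [N hN] := cu e e0; exists N => m n Nm Nn K.
  have [d1 d2] := difE m n; apply: le_trans (sqsum_le K d2) _.
  rewrite -d1 -(ipnorm_sq hip) ler_sqr ?nnegrE ?(ltW e0) //; first exact: hN.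
  exact: ipnorm_ge0.
have cterm k (e : R) : 0 < e -> exists N, forall m n, (N <= m)%N -> (N <= n)%N ->
    normc (a m k - a n k) <= e.
  move=> e0; have [N hN] := cau e e0; exists N => m n Nm Nn.
  rewrite -(@ler_sqr _ (normc _)) ?nnegrE ?(ltW e0) ?normc_ge0 //.
  have -> : a m k - a n k = dif m n k by rewrite /dif mulN1r addrC.
  exact: le_trans (sqsum_ge_term _ _) (hN m n Nm Nn _).
have lim k : exists w : C, (fun n => Re (a n k)) @ \oo --> Re w /\
    (fun n => Im (a n k)) @ \oo --> Im w.
  have c1 : cvgn (fun n => Re (a n k)).
    apply: real_cauchy => e e0; have [N hN] := cterm k e e0; exists N => m n Nm Nn.
    rewrite -cReN -cReD; apply: le_trans (hN m n Nm Nn).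
    by case: (normc_ReIm (a m k - a n k)).
  have c2 : cvgn (fun n => Im (a n k)).
    apply: real_cauchy => e e0; have [N hN] := cterm k e e0; exists N => m n Nm Nn.
    rewrite -cImN -cImD; apply: le_trans (hN m n Nm Nn).
    by case: (normc_ReIm (a m k - a n k)) => _ [].
  by case/cvg_ex : c1 => x hx; case/cvg_ex : c2 => y hy; exists (x +i* y).
have {lim}[b hb] := choice lim.
have lb (e : R) : 0 < e -> exists N, forall n, (N <= n)%N ->
    forall K, sqsum (fun k => -1 * b k + a n k) K <= e ^+ 2.
  move=> e0; have [N hN] := cau e e0; exists N => n Nn K.
  have cK : (fun m => sqsum (dif n m) K) @ \oo --> sqsum (fun k => -1 * b k + a n k) K.
    elim: K => [|K IH].
      rewrite sqsum_ord big_ord0; under eq_fun do rewrite sqsum_ord big_ord0.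
      exact: cvg_cst.
    have S c : sqsum c K.+1 = sqsum c K + normc (c K) ^+ 2.
      by rewrite !sqsum_ord big_ord_recr.
    rewrite S; under eq_fun do rewrite S.
    apply: cvgD => //; have [h1 h2] := hb K.
    rewrite normc_sq; under eq_fun do rewrite normc_sq /dif.
    under eq_fun do rewrite cReD cImD !mulN1r cReN cImN.
    rewrite cReD cImD !mulN1r cReN cImN.
    by apply: cvgD; apply: cvgM; (apply: cvgD; [exact: cvgN|exact: cvg_cst]).
  rewrite -(cvg_lim (@Rhausdorff R) cK); apply: limr_le; first exact: cvgP cK.
  by exists N => // m Nm; exact: hN.
(* [b] differs from the square-summable [a N] by a square-summable sequence. *)
have sb : cvgn (sqsum b).
  have [N hN] := lb 1 ltr01; have [s1 _] := sqsum_bounded (hN N (leqnn _)).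
  have e : (fun k => -1 * (-1 * b k + a N k) + a N k) = b by apply/funext => k; ring.
  by have := @sqsum_lin R (-1) _ _ s1 (ha N).2; rewrite e.
have [f psf] := power_series_l2 sb.
exists f => e e0; have [N hN] := lb e e0; exists N => n Nn.
have [s1 s2] := sqsum_bounded (hN n Nn).
rewrite -(@ler_sqr _ (ipnorm _ _)) ?nnegrE ?(ltW e0) ?ipnorm_ge0 // (ipnorm_sq hip).
have d : power_series_on_disk (fun k => -1 * b k + a n k) (u n - f).
  have := @ps_lin R (-1) _ _ _ _ psf (ha n).1.
  by congr power_series_on_disk; apply/funext => z; rewrite mulN1r addrC.
by rewrite (H2ip_coef d s1).
Qed.

End H2Hilbert.

(** * Multipliers and Toeplitz operators *)

Section BoundedMultiplier.
Context {R : realType}.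
Local Notation C := R[i].
Local Notation arc := (@Defs.arc R).
Local Notation Re := (@complex.Re R).
Local Notation Im := (@complex.Im R).
Local Notation normc := Normc.normc.
Implicit Types (a : nat -> C) (f b : C -> C).

Lemma bv_le f (g : R -> C) (M : R) : is_boundary_value f g ->
  (forall z, `|z| < 1 -> normc (f z) <= M) -> ae_arc (fun t => normc (g t) <= M).
Proof.
move=> [_ h] bf; apply: (ae_arcS _ (h : ae_arc _)) => t _ /cvg_normcP ct.
apply/ler_addgt0Pr => e e0.
have [d d0 hd] := ct e e0.
pose q := Num.min (d / 2) (2^-1 : R).
have q0 : 0 < q by rewrite lt_min divr_gt0 //= invr_gt0.
have [q1 q2] : q <= d / 2 /\ q <= 2^-1 by split; rewrite /q ge_min lexx ?orbT.
pose r := 1 - q.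
have r01 : 0 <= r < 1 by rewrite /r; apply/andP; split; lra.
have := hd r; rewrite /= /r opprB addrCA subrr addr0 gtr0_norm // => /(_ _ _) h1.
have {}h1 : normc (g t - f (r%:C * expi t)) < e by apply: h1; rewrite /=; [lra|lra].
have := le_normcD (g t - f (r%:C * expi t)) (f (r%:C * expi t)); rewrite subrK.
by have := bf _ (normC_radius t r01); lra.
Qed.

Lemma bernoulli (r : R) n : 0 <= r <= 1 -> 1 - n%:R * (1 - r) <= r ^+ n.
Proof.
move=> /andP[r0 r1]; elim: n => [|n IH]; first by rewrite mul0r subr0 expr0.
rewrite exprS -natr1; have h := ler_wpM2l r0 IH.
apply: le_trans h; have n0 : 0 <= n%:R :> R by [].
have := mulr_ge0 n0 (sqr_ge0 (1 - r)).
by move: (n%:R : R) => x; nra.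
Qed.

Lemma ps_terms_bounded a b (r : R) : power_series_on_disk a b -> 0 <= r < 1 ->
  exists B : R, forall k, normc (a k * r%:C ^+ k) <= B.
Proof.
move=> psb hr; have z1 : `|r%:C| < 1 :> C.
  by have := normC_radius 0 hr; rewrite /expi cos0 sin0 mulr1.
have /cvg_ReIm[h1 h2] := psb _ z1.
have bnd (F : nat -> R) (l : R) : series F @ \oo --> l -> exists B, forall k, `|F k| <= B.
  move=> h; have : cvgn F by apply/cvgP; apply: cvg_series_cvg_0; exact: cvgP h.
  move=> /cvg_seq_bounded [B [_ hB]]; exists (B + 1) => k.
  by apply: hB => //; rewrite ltrDl.
have e1 : (fun n => Re (series (fun k => a k * r%:C ^+ k) n)) =
    series (fun k => Re (a k * r%:C ^+ k)) by apply/funext => n; exact: Re_sum.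
have e2 : (fun n => Im (series (fun k => a k * r%:C ^+ k) n)) =
    series (fun k => Im (a k * r%:C ^+ k)) by apply/funext => n; exact: Im_sum.
rewrite e1 in h1; rewrite e2 in h2.
have [B1 hB1] := bnd _ _ h1; have [B2 hB2] := bnd _ _ h2.
exists (B1 + B2) => k; have [_ [_]] := normc_ReIm (a k * r%:C ^+ k).
by move=> h; apply: le_trans h _; exact: lerD.
Qed.

Lemma normc_real (r : R) : normc r%:C = `|r|.
Proof. by rewrite /= expr0n addr0 sqrtr_sqr. Qed.

(** For p strictly between r and 1 the terms a_k p^k are bounded, since the series converges at p;
    hence a_k r^k is dominated by the geometric sequence (r / p)^k. *)
Lemma dilate_l2 a b (r : R) : power_series_on_disk a b -> 0 < r < 1 ->
  cvgn (sqsum (fun k => a k * r%:C ^+ k)).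
Proof.
move=> psb /andP[r0 r1]; pose p := (1 + r) / 2.
have p0 : 0 < p by rewrite /p; lra.
have hp : 0 <= p < 1 by rewrite /p; apply/andP; split; lra.
have [B hB] := ps_terms_bounded psb hp.
pose q := (r / p) ^+ 2.
have rp : r / p < 1 by rewrite ltr_pdivrMr // mul1r /p; lra.
have rp0 : 0 <= r / p by rewrite divr_ge0 // ltW.
have q1 : q < 1 by rewrite expr_lt1.
have q0 : 0 <= q by exact: sqr_ge0.
suff h n : sqsum (fun k => a k * r%:C ^+ k) n <= B ^+ 2 * (1 - q)^-1.
  by have [] := sqsum_bounded h.
apply: le_trans (_ : B ^+ 2 * \sum_(0 <= k < n) q ^+ k <= _); last first.
  by rewrite ler_wpM2l ?sqr_ge0 // geometric_sum_le.
rewrite /sqsum /series /= mulr_sumr; apply: ler_sum => k _.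
have -> : a k * r%:C ^+ k = a k * p%:C ^+ k * ((r / p) ^+ k)%:C.
  rewrite -mulrA -rmorphXn -rmorphXn /= -rmorphM /= -exprMn mulrCA divff ?mulr1 //.
  by rewrite gt_eqF.
rewrite normc_sqM normc_real ger0_norm ?exprn_ge0 // /q -!exprM mulnC.
rewrite ler_wpM2r ?exprn_ge0 // ler_sqr ?nnegrE ?normc_ge0 //.
exact: le_trans (normc_ge0 _) (hB k).
Qed.

(* Parseval for the dilates z |-> b (r z), which are bounded by M as well,
   followed by r -> 1. *)
Lemma bounded_l2 a b (M : R) : power_series_on_disk a b ->
  (forall z, `|z| < 1 -> normc (b z) <= M) -> forall K, sqsum a K <= M ^+ 2.
Proof.
move=> psb bM K.
have step (r : R) : 0 < r < 1 -> r ^+ (2 * K) * sqsum a K <= M ^+ 2.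
  move=> hr; have /andP[r0 r1] := hr.
  have hr0 : 0 <= r < 1 by rewrite ltW.
  have sr := dilate_l2 psb hr.
  have in_disk z : `|z| < 1 -> `|r%:C * z| < 1 :> C.
    rewrite !normC_lt1 Normc.normcM normc_real gtr0_norm // => z1.
    by apply: le_lt_trans r1; rewrite ler_piMr ?(ltW r0) // ltW.
  have psr : power_series_on_disk (fun k => a k * r%:C ^+ k) (fun z => b (r%:C * z)).
    move=> z /in_disk /psb.
    have -> : (series (fun k => a k * (r%:C * z) ^+ k : C^o)) =
      (series (fun k => a k * r%:C ^+ k * z ^+ k : C^o)).
      by congr series; apply/funext => k; rewrite exprMn mulrA.
    by [].
  have [g [bg Lg Ng]] := fatou_H2 sr psr.
  have gM : ae_arc (fun t => normc (g t) <= M).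
    by apply: bv_le bg _ => z /in_disk /bM.
  have M0 : 0 <= M.
    by apply: le_trans (normc_ge0 (b 0)) (bM _ _); rewrite normr0.
  have pi2 : 0 < 2 * pi :> R by rewrite mulr_gt0 // pi_gt0.
  have lim_le : limn (sqsum (fun k => a k * r%:C ^+ k)) <= M ^+ 2.
    rewrite -(ler_pM2l pi2) -Ng mulrC -arcint_cst.
    (* The bound by [M] holds only almost everywhere; the minimum makes it pointwise without
       changing the integral. *)
    rewrite (_ : arcint _ = arcint (fun s => Num.min (normc (g s) ^+ 2) (M ^+ 2))).
      have mg := cmeasurable_normc_sq (L2_meas Lg).
      have mm : measurable_fun arc (fun s => Num.min (normc (g s) ^+ 2) (M ^+ 2)).
        by apply: measurable_minr.
      apply: arcint_le; [|exact: arcL1_cst|by move=> s _; rewrite ge_min lexx orbT].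
      apply: arcL1_le (arcL1_cst (M ^+ 2)) _ => // s _.
      by rewrite ger0_norm ?le_min ?sqr_ge0 // ge_min lexx orbT.
    apply: arcint_ae.
    - exact: cmeasurable_normc_sq (L2_meas Lg).
    - by apply: measurable_minr => //; exact: cmeasurable_normc_sq (L2_meas Lg).
    - apply: ae_arcS gM => t _ h; rewrite min_l // ler_sqr ?nnegrE //.
      exact: normc_ge0.
  apply: le_trans lim_le; apply: le_trans (sqsum_le K sr).
  rewrite !sqsum_ord mulr_sumr; apply: ler_sum => k _; have kK := ltn_ord k.
  rewrite normc_sqM normcX normc_real gtr0_norm // -exprM mulrC mulnC.
  by rewrite ler_wpM2l ?sqr_ge0 // ler_wiXn2l ?(ltW r0) ?(ltW r1) // leq_mul2r /= ltnW.
have S0 : 0 <= sqsum a K by rewrite sqsum_ord sumr_ge0 // => i _; exact: sqr_ge0.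
apply/ler_addgt0Pr => e e0.
pose m : R := (2 * K)%:R.
have m0 : 0 <= m by [].
have d0 : 0 < m * sqsum a K + e + 1 by have := mulr_ge0 m0 S0; lra.
(* Bernoulli gives (1 - d)^(2 K) >= 1 - m d, so [d] is chosen to make the loss d m S at most [e],
   where S = [sqsum a K]. *)
pose d := Num.min (2^-1) (e / (m * sqsum a K + e + 1)).
have dd : 0 < d by rewrite lt_min invr_gt0 ltr0n /= divr_gt0.
have [d1 d2] : d <= 2^-1 /\ d <= e / (m * sqsum a K + e + 1).
  by split; rewrite /d ge_min lexx ?orbT.
clearbody d.
have hr : 0 < 1 - d < 1 by apply/andP; split; lra.
have hr' : 0 <= 1 - d <= 1 by apply/andP; split; lra.
have h1 := step _ hr; have h2 := bernoulli (2 * K) hr'.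
rewrite -/m opprB addrCA subrr addr0 in h2.
have h3 := ler_wpM2r S0 h2.
move: d2; rewrite ler_pdivlMr // => d2.
have := mulr_ge0 m0 S0.
have : 0 <= d * e by rewrite mulr_ge0 // ltW.
move: (m) (sqsum a K) S0 m0 d2 h3 h1 => x y *.
by nra.
Qed.

Lemma H2_mulz (h : C -> C) : H2 h -> H2 (fun z => z * h z).
Proof.
move=> hh; have [a psa sa] := H2_coef hh.
pose a' k := if k is k'.+1 then a k' else 0.
split; last by move=> z /hh.2 ->; rewrite mulr0.
exists a'; split.
  move=> z z1; have /cvg_ReIm[h1 h2] := psa z z1.
  have e n : series (fun k => a' k * z ^+ k) n.+1 = z * series (fun k => a k * z ^+ k) n.
    rewrite /series /= big_nat_recl //= mul0r add0r mulr_sumr.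
    by apply: eq_bigr => k _; rewrite exprS; ring.
  have c : (fun n => series (fun k => a' k * z ^+ k) n.+1 : C^o) @ \oo --> (z * h z : C^o).
    apply/cvg_ReIm; split.
      under eq_fun do rewrite e cReM; rewrite cReM.
      by apply: cvgB; apply: cvgM => //; exact: cvg_cst.
    under eq_fun do rewrite e cImM; rewrite cImM.
    by apply: cvgD; apply: cvgM => //; exact: cvg_cst.
  by move: c; rewrite (cvg_shiftS (series (fun k => a' k * z ^+ k : C^o))).
suff bn n : sqsum a' n <= limn (sqsum a) by have [] := sqsum_bounded bn.
apply: le_trans (sqsum_nd a' (leqnSn n)) _.
have -> : sqsum a' n.+1 = sqsum a n.
  by rewrite /sqsum /series /= big_nat_recl //= expr0n addr0 sqrtr0 expr0n add0r.
exact: sqsum_le.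
Qed.

Definition poly_sum a N (z : C) : C := \sum_(k < N) a k * z ^+ k.

Lemma H2_mul_poly a N (h : C -> C) : H2 h -> H2 (fun z => poly_sum a N z * h z).
Proof.
move=> hh; have hX k : H2 (fun z => z ^+ k * h z).
  elim: k => [|k IH]; first by under eq_fun do rewrite mul1r.
  by under eq_fun do rewrite exprS -mulrA; exact: H2_mulz.
elim: N => [|N IH].
  by under eq_fun do rewrite /poly_sum big_ord0 mul0r; exact: H2_0.
have := @H2_lin R (a N) _ _ (hX N) IH.
congr H2; apply/funext => z.
by rewrite /poly_sum big_ord_recr /=; ring.
Qed.

Lemma bv_poly a N : is_boundary_value (poly_sum a N) (trig_poly a N).
Proof.
have bvX k : is_boundary_value (fun z : C => z ^+ k) (fun t => expi t ^+ k).
  elim: k => [|k IH].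
    by under eq_fun do rewrite expr0; under [X in is_boundary_value _ X]eq_fun do rewrite expr0; exact: bv_cst.
  have b1 : is_boundary_value (fun z : C => z) (@expi R).
    split.
      split; apply: continuous_measurable_arc; [exact: continuous_cos|exact: continuous_sin].
    apply: ae_arc_all => t _.
    have h : (fun r : R => r) @ (1 : R)^'- --> (1 : R) by apply: cvg_at_left_filter; exact: cvg_id.
    have hc (c : R) : (fun r : R => r * c) @ (1 : R)^'- --> c.
      have hcst : (fun _ : R => c) @ (1 : R)^'- --> c by exact: cvg_cst.
      have h2 := cvgM h hcst; rewrite mul1r in h2.
      exact: h2.
    apply/cvg_ReIm; split.
      by under eq_fun do rewrite cReZ; exact: hc.
    by under eq_fun do rewrite cImM /= mul0r addr0; exact: hc.
  have := bvM b1 IH.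
  by under eq_fun do rewrite -exprS; under [X in is_boundary_value _ X]eq_fun do rewrite -exprS.
elim: N => [|N IH].
  have -> : poly_sum a 0 = (fun=> 0) by apply/funext => z; rewrite /poly_sum big_ord0.
  have -> : trig_poly a 0 = (fun=> 0) by apply/funext => z; rewrite /trig_poly big_ord0.
  exact: bv_cst.
have -> : poly_sum a N.+1 = (fun z => poly_sum a N z + a N * z ^+ N).
  by apply/funext => z; rewrite /poly_sum big_ord_recr.
have -> : trig_poly a N.+1 = (fun z => trig_poly a N z + a N * expi z ^+ N).
  by apply/funext => z; rewrite /trig_poly big_ord_recr.
exact: (bvD IH (bvM (bv_cst (a N)) (bvX N))).
Qed.

(** On the circle |p h| <= M |p| almost everywhere, and Parseval evaluates the norm of the
    polynomial p. *)
Lemma H2_mul_poly_norm a N (h : C -> C) (M : R) : H2 h -> 0 <= M ->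
  (forall z, `|z| < 1 -> normc (h z) <= M) ->
  Re (H2_inner (fun z => poly_sum a N z * h z) (fun z => poly_sum a N z * h z)) <=
  M ^+ 2 * sqsum a N.
Proof.
move=> hh M0 hM; have bh := H2_bv hh; have gM := bv_le bh hM.
have bp := bvM (bv_poly a N) bh.
have pi2 : 0 < 2 * pi :> R by rewrite mulr_gt0 // pi_gt0.
rewrite (H2_inner_bv bp bp) Re_L2_inner -(ler_pM2l pi2) mulrA divff ?gt_eqF // mul1r.
have [i1 e1] := arcint_tp_sq a N.
rewrite mulrCA sqsum_ord -e1 -arcintZ //.
have mt := cmeasurable_normc_sq bp.1.
rewrite (_ : arcint _ = arcint (fun s => Num.min
   (normc (trig_poly a N s * boundary h s) ^+ 2) (M ^+ 2 * normc (trig_poly a N s) ^+ 2))).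
  have i2 := arcL1Z (M ^+ 2) i1.
  have mm : measurable_fun arc (fun s => Num.min (normc (trig_poly a N s * boundary h s) ^+ 2)
     (M ^+ 2 * normc (trig_poly a N s) ^+ 2)).
    by apply: measurable_minr => //; exact: arcL1_meas i2.
  apply: arcint_le => //; last by move=> s _; rewrite ge_min lexx orbT.
  apply: arcL1_le i2 _ => // s _.
  rewrite ger0_norm; first by rewrite ge_min lexx orbT.
  by rewrite le_min sqr_ge0 /= mulr_ge0 // sqr_ge0.
apply: arcint_ae => //.
  by apply: measurable_minr => //; exact: (arcL1_meas (arcL1Z (M ^+ 2) i1)).
apply: ae_arcS gM => t _ hb; rewrite min_l // normc_sqM mulrC.
by rewrite ler_wpM2r ?sqr_ge0 // ler_sqr ?nnegrE ?normc_ge0.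
Qed.

(* b is itself in H2, so b p is for every Taylor polynomial p of f, and these
   products are Cauchy because b is bounded by M on the circle. *)
Theorem Hinfty_mul b f : Hinfty b -> H2 f -> H2 (fun z => b z * f z).
Proof.
move=> [[beta psb] [M bM]] hf.
have M0 : 0 <= M by apply: le_trans (normc_ge0 (b 0)) (bM _ _); rewrite normr0.
(* [Hinfty] leaves the values off the disk free, whereas [H2] requires them to vanish. *)
pose b1 z := if `|z| < 1 then b z else 0.
have b1E z : `|z| < 1 -> b1 z = b z by rewrite /b1 => ->.
have psb1 : power_series_on_disk beta b1 by move=> z z1; rewrite b1E //; exact: psb.
have hb1 : H2 b1.
  split; last by move=> z /negbTE h; rewrite /b1 h.
  by exists beta; split => //; have [] := sqsum_bounded (bounded_l2 psb bM).
have b1M z : `|z| < 1 -> normc (b1 z) <= M by move=> z1; rewrite b1E //; exact: bM.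
have [a psa sa] := H2_coef hf.
pose F N z := poly_sum a N z * b1 z.
have hF N : H2 (F N) by exact: H2_mul_poly.
have hFp N : (F N : C -> C^o) \in @H2_pred R by apply/H2_predP.
pose u N : H2_type R := H2Elt (hFp N).
have hip := H2ip_semi_inner (R := R).
have diff N K : (N <= K)%N -> H2ip (u K - u N) (u K - u N) <= M ^+ 2 * (sqsum a K - sqsum a N).
  move=> NK; have := H2_mul_poly_norm (fun k => if (N <= k)%N then a k else 0) K hb1 M0 b1M.
  have e1 : sqsum (fun k => if (N <= k)%N then a k else 0) K = sqsum a K - sqsum a N.
    by rewrite sqsum_ord; exact: sqsum_cut.
  have e : H2_val (u K - u N) =
      (fun z => poly_sum (fun k => if (N <= k)%N then a k else 0) K z * b1 z).
    apply/funext => z; rewrite /= /F -mulrBl; congr (_ * _).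
    rewrite -[LHS]/(poly_sum a K z - poly_sum a N z).
    rewrite /poly_sum -(subnKC NK) !big_split_ord /= addrAC subrr add0r.
    rewrite [X in _ = X + _]big1 ?add0r; last by move=> k _; rewrite leqNgt ltn_ord mul0r.
    by apply: eq_bigr => k _; rewrite leq_addr.
  by rewrite e1 /H2ip e => h; exact: h.
have [h hh] : exists l, ipcvg H2ip u l.
  apply: (hilbert_complete (H2_hilbert (R := R))) => e e0.
  have d0 : 0 < e ^+ 2 / (M ^+ 2 + 1).
    by rewrite divr_gt0 ?exprn_gt0 // ltr_wpDl ?sqr_ge0.
  have [N hN] := sqsum_tail sa d0.
  have key m n : (N <= n)%N -> (n <= m)%N -> ipnorm H2ip (u m - u n) <= e.
    move=> Nn nm; rewrite -(@ler_sqr _ (ipnorm _ _)) ?nnegrE ?(ltW e0) ?ipnorm_ge0 //.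
    rewrite (ipnorm_sq hip); apply: le_trans (diff _ _ nm) _.
    have h1 : sqsum a m - sqsum a n <= e ^+ 2 / (M ^+ 2 + 1).
      by have := hN n Nn; have := sqsum_le m sa; lra.
    apply: le_trans (ler_wpM2l (sqr_ge0 M) h1) _.
    rewrite mulrCA ler_piMr ?sqr_ge0 // ler_pdivrMr ?mul1r ?lerDl ?ler01 //.
    by rewrite ltr_wpDl ?sqr_ge0.
  exists N => m n Nm Nn; have [nm|mn] := leqP n m; first exact: key.
  by rewrite (ipnormBC hip) key // ltnW.
(* Convergence in norm implies pointwise convergence by [H2_eval], and this identifies the limit. *)
have hE z : h z = b z * f z.
  have [z1|z1] := boolP (`|z| < 1); last by rewrite (H2_valP h).2 // hf.2 // mulr0.
  apply/eqP; rewrite -subr_eq0; apply/eqP; apply: Normc.eq0_normc.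
  apply/eqP; rewrite eq_le normc_ge0 andbT; apply/ler_addgt0Pr => e e0; rewrite add0r.
  have [K K0 hK] := H2_eval z1.
  have e4 : 0 < e / 4 by rewrite divr_gt0.
  have eta0 : 0 < e / 4 / (K + 1) by rewrite divr_gt0 // ltr_wpDl.
  set eta := e / 4 / (K + 1) in eta0.
  (* A norm that is at most 1 and at most x has square at most x, which is the form [H2_eval]
     takes. *)
  have d0 : 0 < Num.min 1 (e / 4 * (2 * eta)) by rewrite lt_min ltr01 (mulr_gt0 e4) // mulr_gt0.
  have [N1 hN1] := hh _ d0.
  have M1 : 0 < M + 1 by rewrite ltr_wpDl.
  have /cvg_normcP /(_ _ (divr_gt0 e4 M1)) [N2 _ hN2] := psa z z1.
  pose N := maxn N1 N2.
  have h1 := hN1 N (leq_maxl _ _); have h2 := hN2 N (leq_maxr _ _).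
  have h3 := hK (u N - h) eta eta0.
  have h4 : H2ip (u N - h) (u N - h) <= e / 4 * (2 * eta).
    move: h1; rewrite le_min => /andP[h11 h12]; rewrite -(ipnorm_sq hip) expr2.
    apply: le_trans (_ : ipnorm H2ip (u N - h) * 1 <= _); last by rewrite mulr1.
    by rewrite ler_wpM2l ?ipnorm_ge0.
  have h5 : normc ((u N - h) z) <= e / 2.
    apply: le_trans h3 _.
    have a1 : H2ip (u N - h) (u N - h) / (2 * eta) <= e / 4.
      by rewrite ler_pdivrMr // mulr_gt0.
    have a2 : eta * K <= e / 4.
      rewrite /eta mulrAC ler_pdivrMr; last by rewrite ltr_wpDl.
      by rewrite ler_pM2l // lerDl ler01.
    by lra.
  have e6 : h z - b z * f z = - (u N - h) z + b z * (poly_sum a N z - f z).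
    have -> : (u N - h) z = poly_sum a N z * b z - h z.
      by rewrite -(b1E z z1).
    by ring.
  rewrite e6; apply: le_trans (le_normcD _ _) _.
  rewrite normcN Normc.normcM.
  have h7 : normc (poly_sum a N z - f z) <= e / 4 / (M + 1).
    rewrite -normcN opprB; move: h2; rewrite /series /= big_mkord => h2.
    exact: ltW h2.
  have h8 : normc (b z) * normc (poly_sum a N z - f z) <= M * (e / 4 / (M + 1)).
    by apply: ler_pM => //; [exact: normc_ge0|exact: normc_ge0|exact: bM].
  have h9 : M * (e / 4 / (M + 1)) <= e / 4.
    by rewrite mulrCA ler_piMr ?(ltW e4) // ler_pdivrMr // mul1r lerDl ler01.
  by lra.
by have := H2_valP h; congr H2; apply/funext => z; rewrite hE.
Qed.

End BoundedMultiplier.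

(** * Toeplitz operators as multiplications and their adjoints *)

Section Toeplitz.
Context {R : realType}.
Local Notation C := R[i].
Local Notation Re := (@complex.Re R).
Local Notation Im := (@complex.Im R).
Local Notation normc := Normc.normc.
Local Notation HT := (H2_type R).
Let hH : hilbert (@H2ip R) := H2_hilbert.
Let hip : semi_inner (@H2ip R) := hH.
Implicit Types (f g k : HT).

Lemma H2_elt (f : C -> C) : H2 f -> exists F : HT, H2_val F = f.
Proof.
move=> hf; have hp : (f : C -> C^o) \in @H2_pred R by apply/H2_predP.
by exists (H2Elt hp).
Qed.

(** Re <f, i g> = Im <f, g>, so identities proved for [H2ip] lift to the complex scalar product. *)
Lemma H2_innerE_ip f g : H2_inner f g = H2ip f g +i* H2ip f ('i%C *: g).
Proof.
have e : H2_inner f ('i%C *: g : HT) = - 'i%C * H2_inner f g.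
  have J (x y : HT) : H2_inner y x = conjc (H2_inner x y).
    by apply: H2_innerC; exact: H2_valP.
  have Z : H2_inner ('i%C *: g : HT) f = 'i%C * H2_inner g f.
    exact: (H2_innerZl 'i%C (H2_valP g) (H2_valP f)).
  by rewrite (J ('i%C *: g) f) Z rmorphM /= (J g f); apply: complex_eq; rewrite ?cReM ?cImM /=; ring.
apply: complex_eq => //=.
by rewrite /H2ip e cReM /= oppr0; ring.
Qed.

(** The given [h] shows that the choice in [riesz_proj] is possible; two candidates have the same
    scalar products with all of H2, hence agree. *)
Lemma riesz_proj_unique (u : R -> C) (h : HT) : L2 u ->
  (forall k, L2_inner u (boundary k) = H2_inner h k) -> riesz_proj u = h.
Proof.
move=> Lu hu.
have L2N (v : R -> C) : L2 v -> L2 (fun t => - v t).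
  by move=> /(L2Z (-1)); under eq_fun do rewrite mulN1r.
have sub (F k : HT) : L2_inner (fun t => u t - boundary F t) (boundary k) =
    L2_inner u (boundary k) - H2_inner F k.
  have LF := H2_L2 (H2_valP F); have Lk := H2_L2 (H2_valP k).
  rewrite L2_innerDl //; last exact: L2N.
  have := L2_innerZl (-1) LF Lk; rewrite mulN1r.
  have -> : (fun t => -1 * boundary F t) = (fun t => - boundary F t).
    by apply/funext => t; rewrite mulN1r.
  by move=> ->.
pose P : set (C -> C) := [set h | H2 h /\
  forall k : C -> C, H2 k -> L2_inner (fun t => u t - boundary h t) (boundary k) = 0].
have hP : exists h, P h.
  by exists h; split; [exact: H2_valP|move=> k0 /H2_elt[k <-]; rewrite sub hu subrr].
have [h1 h2] : P (riesz_proj u) := xgetPex _ hP.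
have [F FE] := H2_elt h1; rewrite -FE in h2 *.
suff -> : F = h by [].
apply: (ip_ext hH) => k; have := h2 k (H2_valP k); rewrite sub hu => /eqP.
by rewrite subr_eq0 => /eqP e; rewrite /H2ip e.
Qed.

Section Multiplier.
Variables (b : C -> C) (gb : R -> C).
Hypothesis bb : is_boundary_value b gb.
Hypothesis gb1 : ae_arc (fun t => normc (gb t) <= 1).
Variables M Ma : HT -> HT.
Hypothesis ME : forall f z, M f z = b z * f z.
Hypothesis adjM : forall f g, H2ip (M f) g = H2ip f (Ma g).

Lemma mult_linear : linear_map M.
Proof.
move=> c f g; apply: H2_val_inj => z.
rewrite -[RHS]/(c * M f z + M g z) !ME.
rewrite -[(c *: f + g) z]/(c * f z + g z); by ring.
Qed.

Lemma adj_complex f g : H2_inner (Ma f) g = H2_inner f (M g).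
Proof.
have e k : H2ip (Ma f) k = H2ip f (M k).
  by rewrite (ip_sym hip) -adjM (ip_sym hip).
by rewrite !H2_innerE_ip !e (linear_mapZ mult_linear).
Qed.

Let mb : cmeasurable (boundary b). Proof. by case: (boundary_bv bb). Qed.

Let bb1 : ae_arc (fun t => normc (boundary b t) <= 1).
Proof.
by have := ae_arcI (boundary_ae bb) gb1; apply: ae_arcS => t _ [-> ].
Qed.

Lemma MbE f : H2_val (M f) = (fun z => b z * f z).
Proof. by apply/funext => z; exact: ME. Qed.

Let bvMf f : is_boundary_value (M f) (fun t => boundary b t * boundary f t).
Proof. by rewrite MbE; apply: bvM; [exact: boundary_bv bb|exact: H2_bv (H2_valP f)]. Qed.

(** The product b f is already the boundary function of an element of H2, so the projection fixes
    it. *)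
Lemma toeplitz_analytic f : toeplitz (boundary b) f = M f.
Proof.
have Lf := H2_L2 (H2_valP f).
apply: riesz_proj_unique; first exact: (L2_mul_bounded mb bb1).
by move=> k; symmetry; apply: H2_inner_bv; [exact: bvMf|exact: H2_bv (H2_valP k)].
Qed.

(** Moving conj b across the integral gives <conj b f, k> = <f, b k>, which is the defining property
    of the adjoint. *)
Lemma toeplitz_coanalytic f : toeplitz (fun t => conjc (boundary b t)) f = Ma f.
Proof.
have Lf := H2_L2 (H2_valP f).
have mJ := cmeasurableJ mb.
apply: riesz_proj_unique.
  apply: (L2_mul_bounded mJ (M := 1)) => //.
  apply: ae_arcS bb1 => t _.
  have -> // : normc (conjc (boundary b t)) = normc (boundary b t).
  by case: (boundary b t) => x y /=; rewrite sqrrN.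
move=> k; rewrite adj_complex (H2_inner_bv (H2_bv (H2_valP f)) (bvMf k)).
congr cmean; apply/funext => t.
by rewrite rmorphM /=; ring.
Qed.

Lemma defect_operatorE f : defect_operator b f = (f - M (Ma f) : HT).
Proof.
apply/funext => z; rewrite /defect_operator toeplitz_coanalytic toeplitz_analytic.
by [].
Qed.

Hypothesis conM : forall f, ipnorm (@H2ip R) (M f) <= ipnorm (@H2ip R) f.

Lemma adj_contraction f : ipnorm (@H2ip R) (Ma f) <= ipnorm (@H2ip R) f.
Proof.
have n0 := ipnorm_ge0 (Ma f) (ip := @H2ip R).
have h : ipnorm (@H2ip R) (Ma f) ^+ 2 <= ipnorm (@H2ip R) (Ma f) * ipnorm (@H2ip R) f.
  rewrite (ipnorm_sq hip) -adjM; apply: le_trans (ler_norm _) _.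
  apply: le_trans (cauchy_schwarz hip _ _) _.
  by rewrite ler_wpM2r ?ipnorm_ge0.
move: n0; rewrite le_eqVlt => /orP[/eqP <-|n0]; first exact: ipnorm_ge0.
by move: h; rewrite expr2 ler_pM2l.
Qed.

(** [sqrt_operator] chooses among maps on all functions, so a root built on the subtype has to be
    extended to witness that the choice is possible. *)
Lemma positive_operator_lift (S : HT -> HT) : linear_map S ->
  (forall f g, H2ip (S f) g = H2ip f (S g)) -> (forall f, 0 <= H2ip (S f) f) ->
  (forall f, ipnorm (@H2ip R) (S f) <= 2 * ipnorm (@H2ip R) f) ->
  exists2 S' : (C -> C) -> (C -> C), positive_operator S' & forall f, S' f = S f.
Proof.
move=> linS symS posS bndS.
have /choice[S' hS'] (f : C -> C) : exists h : C -> C, forall F : HT, H2_val F = f -> h = S F.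
  have [/H2_elt[F FE]|nf] := pselect (H2 f).
    exists (S F) => G GE; congr (H2_val (S _)); apply: val_inj.
    by rewrite /= FE GE.
  (* Outside [H2] the condition is vacuous and any value serves. *)
  by exists f => F FE; case: nf; rewrite -FE; exact: H2_valP.
have S'E f : S' f = S f by exact: hS'.
exists S'; last exact: S'E.
have cplx f g : H2_inner (S f) g = H2_inner f (S g).
  by rewrite !H2_innerE_ip !symS (linear_mapZ linS).
split.
- split.
  + by move=> f /H2_elt[F <-]; rewrite S'E; exact: H2_valP.
  + move=> c f g /H2_elt[F <-] /H2_elt[G <-]; rewrite !S'E.
    by rewrite -[(fun z => c * F z + G z)]/(H2_val (c *: F + G)) S'E linS.
  + by exists 2 => f /H2_elt[F <-]; rewrite S'E; exact: bndS.
- by move=> f g /H2_elt[F <-] /H2_elt[G <-]; rewrite !S'E cplx.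
- move=> f /H2_elt[F <-]; rewrite S'E.
  have := H2_innerC (H2_valP F) (H2_valP (S F)); rewrite cplx => e.
  (* The order on [C] compares real parts only when imaginary parts agree; symmetry makes this one
     equal to its own negative. *)
  have im0 : Im (H2_inner F (S F)) = 0.
    have : Im (H2_inner F (S F)) = - Im (H2_inner F (S F)) by rewrite {1}e cImJ.
    by move: (Im _) => x; lra.
  have := posS F; rewrite /H2ip cplx => p.
  by rewrite lecE im0 eqxx; exact: p.
Qed.

(** [positive_sqrt] makes the choice in [sqrt_operator] possible, and the chosen root, whichever it
    is, restricts to the subtype with the two properties that Douglas' lemma uses: symmetry and a
    known square. *)
Lemma deBranges_Rovnyak_range : exists S : HT -> HT,
  [/\ linear_map S, forall f g, H2ip (S f) g = H2ip f (S g),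
     forall f, S (S f) = f - M (Ma f) &
     deBranges_Rovnyak b = [set H2_val (S f) | f in [set: HT]]].
Proof.
have linM := mult_linear.
have linMa : linear_map Ma := adjoint_linear hH linM adjM.
have [S0 [lin0 sym0 pos0 bnd0 sq0]] := @positive_sqrt _ _ _ hH (fun f => M (Ma f))
  (fun c f g => etrans (congr1 M (linMa c f g)) (linM c _ _))
  (fun f g => etrans (adjM _ _) (etrans (ip_sym hip _ _) (etrans (esym (adjM _ _)) (ip_sym hip _ _))))
  (fun f => le_trans (conM _) (adj_contraction f)).
have [S' posS' S'E] := positive_operator_lift lin0 sym0 pos0 bnd0.
pose P : set ((C -> C) -> (C -> C)) := [set S | positive_operator S /\
    forall f : C -> C, H2 f -> S (S f) = defect_operator b f].
have hP : exists S, P S.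
  exists S'; split; first exact: posS'.
  by move=> f0 /H2_elt[f <-]; rewrite !S'E defect_operatorE sq0.
have [[[clS linS _] symS _] sqS] : P (sqrt_operator (defect_operator b)) := xgetPex _ hP.
set Q := sqrt_operator (defect_operator b) in clS linS symS sqS *.
have /choice[S hS] (f : HT) : exists F : HT, H2_val F = Q f.
  exact: H2_elt (clS _ (H2_valP f)).
exists S; split.
- move=> c f g; apply: val_inj => /=; rewrite hS.
  rewrite -[H2_val (c *: f + g)]/(fun z => c * f z + g z) linS; try exact: H2_valP.
  by rewrite -!hS.
- by move=> f g; rewrite /H2ip !hS symS //; exact: H2_valP.
- by move=> f; apply: val_inj => /=; rewrite !hS sqS ?defect_operatorE //; exact: H2_valP.
- rewrite /deBranges_Rovnyak -/Q; apply/seteqP; split.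
    by move=> _ [f0 /H2_elt[f <-] <-]; exists f.
  by move=> _ [f _ <-]; exists (H2_val f); [exact: H2_valP|rewrite hS].
Qed.

End Multiplier.
End Toeplitz.

(** * Multiplication by an inner function and comparison of the ranges *)

Section InnerMultiplier.
Context {R : realType}.
Local Notation C := R[i].
Local Notation normc := Normc.normc.
Local Notation HT := (H2_type R).
Local Notation ip := (@H2ip R).
Let hH : hilbert ip := H2_hilbert.
Let hip : semi_inner ip := hH.
Variables (I : C -> C) (g : R -> C).
Hypothesis HI : Hinfty I.
Hypothesis bI : is_boundary_value I g.
Hypothesis g1 : ae_arc (fun t => normc (g t) = 1).

Lemma inner_mult : exists T : HT -> HT, (forall f z, T f z = I z * f z) /\
  forall f k, ip (T f) (T k) = ip f k.
Proof.
have /choice[T hT] (f : HT) : exists F : HT, H2_val F = (fun z => I z * f z).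
  exact: H2_elt (Hinfty_mul HI (H2_valP f)).
exists T; split=> [f z|f k]; first by rewrite hT.
suff e : H2_inner (T f) (T k) = H2_inner f k by rewrite /H2ip e.
rewrite !hT.
have bf := bvM bI (H2_bv (H2_valP f)); have bk := bvM bI (H2_bv (H2_valP k)).
rewrite (H2_inner_bv bf bk).
have [m1 m2] := (bf.1, bk.1).
have [m3 m4] := ((H2_bv (H2_valP f)).1, (H2_bv (H2_valP k)).1).
apply: cmean_ae.
- by apply: cmeasurableM => //; exact: cmeasurableJ.
- by apply: cmeasurableM => //; exact: cmeasurableJ.
- apply: ae_arcS g1 => t _ e; rewrite rmorphM /=.
  have e1 : g t * conjc (g t) = 1.
    rewrite -sqr_normc -[`|g t|]/((normc (g t))%:C) e.
    by rewrite rmorph1 expr1n.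
  transitivity (g t * conjc (g t) * (boundary f t * conjc (boundary k t))); first by ring.
  by rewrite e1 mul1r.
Qed.

Definition shifted_avg n (z : C) : C := I z ^+ n * (1 + I z) / 2.

Lemma bv_shifted_avg n :
  is_boundary_value (shifted_avg n) (fun t => g t ^+ n * (1 + g t) / 2).
Proof.
have bX : is_boundary_value (fun z => I z ^+ n) (fun t => g t ^+ n).
  elim: n => [|n IH]; first exact: (bv_cst 1).
  by under eq_fun do rewrite exprS; under [X in is_boundary_value _ X]eq_fun do rewrite exprS; exact: bvM.
exact: (bvM (bvM bX (bvD (bv_cst 1) bI)) (bv_cst 2^-1)).
Qed.

Lemma shifted_avg_le1 n : ae_arc (fun t => normc (g t ^+ n * (1 + g t) / 2) <= 1).
Proof.
apply: ae_arcS g1 => t _ e.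
rewrite !Normc.normcM normcX e expr1n mul1r Normc.normcV.
have -> : normc (2 : C) = 2 by rewrite -(rmorph_nat (real_complex R) 2) normc_real ger0_norm.
rewrite ler_pdivrMr // mul1r; apply: le_trans (le_normcD _ _) _.
by rewrite e -[1 : C]/((1 : R)%:C) normc_real normr1.
Qed.

Lemma range_shifted_avg n :
  deBranges_Rovnyak (shifted_avg n) = deBranges_Rovnyak (shifted_avg 0).
Proof.
have [T [TE isoT]] := inner_mult.
have linT : linear_map T by apply: (mult_linear TE).
have nT f : ipnorm ip (T f) = ipnorm ip f by rewrite /ipnorm isoT.
have [Ta adjT] : exists Ta : HT -> HT, forall f k, ip (T f) k = ip f (Ta k).
  by apply: (adjoint_exists hH linT (M := 1)) => f; rewrite mul1r nT.
have linTa := adjoint_linear hH linT adjT.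
pose half : C := (2^-1 : R)%:C.
pose M m (f : HT) : HT := half *: (iter m T f + iter m T (T f)).
have iterE m (f : HT) z : iter m T f z = I z ^+ m * f z.
  elim: m => [|m IH] /=; first by rewrite expr0 mul1r.
  by rewrite TE IH exprS mulrA.
have halfE : half = 2^-1 by rewrite /half fmorphV rmorph_nat.
have ME m (f : HT) z : M m f z = shifted_avg m z * f z.
  rewrite -[LHS]/(half * (iter m T f z + iter m T (T f) z)) !iterE TE halfE.
  by rewrite /shifted_avg; ring.
have iter_adj m (f k : HT) : ip (iter m T f) k = ip f (iter m Ta k).
  elim: m f k => [|m IH] f k; first by [].
  by rewrite iterS adjT IH iterSr.
have adjM m (f k : HT) : ip (M m f) k = ip f (avg_adj Ta m k).
  rewrite /M /avg_adj (ip_scaler hip) (ip_scalerr hip) (ip_addl hip) (ip_addr hip).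
  by rewrite !iter_adj adjT -iterS iterSr.
have niter m (f : HT) : ipnorm ip (iter m T f) = ipnorm ip f.
  elim: m => [|m IH]; first by [].
  by rewrite iterS nT.
have conM m (f : HT) : ipnorm ip (M m f) <= ipnorm ip f.
  rewrite (ipnormZ hip) ger0_norm ?invr_ge0 //.
  have := ipnormD hip (iter m T f) (iter m T (T f)); rewrite !niter nT.
  by move: (ipnorm ip (_ + _)) (ipnorm ip f) => x y; lra.
(* Symmetry gives |S f|^2 = <S^2 f, f>, which depends on the square of [S] alone. *)
have sqE m (S : HT -> HT) : (forall f k, ip (S f) k = ip f (S k)) ->
    (forall f, S (S f) = f - M m (avg_adj Ta m f)) ->
    forall f, ip (S f) (S f) = defect (ip := ip) Ta m f.
  move=> symS sqS f; rewrite symS sqS (ip_subr hip) /defect.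
  by rewrite (ip_sym hip f (M _ _)) adjM.
have [Sn [linSn symSn sqSn ->]] := deBranges_Rovnyak_range (bv_shifted_avg n)
  (shifted_avg_le1 n) (ME n) (adjM n) (conM n).
have [S0 [linS0 symS0 sqS0 ->]] := deBranges_Rovnyak_range (bv_shifted_avg 0)
  (shifted_avg_le1 0) (ME 0%N) (adjM 0%N) (conM 0%N).
have En := sqE _ _ symSn sqSn; have E0 := sqE _ _ symS0 sqS0.
have incl (A B : HT -> HT) (c : R) : linear_map A -> linear_map B ->
    (forall f k, ip (A f) k = ip f (A k)) -> (forall f k, ip (B f) k = ip f (B k)) ->
    (forall f, ip (A f) (A f) <= c * ip (B f) (B f)) ->
    [set H2_val (A f) | f in [set: HT]] `<=` [set H2_val (B f) | f in [set: HT]].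
  move=> lA lB sA sB le _ [f _ <-].
  (* [range_inclusion] takes the constant as a square, and (|c| + 1)^2 >= c for every real c. *)
  have [||k ->] := @range_inclusion _ _ _ hH A B (`|c| + 1) lA lB sA sB _ _ f.
  - move=> h; apply: le_trans (le h) _; rewrite ler_wpM2r ?(ip_ge0 hip) //.
    by have := ler_norm c; have := sqr_ge0 `|c|; have := normr_ge0 c; nra.
  - by rewrite addr_ge0.
  - by exists k.
have [c1 h1] := defect_le hip isoT adjT linT linTa n.
have [c2 h2] := defect_ge hip isoT adjT linT linTa n.
apply/seteqP; split; [apply: (incl _ _ c1)|apply: (incl _ _ c2)] => // f.
  by rewrite En E0.
by rewrite En E0.
Qed.

End InnerMultiplier.

Theorem proposition1 (R : realType) (I : R[i] -> R[i]) (n : nat) :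
  inner I ->
  ~ (exists c : R[i], forall z : R[i], `|z| < 1 -> I z = c) ->
  (0 < n)%N ->
  deBranges_Rovnyak (fun z => I z ^+ n * (1 + I z) / 2) =
  deBranges_Rovnyak (fun z => (1 + I z) / 2).
Proof.
move=> [HI [g [bI g1]]] _ _.
(* In [inner] the modulus is an element of [C]; the embedding of [R] is injective. *)
have ng : ae_arc (fun t => Normc.normc (g t) = 1).
  apply: (ae_arcS _ (g1 : ae_arc _)) => t _ e; apply: complexI.
  by rewrite -[LHS]/(`|g t|) e rmorph1.
have := range_shifted_avg HI bI ng n.
have -> : shifted_avg I 0 = (fun z => (1 + I z) / 2).
  by apply/funext => z; rewrite /shifted_avg expr0 mul1r.
by [].
Qed.
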